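(* Let $H:[0,T]\times\mathbb{R}^N\times\mathbb{R}^N\to\mathbb{R}$ satisfy (H1)–(H4) and let $g:\mathbb{R}^N\to\mathbb{R}\cup\{\pm\infty\}$ be proper and lower semicontinuous. If $V$ is the value function associated with $H^*$ and $g$, then $V$ is a lower semicontinuous solution of the Cauchy problem $-U_t+H(t,x,-U_x)=0$ in $(0,T)\times\mathbb{R}^N$, $U(T,x)=g(x)$ in $\mathbb{R}^N$.
   Context: $\mathbb{B}_R$ is the closed ball of radius $R$ at $0$; proper means never $-\infty$ and not identically $+\infty$. (H1) $H$ is continuous in all variables. (H2) $H(t,x,p)$ is convex in $p$. (H3) for every $R\geq0$ there is $C_R\geq0$ with $|H(t,x,p)-H(t,x,q)|\leq C_R|p-q|$ for all $t\in[0,T]$, $x\in\mathbb{B}_R$, $p,q$. (H4) there is an integrable $c:[0,T]\to[0,\infty)$ with $|H(t,x,p)-H(t,x,q)|\leq c(t)(1+|x|)|p-q|$ for a.e. $t$ and all $x,p,q$. $H^*(t,x,v)=\sup_p\{\langle v,p\rangle-H(t,x,p)\}$. Value function: $V(t_0,x_0)=\inf\{g(x(T))+\int_{t_0}^TH^*(t,x(t),\dot x(t))\,dt\}$ over absolutely continuous $x:[t_0,T]\to\mathbb{R}^N$ with $x(t_0)=x_0$, for $t_0\in[0,T)$; $V(T,x_0)=g(x_0)$. Subderivative: $d\varphi(z)(v)=\liminf_{\tau\to0^+,y\to v}(\varphi(z+\tau y)-\varphi(z))/\tau$; subdifferential $\partial\varphi(z)=\{p:\langle v,p\rangle\leq d\varphi(z)(v)\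 \forall v\}$ (functions on $[0,T]\times\mathbb{R}^N$ regarded as $+\infty$ outside). $\mathrm{dom}\,U=\{(t,x):U(t,x)\neq\pm\infty\}$. A lower semicontinuous solution is a lower semicontinuous $U:[0,T]\times\mathbb{R}^N\to\mathbb{R}\cup\{+\infty\}$ with $U(T,x)=g(x)$ for all $x$, such that for every $(t,x)\in\mathrm{dom}\,U$ and $(p_t,p_x)\in\partial U(t,x)$: $-p_t+H(t,x,-p_x)\geq0$ if $0\leq t<T$ and $-p_t+H(t,x,-p_x)\leq0$ if $0<t\leq T$. *)

(* Defs.v *)
From HB Require Import structures.
From mathcomp Require Import all_boot all_order all_algebra.
From mathcomp Require Import all_classical all_reals all_analysis.
Set Implicit Arguments. Unset Strict Implicit. Unset Printing Implicit Defensive.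
Import Order.TTheory GRing.Theory Num.Theory.
Import numFieldNormedType.Exports.
Local Open Scope classical_set_scope.
Local Open Scope ring_scope.

Section Defs.
Variables (R : realType) (N : nat).
Notation vec := 'rV[R]_N.

Definition dotv (u v : vec) : R := \sum_(i < N) u ord0 i * v ord0 i.
Definition enorm (v : vec) : R := Num.sqrt (dotv v v).

Definition H1 (T : R) (H : R -> vec -> vec -> R) : Prop :=
  {within [set z : R * vec * vec | 0 <= z.1.1 <= T],
    continuous (fun z : R * vec * vec => H z.1.1 z.1.2 z.2)}.

Definition H2 (T : R) (H : R -> vec -> vec -> R) : Prop :=
  forall t x p q (l : R), 0 <= t <= T -> 0 <= l <= 1 ->
    H t x (l *: p + (1 - l) *: q) <= l * H t x p + (1 - l) * H t x q.

Definition H3 (T : R) (H : R -> vec -> vec -> R) : Prop :=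
  forall r : R, 0 <= r -> exists2 C : R, 0 <= C &
    forall t x p q, 0 <= t <= T -> enorm x <= r ->
      `|H t x p - H t x q| <= C * enorm (p - q).

Definition H4 (T : R) (H : R -> vec -> vec -> R) : Prop :=
  exists c : R -> R,
    [/\ (forall t, 0 <= t <= T -> 0 <= c t),
        (@lebesgue_measure R).-integrable [set t | 0 <= t <= T] (EFin \o c) &
        {ae @lebesgue_measure R, forall t, 0 <= t <= T ->
           forall x p q, `|H t x p - H t x q| <= c t * (1 + enorm x) * enorm (p - q)}].

Definition Hstar (H : R -> vec -> vec -> R) (t : R) (x v : vec) : \bar R :=
  ereal_sup (range (fun p : vec => (dotv v p - H t x p)%:E)).

Definition abs_cont_on (a b : R) (x : R -> vec) : Prop :=
  forall e : R, 0 < e -> exists2 d : R, 0 < d &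
    forall (n : nat) (l r : 'I_n -> R),
      (forall k, a <= l k /\ l k <= r k /\ r k <= b) ->
      (forall k k', k != k' -> r k <= l k' \/ r k' <= l k) ->
      \sum_(k < n) (r k - l k) < d ->
      \sum_(k < n) enorm (x (r k) - x (l k)) < e.

Definition xdot (x : R -> vec) (t : R) : vec :=
  \row_(i < N) derive1 (fun s => x s ord0 i) t.

Definition cost (H : R -> vec -> vec -> R) (g : vec -> \bar R) (T t0 : R)
    (x : R -> vec) : \bar R :=
  (g (x T) + \int[@lebesgue_measure R]_(s in [set s : R | (t0 <= s <= T)%R])
              Hstar H s (x s) (xdot x s))%E.

Definition value_function (H : R -> vec -> vec -> R) (g : vec -> \bar R) (T : R)
    (t0 : R) (x0 : vec) : \bar R :=
  if (0 <= t0) && (t0 < T) then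
    ereal_inf [set cost H g T t0 x | x in
                 [set x : R -> vec | abs_cont_on t0 T x /\ x t0 = x0]]
  else if t0 == T then g x0 else +oo%E.

Definition proper_ext (g : vec -> \bar R) : Prop :=
  (forall x, g x != -oo%E) /\ (exists x, g x != +oo%E).

Definition ext (T : R) (U : R -> vec -> \bar R) (t : R) (x : vec) : \bar R :=
  if (0 <= t) && (t <= T) then U t x else +oo%E.

(* subderivative dphi(t,x)(vt,vx) = liminf_{tau->0+, y->v} (phi(z+tau y)-phi z)/tau *)
Definition subderiv (phi : R -> vec -> \bar R) (t : R) (x : vec) (vt : R) (vx : vec)
  : \bar R :=
  ereal_sup [set ereal_inf
     ((fun z : R * R * vec =>
         ((phi (t + z.1.1 * z.1.2)%R (x + z.1.1 *: z.2)%R - phi t x)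
            * (z.1.1^-1)%:E)%E) @`
      [set z : R * R * vec | 0 < z.1.1 < d /\ `|z.1.2 - vt| < d /\ enorm (z.2 - vx) < d])
   | d in [set d : R | 0 < d]].

Definition subdiff (phi : R -> vec -> \bar R) (t : R) (x : vec) (pt : R) (px : vec)
  : Prop :=
  forall vt vx, ((vt * pt + dotv vx px)%:E <= subderiv phi t x vt vx)%E.

Definition lsc_solution (H : R -> vec -> vec -> R) (g : vec -> \bar R) (T : R)
    (U : R -> vec -> \bar R) : Prop :=
  [/\ lower_semicontinuous (fun z : R * vec => ext T U z.1 z.2),
      (forall t x, 0 <= t <= T -> U t x != -oo%E),
      (forall x, U T x = g x) &
      forall t x pt px, 0 <= t <= T -> U t x \is a fin_num ->
        subdiff (ext T U) t x pt px ->
        (t < T -> 0 <= - pt + H t x (- px)) /\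
        (0 < t -> - pt + H t x (- px) <= 0)].

End Defs.

(* Main.v *)
(* For the supersolution inequality take near-optimal trajectories on [t, T]. Fenchel's inequality
   L(s, x, v) >= <q, v> - H(s, x, q), with L = H^*, bounds their cost on [t, t + h] from below; the
   growth condition (H4) makes them equi-absolutely continuous and (H3) bounds their speed, so that
   their mean velocities on [t, t + h] have a cluster point as h -> 0, in the direction of which the
   subderivative of V is at most H(t, x, q) - <q, v>.
   For the subsolution inequality go backwards in time from (t, x) along a solution of y' = f(s, y),
   where f(s, y) is the gradient of the Moreau envelope of H(s, y, .) at q. It is continuous in (s, y),
   takes values where L is finite and continuous along f, and is almost optimal in Fenchel's
   inequality; the dynamic programming principle then bounds the subderivative in the direction
   (-1, -f(t, x)).
   For lower semicontinuity extract a limit of near-optimal trajectories by Ascoli's theorem. On the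
   cells of a partition L is bounded below by affine functions of the velocity, whose integrals over
   cells pass to the limit under uniform convergence of the trajectories; refining the partition and
   enlarging the finite set of slopes, Fatou's lemma recovers the cost of the limit trajectory. *)
Require Import Defs.
From HB Require Import structures.
From mathcomp Require Import all_boot all_order all_algebra.
From mathcomp Require Import all_classical all_reals all_analysis.
From mathcomp Require Import measurable_realfun ring lra.
Set Implicit Arguments. Unset Strict Implicit. Unset Printing Implicit Defensive.
Import Order.TTheory GRing.Theory Num.Theory.
Import numFieldNormedType.Exports.
Local Open Scope classical_set_scope.
Local Open Scope ring_scope.

(** * Absolutely continuous functions have a density *)

Section AbsoluteContinuity.
Context {R : realType}.
Implicit Types (a b e d : R) (F G : R -> R) (p q : R * R) (s : seq (R * R)).

(** [L] may be [+oo], and no continuity of [L] is available, only that of [H]. Lower bounds on [L]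
    therefore come from its affine minorants [<q, v> - H(s, x, q)] alone, and explicit values of [L]
    are known only at the selected velocities, where Fenchel's inequality is an equality. The cost
    contains the pointwise derivative of an absolutely continuous curve, whereas the estimates need
    increments that are integrals of velocities. Absolutely continuous functions are shown to have
    densities by way of Stieltjes measures and the Radon-Nikodym theorem, and the density agrees
    with the derivative almost everywhere. Running costs may be infinite. On bounded sets, however,
    [L >= - K], and after adding [K] the integrand is nonnegative, so that splitting, comparison and
    Fatou's lemma apply without integrability. One [K] serves all trajectories of finite cost
    issuing from a bounded set, since Gronwall's inequality keeps them in one ball. *)

Definition nonoverlap p q := (p.2 <= q.1) || (q.2 <= p.1).

Definition in_seg a b p := [&& a <= p.1, p.1 <= p.2 & p.2 <= b].

(** Families of intervals are lists here, so that one interval of a family can be replaced by the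
    steps of a partition through concatenation. *)
Definition absc a b F := forall e, 0 < e -> exists2 d, 0 < d &
  forall s, all (in_seg a b) s -> pairwise nonoverlap s ->
    \sum_(p <- s) (p.2 - p.1) < d -> \sum_(p <- s) `|F p.2 - F p.1| < e.

Fixpoint steps (x : R) (l : seq R) : seq (R * R) :=
  if l is y :: l' then (x, y) :: steps y l' else [::].

Lemma nonoverlap_sym p q : nonoverlap p q = nonoverlap q p.
Proof. by rewrite /nonoverlap orbC. Qed.

Lemma steps_in_seg x l : path <%R x l -> all (in_seg x (last x l)) (steps x l).
Proof.
elim: l x => //= y l IH x /andP[xy yl].
have yL : y <= last y l.
  by apply: (@itv_partition_le _ _ _ _ l); split.
rewrite /in_seg /= lexx ltW//= yL /=.
apply: sub_all (IH _ yl) => p /and3P[h1 h2 h3].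
by rewrite /in_seg h2 h3 (le_trans (ltW xy)).
Qed.

Lemma steps_pairwise x l : path <%R x l -> pairwise nonoverlap (steps x l).
Proof.
elim: l x => //= y l IH x /andP[xy yl]; rewrite IH// andbT.
apply: sub_all (steps_in_seg yl) => p /and3P[h1 h2 h3].
by rewrite /nonoverlap/= h1.
Qed.

Lemma steps_sum x l : \sum_(p <- steps x l) (p.2 - p.1) = last x l - x.
Proof.
elim: l x => [|y l IH] x /=; first by rewrite big_nil subrr.
by rewrite big_cons IH /=; ring.
Qed.

Lemma variation_steps a b F l : itv_partition a b l ->
  variation a b F l = \sum_(p <- steps a l) `|F p.2 - F p.1|.
Proof.
move=> /[dup] /variation_zip -> _.
elim: l a => [|y l IH] a /=; first by rewrite !big_nil.
by rewrite !big_cons IH.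
Qed.

(** Increments are replaced by total variations one interval at a time. A partition of the head of
    [s1] is moved to the intervals [s2] that still count as increments, the induction hypothesis
    applies to the rest of [s1], and the supremum over partitions gives the variation of the head.
    This is why [s2] is general. *)
Lemma absc_TV_aux a b F e d :
  (forall s, all (in_seg a b) s -> pairwise nonoverlap s ->
    \sum_(p <- s) (p.2 - p.1) < d -> \sum_(p <- s) `|F p.2 - F p.1| < e) ->
  forall s1 s2, all (in_seg a b) (s1 ++ s2) -> pairwise nonoverlap (s1 ++ s2) ->
    \sum_(p <- s1 ++ s2) (p.2 - p.1) < d ->
  (\sum_(p <- s1) total_variation p.1 p.2 F
    + (\sum_(p <- s2) `|F p.2 - F p.1|)%:E <= e%:E)%E.
Proof.
move=> H; elim=> [|p s1 IH] s2.
  by rewrite /= big_nil add0e => h1 h2 h3; rewrite lee_fin ltW// H.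
rewrite cat_cons /= => /andP[/and3P[ap pp pb] hall] /andP[hp hpw].
rewrite big_cons => hs.
have tv0 (s : seq (R * R)) : all (in_seg a b) s ->
    (0 <= \sum_(p0 <- s) total_variation p0.1 p0.2 F)%E.
  elim: s => [|q s' IH']; rewrite ?big_nil ?big_cons//= => /andP[/and3P[_ q2 _] /IH'].
  by move=> h; apply: adde_ge0 => //; exact: total_variation_ge0.
have [hall1 hall2] : all (in_seg a b) s1 /\ all (in_seg a b) s2.
  by move: hall; rewrite all_cat => /andP.
have hs' : \sum_(q <- s1 ++ s2) (q.2 - q.1) < d.
  by apply: le_lt_trans hs; rewrite lerDr subr_ge0.
have fin1 : (\sum_(p0 <- s1) total_variation p0.1 p0.2 F)%E \is a fin_num.
  rewrite ge0_fin_numE ?tv0//; apply: le_lt_trans (ltry e).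
  apply: le_trans (IH s2 hall hpw hs'); rewrite leeDl// lee_fin.
  by apply: sumr_ge0.
rewrite big_cons -addeA -leeBrDr; last by rewrite fin_numD fin1.
apply: ge_ereal_sup => _ [_ [l pl <-] <-].
rewrite leeBrDr; last by rewrite fin_numD fin1.
rewrite addeCA -EFinD variation_steps// -big_cat.
have [/steps_in_seg hl /eqP hlast] := pl.
have hlpw : pairwise nonoverlap (steps p.1 l) by apply: steps_pairwise; case: pl.
rewrite hlast in hl.
have sub q : nonoverlap p q -> {in steps p.1 l, forall q', nonoverlap q' q}.
  rewrite /nonoverlap => hpq q' /(allP hl)/and3P[h1 h2 h3].
  by case/orP: hpq => h; apply/orP; [left|right]; lra.
have hn : {in s1 ++ s2, forall q, nonoverlap p q} by move/allP: hp.
apply: IH.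
- rewrite all_cat hall1 all_cat hall2 andbT/=.
  apply: sub_all hl => q /and3P[h1 h2 h3].
  by rewrite /in_seg h2 (le_trans ap h1) (le_trans h3 pb).
- move: hpw; rewrite !pairwise_cat hlpw => /and3P[h12 -> ->]; rewrite /= !andbT.
  apply/andP; split.
    rewrite allrel_catr h12 andbT; apply/allrelP => q q' qs1 q's.
    by rewrite nonoverlap_sym; apply: sub q's; apply: hn; rewrite mem_cat qs1.
  apply/allrelP => q' q q's qs2.
  by apply: sub q's; apply: hn; rewrite mem_cat qs2 orbT.
- move: hs; rewrite !big_cat/= steps_sum hlast.
  by set u := \sum_(_ <- s1) _; set v := \sum_(_ <- s2) _; lra.
Qed.

Lemma absc_TV a b F : absc a b F -> forall e, 0 < e -> exists2 d, 0 < d &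
  forall s, all (in_seg a b) s -> pairwise nonoverlap s ->
    \sum_(p <- s) (p.2 - p.1) < d ->
    (\sum_(p <- s) total_variation p.1 p.2 F <= e%:E)%E.
Proof.
move=> aF e e0; have [d d0 h] := aF e e0; exists d => // s s1 s2 s3.
have := absc_TV_aux h (s1 := s) (s2 := [::]).
by rewrite cats0 big_nil adde0; apply.
Qed.

(** The variation is at most 1 on intervals shorter than the [d] of [absc_TV] for 1, and finitely
    many steps of length [d / 2] reach [x]. *)
Lemma absc_TV_fin a b F x : absc a b F -> a <= x <= b ->
  total_variation a x F \is a fin_num.
Proof.
move=> aF /andP[ax xb]; have [d d0 h] := absc_TV aF ltr01.
have small l r : a <= l -> l <= r -> r <= b -> r - l < d ->
    total_variation l r F \is a fin_num.
  move=> al lr rb rl; rewrite ge0_fin_numE; last exact: total_variation_ge0.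
  have := h [:: (l, r)]; rewrite !big_seq1 /= /in_seg /= al lr rb => /(_ isT isT rl) hh.
  exact: le_lt_trans hh (ltry _).
have step n y : a <= y -> y <= b -> y <= a + n%:R * (d / 2) ->
    total_variation a y F \is a fin_num.
  elim: n y => [|n IH] y ay yb yn.
    apply: small => //; lra.
  have [yn'|yn'] := leP y (a + n%:R * (d / 2)); first exact: IH.
  have nd : 0 <= n%:R * (d / 2) by rewrite mulr_ge0// ltW// divr_gt0.
  rewrite (@total_variationD _ _ _ (a + n%:R * (d / 2))); [|lra|lra].
  rewrite fin_numD IH//; [|lra|lra].
  apply: small; [lra|lra|lra|].
  by move: yn; rewrite mulrSr; lra.
have [n hn] : exists n, (x - a) / (d / 2) <= n%:R.
  by exists (Num.bound ((x - a) / (d / 2))); apply/ltW/archi_boundP; rewrite divr_ge0 ?subr_ge0//; lra.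
apply: (step n) => //; rewrite -lerBlDl -ler_pdivrMr//; lra.
Qed.

(** [V] is the total variation from [a]. Absolute continuity passes to [V] by [absc_TV], and to
    [V \- F] because its increments are at most twice those of [V]. *)
Lemma absc_mono_decomp a b F : absc a b F ->
  exists V, [/\ absc a b V, absc a b (V \- F),
   {in `[a, b] &, nondecreasing_fun V} & {in `[a, b] &, nondecreasing_fun (V \- F)}].
Proof.
move=> aF; pose V x := fine (total_variation a x F).
have VB l r : a <= l -> l <= r -> r <= b ->
    (V r - V l)%:E = total_variation l r F.
  move=> al lr rb; rewrite /V EFinB !fineK; last 2 first.
    by apply: (absc_TV_fin aF); rewrite al (le_trans lr).
    by apply: (absc_TV_fin aF); rewrite rb (le_trans al).
  rewrite (@total_variationD _ a r l)// addeAC subee ?add0e//.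
  by apply: (absc_TV_fin aF); rewrite al (le_trans lr).
have FV l r : a <= l -> l <= r -> r <= b -> `|F r - F l| <= V r - V l.
  by move=> al lr rb; rewrite -lee_fin VB//; exact: total_variation_ge.
have aV : forall e, 0 < e -> exists2 d, 0 < d &
  forall s, all (in_seg a b) s -> pairwise nonoverlap s ->
    \sum_(p <- s) (p.2 - p.1) < d -> \sum_(p <- s) (V p.2 - V p.1) < e.
  move=> e e0; have e20 : 0 < e / 2 by lra.
  have [d d0 h] := absc_TV aF e20.
  exists d => // s s1 s2 s3; apply: (@le_lt_trans _ _ (e / 2)); last lra.
  rewrite -lee_fin; apply: le_trans (h s s1 s2 s3).
  rewrite -sumEFin le_eqVlt; apply/orP; left; apply/eqP.
  by apply: eq_big_seq => p /(allP s1)/and3P[h1 h2 h3]; rewrite VB.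
exists V; split.
- move=> e e0; have [d d0 h] := aV e e0; exists d => // s s1 s2 s3.
  apply: le_lt_trans (h s s1 s2 s3).
  rewrite big_seq [leRHS]big_seq ler_sum// => p /(allP s1)/and3P[h1 h2 h3].
  by rewrite ger0_norm//; apply: le_trans (FV _ _ h1 h2 h3).
- move=> e e0; have [|d d0 h] := aV (e / 2) _; first lra.
  exists d => // s s1 s2 s3; have := h s s1 s2 s3 => {}h.
  apply: (@le_lt_trans _ _ (2 * \sum_(p <- s) (V p.2 - V p.1))); last lra.
  rewrite mulr_sumr big_seq [leRHS]big_seq ler_sum// => p /(allP s1)/and3P[h1 h2 h3] /=.
  have := FV _ _ h1 h2 h3; rewrite !ler_norml => /andP[? ?].
  by apply/andP; split; lra.
- move=> x y; rewrite !in_itv/= => /andP[ax xb] /andP[ay yb] xy.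
  by have := FV _ _ ax xy yb => /(le_trans (normr_ge0 _)); rewrite subr_ge0.
- move=> x y; rewrite !in_itv/= => /andP[ax xb] /andP[ay yb] xy.
  by have := FV _ _ ax xy yb; rewrite ler_norml => /andP[? ?]; lra.
Qed.

End AbsoluteContinuity.

(** * Densities of nondecreasing functions through Stieltjes measures *)

Section MonotoneDensity.
Context {R : realType}.
Implicit Types (a b e d : R) (F G : R -> R).
Notation mu := (@lebesgue_measure R).

Lemma absc_continuous a b F : absc a b F -> forall e, 0 < e ->
  exists2 d, 0 < d & forall x y, a <= x -> x <= y -> y <= b -> y - x < d ->
    `|F y - F x| < e.
Proof.
move=> aF e e0; have [d d0 h] := aF e e0; exists d => // x y ax xy yb yx.
by have := h [:: (x, y)]; rewrite !big_seq1/= /in_seg /= ax xy yb; apply.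
Qed.

(** Composition with [clamp a b] extends a function on [[a, b]] to the line by its end values;
    monotonicity and continuity are kept. *)
Definition clamp a b x : R := Num.max a (Num.min x b).

Lemma clamp_id a b x : a <= x <= b -> clamp a b x = x.
Proof.
move=> /andP[ax xb]; rewrite /clamp min_l//.
by rewrite max_r.
Qed.

Lemma clamp_in a b x : a <= b -> a <= clamp a b x <= b.
Proof. by move=> ab; rewrite /clamp le_max lexx /= ge_max ab /= ge_min lexx orbT. Qed.

Lemma clamp_le a b x y : x <= y -> clamp a b x <= clamp a b y.
Proof.
move=> xy; rewrite /clamp /Order.max /Order.min.
by case: ifP; case: ifP; case: ifP; case: ifP; lra.
Qed.

Lemma clamp_dist a b x y : x <= y -> clamp a b y - clamp a b x <= y - x.
Proof.
move=> xy; rewrite /clamp /Order.max /Order.min.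
by case: ifP; case: ifP; case: ifP; case: ifP; lra.
Qed.

Lemma lebesgue_stieltjes_itvoc (f : cumulative R R) (c d : R) : c <= d ->
  lebesgue_stieltjes_measure f (`]c, d] : set R)%classic = (f d - f c)%:E.
Proof.
move=> cd; rewrite /lebesgue_stieltjes_measure/= /measure_extension/=.
rewrite measurable_mu_extE//; last exact: is_ocitv.
exact: wlength_itv_bnd.
Qed.

Lemma cumulative_clamp a b G : a <= b -> absc a b G ->
  {in `[a, b] &, nondecreasing_fun G} ->
  exists g : cumulative R R, forall x, g x = G (clamp a b x).
Proof.
move=> ab aG ndG; pose g x := G (clamp a b x).
have nd : nondecreasing g.
  move=> x y xy; apply: ndG; rewrite ?in_itv ?clamp_in//.
  exact: clamp_le.
have rc : right_continuous g.
  move=> x; apply/cvgrPdist_lt => e e0.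
  have [d d0 h] := absc_continuous aG e0.
  near=> y; rewrite distrC; apply: h.
  - by have /andP[] := clamp_in x ab.
  - by apply: clamp_le; near: y; apply: nbhs_right_ge.
  - by have /andP[] := clamp_in y ab.
  - apply: (@le_lt_trans _ _ (y - x)).
      by apply: clamp_dist; near: y; apply: nbhs_right_ge.
    by rewrite ltrBlDl; near: y; apply: nbhs_right_lt; rewrite ltrDl.
pose gc : cumulative R R := HB.pack g (isCumulative.Build R _ R g nd rc).
by exists gc.
Unshelve. all: by end_near. Qed.

(** The cells of a uniform grid that lie in [U] form a nonoverlapping family of total length below
    [d], so the increments of [G] over them sum to less than [e]. As the grid is refined these cells
    exhaust [U] inside []a, b]]. *)
Lemma open_grid_measure_le a b G (g : cumulative R R) (U : set R) d e :
  a < b -> (forall x, a <= x <= b -> g x = G x) ->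
  {in `[a, b] &, nondecreasing_fun G} ->
  (forall s, all (in_seg a b) s -> pairwise nonoverlap s ->
    \sum_(p <- s) (p.2 - p.1) < d -> \sum_(p <- s) `|G p.2 - G p.1| < e) ->
  open U -> (mu U < d%:E)%E ->
  (lebesgue_stieltjes_measure g (U `&` `]a, b]) <= e%:E)%E.
Proof.
move=> ab gG ndG hG oU Ud.
have mU : measurable U by exact: measurable_realfun.open_measurable.
pose LS : {measure set (measurableTypeR R) -> \bar R} :=
  lebesgue_stieltjes_measure g.
rewrite -[X in (X <= _)%E]/(LS (U `&` `]a, b]%classic)).
pose h m : R := (b - a) / m.+1%:R.
have h0 m : 0 < h m by rewrite divr_gt0 ?subr_gt0.
pose t m i : R := a + i%:R * h m.
have tS m i : t m i.+1 = t m i + h m by rewrite /t mulrSr; ring.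
have tle m i j : (i <= j)%N -> t m i <= t m j.
  by move=> ij; rewrite lerD2l ler_wpM2r ?ler_nat// ltW.
have ta m i : a <= t m i by rewrite lerDl mulr_ge0// ltW.
have tb m i : (i <= m.+1)%N -> t m i <= b.
  move=> im; apply: (le_trans (tle m _ _ im)).
  by rewrite /t /h mulrCA mulfV// mulr1 subrKC.
pose c m i : set R := `]t m i, t m i.+1]%classic.
pose P m i := `[< `[t m i, t m i.+1] `<=` U >].
pose K m := \big[setU/set0]_(i < m.+1 | P m i) c m i.
have mc m i : measurable (c m i) by exact: measurable_itv.
have mK m : measurable (K m) by apply: bigsetU_measurable.
have tc m : trivIset setT (c m).
  apply: ltn_trivIset => j i ij; rewrite -subset0 => x [].
  rewrite /c /= !in_itv/= => /andP[_ xi] /andP[xj _].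
  by have := tle m _ _ ij; lra.
have tco m : trivIset setT (fun i : 'I_m.+1 => c m i).
  move=> i j _ _ ne; apply: ord_inj; exact: (tc m _ _ I I ne).
have KE (nu : {measure set (measurableTypeR R) -> \bar R}) m :
    nu (K m) = (\sum_(i < m.+1 | P m i) nu (c m i))%E.
  exact: (@measure_bigsetU_ord _ _ _ nu _ (P m) (fun i => c m i)
    (fun i => mc m i) (tco m)).
have KU m : K m `<=` U.
  move=> x; rewrite /K -bigcup_seq_cond => -[i /= /andP[_ /asboolP Pi] ci].
  by apply: Pi; move: ci; rewrite /c /= !in_itv/= => /andP[/ltW -> ->].
have KLS m : (LS (K m) <= e%:E)%E.
  rewrite (KE LS).
  pose s := [seq (t m i, t m i.+1) | i <- iota 0 m.+1 & P m i].
  have E1 (f : R * R -> R) :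
      \sum_(p <- s) f p = \sum_(i < m.+1 | P m i) f (t m i, t m i.+1).
    rewrite /s big_map big_filter -(big_mkord (P m) (fun i => f (t m i, t m i.+1))).
    by rewrite /index_iota subn0.
  have := hG s; rewrite !E1 => hs.
  have s1 : all (in_seg a b) s.
    rewrite /s all_map; apply/allP => i; rewrite mem_filter mem_iota/= add0n.
    by move=> /andP[_ im]; rewrite /in_seg /= ta tb// tle.
  have s2 : pairwise nonoverlap s.
    rewrite /s pairwise_map; apply: pairwise_filter.
    have := iota_ltn_sorted 0 m.+1; rewrite sorted_pairwise; last exact: ltn_trans.
    apply: sub_pairwise => i j ij; rewrite /nonoverlap /= tle//.
  have s3 : \sum_(i < m.+1 | P m i) (t m i.+1 - t m i) < d.
    rewrite -lte_fin; apply: le_lt_trans Ud.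
    apply: le_trans (_ : mu (K m) <= _)%E; last first.
      by apply: le_measure; rewrite ?inE; [exact: mK|exact: mU|exact: KU].
    rewrite [leRHS](KE mu) -sumEFin le_eqVlt; apply/orP; left; apply/eqP.
    apply: eq_bigr => i _; have := lebesgue_measure_itv `]t m i, t m i.+1].
    by rewrite /= lte_fin (_ : (t m i < t m i.+1) = true) => [/esym//|]; rewrite tS ltrDl h0.
  apply: le_trans (_ : (\sum_(i < m.+1 | P m i) `|G (t m i.+1) - G (t m i)|)%:E <= _)%E; last first.
    by rewrite lee_fin ltW// hs.
  rewrite -sumEFin le_eqVlt; apply/orP; left; apply/eqP.
  apply: eq_bigr => i _.
  apply: etrans (lebesgue_stieltjes_itvoc g (tle m _ _ (leqnSn i))) _.
  have t1 := tb m i (ltnW (ltn_ord i)); have t2 := tb m i.+1 (ltn_ord i).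
  rewrite !gG ?ta ?t1 ?t2// ger0_norm// subr_ge0 ndG// ?in_itv/= ?ta ?t1 ?t2//.
  exact: tle.
(* Uniform grids are not nested, so [K m] need not increase with [m]; the tail intersections [E m]
   do, and they still cover, because a point of [U] lies in [K m] for all large [m]. *)
pose E m := \bigcap_(j in [set j | (m <= j)%N]) K j.
have mE m : measurable (E m) by apply: bigcap_measurable => [|j _]; [exists m => /=|exact: mK].
have ndE : nondecreasing_seq E.
  move=> m n mn; apply/subsetPset => x Ex j /= nj; apply: Ex => /=.
  exact: leq_trans nj.
have UE : U `&` `]a, b] `<=` \bigcup_m E m.
  move=> x [Ux]; rewrite /= in_itv/= => /andP[ax xb].
  have /nbhs_ballP[r /= r0 rU] := open_nbhs_nbhs (conj oU Ux).
  have [n hn] : exists n, (b - a) / r < n%:R.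
    by exists (Num.bound ((b - a) / r)); apply/archi_boundP; rewrite divr_ge0// ?subr_ge0 ltW.
  exists n => // m /= nm.
  have hr : h m < r.
    rewrite /h ltr_pdivrMr// -ltr_pdivrMl// mulrC; apply: (lt_le_trans hn).
    by rewrite ler_nat ltnW// ltnS.
  have xp : 0 < (x - a) / h m by rewrite divr_gt0// subr_gt0.
  have ex : exists i, x <= t m i.+1.
    exists m; rewrite (le_trans xb)// /t /h mulrCA mulfV// mulr1 subrKC//.
  have [i xi imin] := ex_minnP ex.
  have xti : t m i < x.
    case: i xi imin => [|i] xi imin; first by rewrite /t mul0r addr0.
    by rewrite ltNge; apply/negP => /imin; rewrite ltnn.
  have im : (i < m.+1)%N.
    rewrite ltnNge; apply/negP => mi.
    have := tle m _ _ mi; rewrite {1}/t /h mulrCA mulfV// mulr1 subrKC => bt.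
    by move: xti xb bt; lra.
  rewrite /K -bigcup_seq_cond; exists (Ordinal im) => /=; last first.
    by rewrite /c /= in_itv/= xti xi.
  rewrite mem_index_enum /=; apply/asboolP => y; rewrite /= in_itv/= => /andP[y1 y2].
  apply: rU; rewrite /ball/= ltr_distl.
  by move: xti xi y1 y2 hr; rewrite tS; move: (h m) (t m i) => u v; lra.
apply: (@le_trans _ _ (LS (\bigcup_m E m))).
  apply: le_measure; rewrite ?inE//; first by apply: measurableI.
  exact: (bigcup_measurable (fun m _ => mE m)).
have cv := @nondecreasing_cvg_mu _ _ _ LS E mE (bigcup_measurable (fun m _ => mE m)) ndE.
rewrite -(cvg_lim _ cv)//.
apply: lime_le; first by apply/cvg_ex; eexists; exact: cv.
near=> m => /=; apply: le_trans (KLS m).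
by apply: le_measure; rewrite ?inE; [exact: mE|exact: mK|move=> x; apply; rewrite /=].
Unshelve. all: by end_near. Qed.

(** A Lebesgue null set is contained in an open set of measure below [d], whose Stieltjes measure is
    at most [e] by [open_grid_measure_le]. The Stieltjes measure restricted to []a, b]] is thus
    dominated by Lebesgue measure, and [f] is its Radon-Nikodym derivative. *)
Lemma absc_nondecreasing_density a b G : a < b -> absc a b G ->
  {in `[a, b] &, nondecreasing_fun G} ->
  exists f : R -> R, mu.-integrable setT (EFin \o f) /\
    forall c d, a <= c -> c <= d -> d <= b ->
      (\int[mu]_(x in `[c, d]) (f x)%:E = (G d - G c)%:E)%E.
Proof.
move=> ab aG ndG; have [g gE] := cumulative_clamp (ltW ab) aG ndG.
have gG x : a <= x <= b -> g x = G x by move=> xab; rewrite gE clamp_id.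
pose LS := lebesgue_stieltjes_measure g.
have mab : measurable (`]a, b]%classic : set (measurableTypeR R)) by exact: measurable_itv.
have fab : (LS `]a, b]%classic < +oo)%E.
  by rewrite /LS lebesgue_stieltjes_itvoc ?ltW// ltry.
pose nu : {finite_measure set (measurableTypeR R) -> \bar R} := mfrestr mab fab.
have dom : nu `<< mu.
  apply/null_content_dominatesP => A mA A0.
  apply/eqP; rewrite eq_le measure_ge0 andbT; apply/lee_addgt0Pr => e e0.
  rewrite add0e; have [d d0 hd] := aG e e0.
  have [|U [oU AU UA]] := @lebesgue_regularity_outer R A d mA _ d0.
    by rewrite A0 ltry.
  have mU : measurable U by exact: measurable_realfun.open_measurable.
  have Ud : (mu U < d%:E)%E.
    rewrite -(setDUK AU); apply: le_lt_trans UA.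
    apply: le_trans (measureU2 _ _ _) _ => //; first exact: measurableD.
    by rewrite A0 add0e.
  apply: le_trans (open_grid_measure_le ab gG ndG hd oU Ud).
  rewrite -[X in (X <= _)%E]/(LS (A `&` `]a, b]%classic)).
  apply: le_measure; rewrite ?inE; last exact: setSI.
    exact: (measurableI _ _ mA mab).
  exact: (measurableI _ _ mU mab).
have [f [f0 ffin fint fE]] := @radon_nikodym_sigma_finite _ _ _ mu nu dom.
exists (fine \o f); split.
  by rewrite (_ : EFin \o _ = f)//; apply/funext => x /=; rewrite fineK.
move=> c d ac cd db.
under eq_integral do rewrite /= fineK//.
rewrite -integral_itv_obnd_cbnd; last first.
  by apply: (measurable_funS measurableT) => //; exact: measurable_int fint.
have := fE `]c, d]%classic (measurable_itv _) => <-.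
rewrite -[LHS]/(LS (`]c, d] `&` `]a, b])) setIidl; last first.
  move=> x; rewrite /= !in_itv/= => /andP[cx xd].
  by rewrite (le_lt_trans ac cx) (le_trans xd db).
by rewrite /LS lebesgue_stieltjes_itvoc// !gG// ?ac ?db ?(le_trans cd) ?(le_trans ac).
Qed.

End MonotoneDensity.

(** * Euclidean norm *)

Section EuclideanNorm.
Context {R : realType} {N : nat}.
Implicit Types (u v w : 'rV[R]_N) (a : R).

Lemma dotvC u v : dotv u v = dotv v u.
Proof. by apply: eq_bigr => i _; rewrite mulrC. Qed.

Lemma dotvDl u v w : dotv (u + v) w = dotv u w + dotv v w.
Proof. by rewrite /dotv -big_split; apply: eq_bigr => i _; rewrite mxE mulrDl. Qed.

Lemma dotvZl a u v : dotv (a *: u) v = a * dotv u v.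
Proof. by rewrite /dotv mulr_sumr; apply: eq_bigr => i _; rewrite mxE mulrA. Qed.

Lemma dotvDr u v w : dotv u (v + w) = dotv u v + dotv u w.
Proof. by rewrite !(dotvC u) dotvDl. Qed.

Lemma dotvZr a u v : dotv u (a *: v) = a * dotv u v.
Proof. by rewrite !(dotvC u) dotvZl. Qed.

Lemma dotvNl u v : dotv (- u) v = - dotv u v.
Proof. by rewrite -scaleN1r dotvZl mulN1r. Qed.

Lemma dotvNr u v : dotv u (- v) = - dotv u v.
Proof. by rewrite !(dotvC u) dotvNl. Qed.

Lemma dotv0l u : dotv 0 u = 0.
Proof. by rewrite -(scale0r u) dotvZl mul0r. Qed.

Lemma dotv0r u : dotv u 0 = 0.
Proof. by rewrite dotvC dotv0l. Qed.

Lemma dotvBl u v w : dotv (u - v) w = dotv u w - dotv v w.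
Proof. by rewrite dotvDl dotvNl. Qed.

Lemma dotvBr u v w : dotv u (v - w) = dotv u v - dotv u w.
Proof. by rewrite dotvDr dotvNr. Qed.

Lemma dotv_ge0 u : 0 <= dotv u u.
Proof. by apply: sumr_ge0 => i _; rewrite -expr2 sqr_ge0. Qed.

Lemma enorm_ge0 u : 0 <= enorm u.
Proof. exact: sqrtr_ge0. Qed.

Lemma enorm_sqr u : enorm u ^+ 2 = dotv u u.
Proof. by rewrite sqr_sqrtr// dotv_ge0. Qed.

Lemma dotv_le_enorm u v : dotv u v <= enorm u * enorm v.
Proof.
have [v0|v0] := eqVneq (enorm v) 0.
  have vv : forall i, v ord0 i = 0.
    move=> i; have : dotv v v == 0 by rewrite -enorm_sqr v0 expr0n.
    rewrite psumr_eq0; last by move=> j _; rewrite -expr2 sqr_ge0.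
    by move=> /allP/(_ i (mem_index_enum _)); rewrite mulf_eq0 orbb => /eqP.
  by rewrite v0 mulr0 /dotv big1// => i _; rewrite vv mulr0.
have vp : 0 < enorm v by rewrite lt_def v0 enorm_ge0.
have := dotv_ge0 (u - (dotv u v / enorm v ^+ 2) *: v).
rewrite !dotvBl !dotvBr !dotvZl !dotvZr -!enorm_sqr (dotvC v u).
set d := dotv u v => h.
have : d ^+ 2 <= (enorm u * enorm v) ^+ 2.
  have e : enorm u ^+ 2 - d / enorm v ^+ 2 * d - (d / enorm v ^+ 2 * d -
    d / enorm v ^+ 2 * (d / enorm v ^+ 2 * enorm v ^+ 2)) =
    ((enorm u * enorm v) ^+ 2 - d ^+ 2) / enorm v ^+ 2 by field.
  by move: h; rewrite e pmulr_lge0 ?invr_gt0 ?exprn_gt0// subr_ge0.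
move=> h2; apply: le_trans (ler_norm _) _.
rewrite -(@ler_pXn2r _ 2)// ?nnegrE ?mulr_ge0 ?enorm_ge0//.
by rewrite real_normK// num_real.
Qed.

Lemma normr_dotv_le u v : `|dotv u v| <= enorm u * enorm v.
Proof.
rewrite ler_norml dotv_le_enorm andbT -[leRHS]opprK lerN2 -dotvNl.
have eN : enorm (- u) = enorm u by rewrite /enorm dotvNl dotvNr opprK.
by rewrite -eN dotv_le_enorm.
Qed.

Lemma enormN u : enorm (- u) = enorm u.
Proof. by rewrite /enorm dotvNl dotvNr opprK. Qed.

Lemma enormB u v : enorm (u - v) = enorm (v - u).
Proof. by rewrite -enormN opprB. Qed.

Lemma enormZ a u : enorm (a *: u) = `|a| * enorm u.
Proof.
rewrite /enorm dotvZl dotvZr mulrA -expr2 sqrtrM ?sqr_ge0//.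
by rewrite sqrtr_sqr.
Qed.

Lemma enorm0 : enorm (0 : 'rV[R]_N) = 0.
Proof. by rewrite /enorm dotv0l sqrtr0. Qed.

Lemma ler_enormD u v : enorm (u + v) <= enorm u + enorm v.
Proof.
rewrite -(@ler_pXn2r _ 2)// ?nnegrE ?addr_ge0 ?enorm_ge0//.
rewrite enorm_sqr !dotvDl !dotvDr -!enorm_sqr (dotvC v u).
have := dotv_le_enorm u v; lra.
Qed.

Lemma enorm_dist u v w : enorm (u - w) <= enorm (u - v) + enorm (v - w).
Proof. by apply: le_trans (ler_enormD _ _); rewrite addrA subrK. Qed.

Lemma coord_le_enorm u i : `|u ord0 i| <= enorm u.
Proof.
rewrite -sqrtr_sqr /enorm ler_wsqrtr// /dotv (bigD1 i)//= -expr2 lerDl.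
by apply: sumr_ge0 => j _; rewrite -expr2 sqr_ge0.
Qed.

Lemma enorm_le_sum u : enorm u <= \sum_i `|u ord0 i|.
Proof.
rewrite -(@ler_pXn2r _ 2)// ?nnegrE ?enorm_ge0 ?sumr_ge0//.
rewrite enorm_sqr /dotv expr2 mulr_suml; apply: ler_sum => i _.
rewrite -expr2 -real_normK ?num_real// expr2; apply: ler_wpM2l => //.
by rewrite (bigD1 i)//= lerDl sumr_ge0.
Qed.

Lemma normr_le_enorm u : `|u| <= enorm u.
Proof.
rewrite [leLHS]/Num.norm /= mx_normrE; apply/bigmax_leP; split=> [|[i j] _ /=].
  exact: enorm_ge0.
by rewrite ord1 coord_le_enorm.
Qed.

Lemma coord_le_normr u i : `|u ord0 i| <= `|u|.
Proof.
rewrite [leRHS]/Num.norm /= mx_normrE; apply/bigmax_geP; right => /=.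
by exists (ord0, i).
Qed.

Lemma enorm_le_normr u : enorm u <= N%:R * `|u|.
Proof.
apply: le_trans (enorm_le_sum u) _.
apply: (@le_trans _ _ (\sum_(i < N) `|u|)).
  by apply: ler_sum => i _; exact: coord_le_normr.
by rewrite sumr_const card_ord mulr_natl.
Qed.

(** The topology of row vectors is that of the maximum norm, which is at most [enorm], while [enorm]
    is at most [N] times it. The divisor [N.+1] covers [N = 0]. *)
Lemma nbhs_enormP u (A : set 'rV[R]_N) :
  nbhs u A <-> exists2 e, 0 < e & forall v, enorm (v - u) < e -> A v.
Proof.
split=> [/nbhs_ballP[e /= e0 eA]|[e e0 eA]].
  exists e => // v ve; apply: eA; rewrite -ball_normE /= distrC.
  exact: le_lt_trans (normr_le_enorm _) ve.
apply/nbhs_ballP; exists (e / N.+1%:R); first by rewrite /= divr_gt0.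
move=> v; rewrite -ball_normE /= distrC => ve; apply: eA.
apply: le_lt_trans (enorm_le_normr _) _.
apply: (@le_lt_trans _ _ (N.+1%:R * `|v - u|)).
  by rewrite ler_wpM2r// ler_nat.
by rewrite -ltr_pdivlMl// mulrC.
Qed.

Lemma continuous_enormP (T : topologicalType) (f : T -> 'rV[R]_N) x :
  {for x, continuous f} <->
  (forall e, 0 < e -> \forall y \near x, enorm (f y - f x) < e).
Proof.
split=> [cf e e0|h A /nbhs_enormP[e e0 eA]].
  by apply: (cf [set z | enorm (z - f x) < e]); apply/nbhs_enormP; exists e.
by apply: filterS (h e e0) => y; exact: eA.
Qed.

Lemma cvg_enormP (T : Type) (F : set_system T) {FF : Filter F} (f : T -> 'rV[R]_N) (l : 'rV[R]_N) :
  f @ F --> l <-> (forall e, 0 < e -> \forall y \near F, enorm (f y - l) < e).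
Proof.
split=> [cf e e0|h A /nbhs_enormP[e e0 eA]].
  by apply: (cf [set z | enorm (z - l) < e]); apply/nbhs_enormP; exists e.
by apply: filterS (h e e0) => y; exact: eA.
Qed.

Lemma cvg_dotv (T : Type) (F : set_system T) {FF : Filter F}
    (f g : T -> 'rV[R]_N) (a b : 'rV[R]_N) :
  f @ F --> a -> g @ F --> b -> dotv (f x) (g x) @[x --> F] --> dotv a b.
Proof.
move=> fa gb; apply: cvg_big => [|i _]; first exact: add_continuous.
by apply: cvgM; [exact: (cvg_comp _ _ fa (@coord_continuous R 1 N ord0 i a))|
  exact: (cvg_comp _ _ gb (@coord_continuous R 1 N ord0 i b))].
Qed.

Lemma cvg_enorm (T : Type) (F : set_system T) {FF : Filter F}
    (f : T -> 'rV[R]_N) (a : 'rV[R]_N) :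
  f @ F --> a -> enorm (f x) @[x --> F] --> enorm a.
Proof.
by move=> fa; apply: (cvg_comp _ _ (cvg_dotv fa fa) (@sqrt_continuous R (dotv a a))).
Qed.

Lemma compact_enorm_ball u (r : R) : compact [set v | enorm (v - u) <= r].
Proof.
apply: bounded_closed_compact.
  exists (enorm u + r); split; first exact: num_real.
  move=> x hx v /= vr; apply/ltW; apply: le_lt_trans hx.
  apply: le_trans (normr_le_enorm _) _.
  by rewrite -(subrK u v) addrC (le_trans (ler_enormD _ _))// lerD2l.
have -> : [set v : 'rV[R]_N | enorm (v - u) <= r] =
    (fun v => enorm (v - u)) @^-1` [set x | x <= r] by [].
apply: closed_comp; last exact: closed_le.
move=> v _; apply: (@cvg_enorm _ (nbhs v)).
by apply: cvgB; [exact: cvg_id|exact: cvg_cst].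
Qed.

End EuclideanNorm.

(** * Integrals over compact intervals *)

Section IntervalIntegrals.
Context {R : realType}.
Implicit Types (a b c d e k s t : R) (f g : R -> R).
Notation mu := (@lebesgue_measure R).

Lemma ae_imp (P Q : R -> Prop) : (forall x, P x -> Q x) ->
  {ae mu, forall x, P x} -> {ae mu, forall x, Q x}.
Proof. by move=> PQ; apply: filterS => //; exact: (ae_filter_ringOfSetsType mu). Qed.

Lemma ae_and (P Q : R -> Prop) : {ae mu, forall x, P x} -> {ae mu, forall x, Q x} ->
  {ae mu, forall x, P x /\ Q x}.
Proof. exact: (@filterS2 _ _ (ae_filter_ringOfSetsType mu) P Q _ (fun x => @conj _ _)). Qed.

Definition locint f := forall c d, mu.-integrable `[c, d] (EFin \o f).

(** The integral is not oriented: it vanishes when [d < c]. *)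
Definition ivint f c d : R := \int[mu]_(x in `[c, d]) f x.

Lemma locint_integrable f : mu.-integrable setT (EFin \o f) -> locint f.
Proof. by move=> hf c d; exact: (integrableS measurableT). Qed.

Lemma locint_continuous f : continuous f -> locint f.
Proof.
move=> cf c d; apply: continuous_compact_integrable; first exact: segment_compact.
exact: continuous_subspaceT.
Qed.

Lemma locint_cst k : locint (cst k).
Proof. by apply: locint_continuous => x; exact: cvg_cst. Qed.

Lemma locintD f g : locint f -> locint g -> locint (fun x => f x + g x).
Proof.
move=> hf hg c d; have := @integrableD _ _ _ mu _ (measurable_itv `[c, d]) _ _ (hf c d) (hg c d).
by apply: eq_integrable.
Qed.

Lemma locintZ k f : locint f -> locint (fun x => k * f x).
Proof.
move=> hf c d; have := @integrableZl _ _ _ mu _ (measurable_itv `[c, d]) k _ (hf c d).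
by apply: eq_integrable.
Qed.

Lemma locintB f g : locint f -> locint g -> locint (fun x => f x - g x).
Proof.
move=> hf hg; have := locintD hf (locintZ (-1) hg).
by under eq_fun do rewrite mulN1r.
Qed.

Lemma locint_norm f : locint f -> locint (fun x => `|f x|).
Proof.
move=> hf c d; have := integrable_norm (hf c d).
by apply: eq_integrable.
Qed.

Lemma locint_sum n (f : 'I_n -> R -> R) : (forall i, locint (f i)) ->
  locint (fun x => \sum_i f i x).
Proof.
move=> hf c d; have := @integrable_sum _ _ _ mu _ (measurable_itv `[c, d]) _
  (index_enum 'I_n) predT (fun i => EFin \o f i) (fun i _ => hf i c d).
by apply: eq_integrable => // x _; rewrite /= sumEFin.
Qed.

Lemma locint_if f g t : locint f -> locint g -> locint (fun x => if x < t then f x else g x).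
Proof.
move=> hf hg c d.
have mb : measurable_fun `[c, d] (fun x : R => x < t).
  apply: (measurable_fun_bool true) => //.
  rewrite (_ : _ @^-1` _ = `]-oo, t[%classic); first by apply: measurableI.
  by apply/seteqP; split => x; rewrite /= in_itv/=.
have h : mu.-integrable `[c, d] (EFin \o (fun x => `|f x| + `|g x|)).
  by apply: locintD; exact: locint_norm.
have mf : measurable_fun `[c, d] f by apply/measurable_EFinP; exact: measurable_int (hf c d).
have mg : measurable_fun `[c, d] g by apply/measurable_EFinP; exact: measurable_int (hg c d).
apply: le_integrable h => //.
  by apply/measurable_EFinP; apply: measurable_fun_if => //; apply: measurable_funS (measurable_itv _) _ _; try exact: subIsetl.
move=> x _ /=; rewrite lee_fin [leRHS]ger0_norm ?addr_ge0//.
by case: ifP => _; rewrite ?lerDl ?lerDr.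
Qed.

Lemma locint_measurable f : locint f -> measurable_fun setT f.
Proof.
move=> hf; have -> : [set: R] = \bigcup_n `[- n%:R, n%:R]%classic.
  apply/seteqP; split => // x _.
  exists (Num.bound `|x|) => //=; rewrite in_itv/= -ler_norml.
  by apply/ltW/archi_boundP.
apply/measurable_fun_bigcup => n; first exact: measurable_itv.
by apply/measurable_EFinP; exact: measurable_int (hf (- n%:R) n%:R).
Qed.

Lemma locint_locally f : locint f -> locally_integrable setT f.
Proof.
move=> hf; split; [exact: locint_measurable|exact: openT|move=> K _ cK].
have /compact_bounded[M [_ hM]] := cK.
have {hM}KM : K `<=` `[- (`|M| + 1), `|M| + 1]%classic.
  move=> x Kx /=; rewrite in_itv/= -ler_norml; apply: hM => //.
  by rewrite (le_lt_trans (ler_norm _))// ltrDl.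
have /integrableP[_] := hf (- (`|M| + 1)) (`|M| + 1).
apply: le_lt_trans; apply: ge0_subset_integral => //=.
  exact: compact_measurable.
exact: measurable_int (locint_norm hf (- (`|M| + 1)) (`|M| + 1)).
Qed.

Lemma ivint_xx f c : ivint f c c = 0.
Proof. by rewrite /ivint set_itv1 Rintegral_set1. Qed.

Lemma ivint_gt f c d : d < c -> ivint f c d = 0.
Proof. by move=> dc; rewrite /ivint set_itv_ge ?Rintegral_set0// bnd_simp -ltNge. Qed.

Lemma ivint_split f c d e : locint f -> c <= d -> d <= e ->
  ivint f c e = ivint f c d + ivint f d e.
Proof.
move=> hf cd de; have := @Rintegral_itvB R f (BLeft c) (BRight e) d (hf c e).
rewrite !bnd_simp => /(_ cd de).
rewrite Rintegral_itv_obnd_cbnd; last first.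
  by apply: integrableS (hf d e) => //; apply: subset_itvr; rewrite bnd_simp.
by rewrite /ivint => <-; rewrite addrC subrK.
Qed.

Lemma eq_ri f g c d : (forall s, c <= s <= d -> f s = g s) -> ivint f c d = ivint g c d.
Proof.
by move=> fg; apply: eq_Rintegral => x; rewrite inE /= in_itv/=; exact: fg.
Qed.

Lemma ivintD f g c d : locint f -> locint g -> ivint (fun x => f x + g x) c d = ivint f c d + ivint g c d.
Proof. by move=> hf hg; rewrite /ivint RintegralD. Qed.

Lemma ivintB f g c d : locint f -> locint g -> ivint (fun x => f x - g x) c d = ivint f c d - ivint g c d.
Proof. by move=> hf hg; rewrite /ivint RintegralB. Qed.

Lemma ivintZ k f c d : locint f -> ivint (fun x => k * f x) c d = k * ivint f c d.
Proof. by move=> hf; rewrite /ivint RintegralZl. Qed.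

Lemma mu_itvcc c d : c <= d -> mu `[c, d]%classic = (d - c)%:E.
Proof.
move=> cd; rewrite lebesgue_measure_itv/= lte_fin.
by case: ltgtP cd => // -> _; rewrite subrr.
Qed.

Lemma ivint_cst k c d : c <= d -> ivint (cst k) c d = k * (d - c).
Proof.
move=> cd; rewrite /ivint Rintegral_cst//; congr (_ * _).
by rewrite -[RHS]/(fine (d - c)%:E); congr fine; exact: mu_itvcc.
Qed.

Lemma ivint_sum n (f : 'I_n -> R -> R) c d : (forall i, locint (f i)) ->
  ivint (fun x => \sum_i f i x) c d = \sum_i ivint (f i) c d.
Proof.
elim: n f => [|n IH] f hf.
  rewrite big_ord0; have [cd|dc] := leP c d.
    transitivity (ivint (cst 0) c d); last by rewrite ivint_cst// mul0r.
    by apply: eq_ri => s _; rewrite big_ord0.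
  by rewrite ivint_gt.
rewrite big_ord_recl -IH//.
rewrite -ivintD//; last exact: locint_sum.
by apply: eq_ri => s _; rewrite big_ord_recl.
Qed.

Lemma ivint_le f g c d : locint f -> locint g -> (forall s, c <= s <= d -> f s <= g s) ->
  ivint f c d <= ivint g c d.
Proof.
move=> hf hg fg; apply: le_Rintegral => // x; rewrite /= in_itv/=; exact: fg.
Qed.

Lemma ivint_ge0 f c d : (forall s, c <= s <= d -> 0 <= f s) -> 0 <= ivint f c d.
Proof. by move=> f0; apply: Rintegral_ge0 => x; rewrite /= in_itv/=; exact: f0. Qed.

Lemma ivint_norm f c d : locint f -> `|ivint f c d| <= ivint (fun s => `|f s|) c d.
Proof. by move=> hf; exact: le_normr_Rintegral. Qed.

Lemma ivint_norm_cst f k c d : locint f -> c <= d -> (forall s, c <= s <= d -> `|f s| <= k) ->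
  `|ivint f c d| <= k * (d - c).
Proof.
move=> hf cd fk; apply: le_trans (ivint_norm _ _ hf) _.
by rewrite -ivint_cst//; apply: ivint_le => //; [exact: locint_norm|exact: locint_cst].
Qed.

(** [g] may be replaced by the maximum of [f] and [g], which equals [g] almost everywhere and
    dominates [f] at every point. *)
Lemma ivint_ae_le f g c d : locint f -> locint g ->
  {ae mu, forall s, c <= s <= d -> f s <= g s} -> ivint f c d <= ivint g c d.
Proof.
move=> hf hg fg.
have mf := locint_measurable hf; have mg := locint_measurable hg.
pose m x := Num.max (f x) (g x).
have mm : measurable_fun setT m by exact: measurable_maxr.
have hm : locint m.
  move=> a b; have h : mu.-integrable `[a, b] (EFin \o (fun x => `|f x| + `|g x|)).
    by apply: locintD; exact: locint_norm.
  apply: le_integrable h => //.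
    by apply/measurable_EFinP; exact: measurable_funTS.
  move=> x _ /=; rewrite lee_fin [leRHS]ger0_norm ?addr_ge0// /m /Num.max.
  by case: ifP => _; rewrite ?lerDl ?lerDr.
have -> : ivint g c d = ivint m c d.
  congr fine; apply: ae_eq_integral => //.
  - by apply/measurable_EFinP; exact: measurable_funTS.
  - by apply/measurable_EFinP; exact: measurable_funTS.
  - apply: ae_imp fg => x h; rewrite /= in_itv/= => /h h'.
    by rewrite /m max_r.
by apply: ivint_le => // s _; rewrite /m le_max lexx.
Qed.

Lemma ivint_EFin f c d : locint f -> (\int[mu]_(x in `[c, d]) (f x)%:E = (ivint f c d)%:E)%E.
Proof. by move=> hf; rewrite /ivint /Rintegral fineK//; apply: integrable_fin_num. Qed.

Lemma integral_small f a b : locint f -> forall e, 0 < e -> exists2 d, 0 < d &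
  forall A, measurable A -> A `<=` `[a, b]%classic -> (mu A < d%:E)%E ->
    \int[mu]_(x in A) `|f x| < e.
Proof.
move=> hf e e0.
pose g := f \_ `[a, b]%classic.
have ig : mu.-integrable setT (EFin \o g).
  rewrite /g -restrict_EFin.
  by have := (@integrable_mkcond _ _ _ mu _ (EFin \o f) (measurable_itv `[a, b])).1 (hf a b).
have [d [d0 hd]] := integral_normr_continuous ig e0.
exists d => // A mA Aab Ad; have := hd A mA Ad; congr (_ < _).
apply: eq_Rintegral => x; rewrite inE => Ax.
by rewrite /g patchE mem_set//; exact: Aab.
Qed.

Lemma ivint_small f a b : locint f -> forall e, 0 < e -> exists2 d, 0 < d &
  forall x y, a <= x -> x <= y -> y <= b -> y - x < d -> ivint (fun s => `|f s|) x y < e.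
Proof.
move=> hf e e0; have [d d0 hd] := integral_small a b hf e0.
exists d => // x y ax xy yb yx; apply: hd => //.
  by move=> z; rewrite /= !in_itv/= => /andP[xz zy]; rewrite (le_trans ax xz) (le_trans zy yb).
by suff : ((y - x)%:E < d%:E)%E by rewrite -(mu_itvcc xy).
Qed.

(** The Lebesgue differentiation property for all short intervals containing [s], wherever [s] lies
    in them: this yields two-sided difference quotients as well as averages over partition cells. *)
Definition straddle f s := forall e, 0 < e -> exists2 r, 0 < r &
  forall c d, c <= s -> s <= d -> s - r < c -> d < s + r ->
    `|ivint f c d - f s * (d - c)| <= e * (d - c).

(** Where the primitive of [f] has derivative [f s], the increments over [[c, s]] and [[s, d]] are
    linear up to [e] times the respective length, and the two errors add up to [e * (d - c)]. *)
Lemma ae_straddle f a : locint f -> {ae mu, forall s, a < s -> straddle f s}.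
Proof.
move=> hf; have := FTC1 (a := BLeft a) (fun y => hf a y) (locint_locally hf).
apply: ae_imp => s /= h as_; have [//|df f's] := h.
move=> e e0; have h0 : (fun h => h^-1 *: (ivint f a (h *: 1 + s) - ivint f a s)) @ 0^' --> f s.
  by rewrite -f's derive1E; exact: df.
move/cvgrPdist_le : h0 => /(_ e e0)/nbhs_ballP[r /= r0 hr].
exists (Num.min r (s - a)); first by rewrite lt_min r0 subr_gt0.
have key h' : `|h'| < r ->
    `|ivint f a (h' + s) - ivint f a s - f s * h'| <= e * `|h'|.
  have [->|h0] := eqVneq h' 0 => hh.
    by rewrite add0r subrr mulr0 subr0 normr0 mulr0.
  have := hr h'; rewrite /ball/= sub0r normrN => /(_ hh h0).
  rewrite distrC /GRing.scale/= mulr1 => hle.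
  rewrite -(ler_pM2r (_ : 0 < `|h'|)) ?normr_gt0// -normrM in hle.
  apply: le_trans hle; rewrite le_eqVlt; apply/orP; left; apply/eqP.
  by congr (`| _ |); field.
move=> c d cs sd rc dr.
have [rc1 rc2] : s - c < r /\ a < c.
  by move: rc; rewrite ltrBlDr -ltrBlDl lt_min => /andP[]; lra.
have dr1 : d - s < r by move: dr; rewrite -ltrBlDl lt_min => /andP[].
have k1 : `|ivint f a s - ivint f a c - f s * (s - c)| <= e * (s - c).
  have := key (c - s); rewrite subrK distrC (ger0_norm (x := s - c)) ?subr_ge0// => /(_ rc1).
  by rewrite -normrN; congr (`| _ | <= _); ring.
have k2 : `|ivint f a d - ivint f a s - f s * (d - s)| <= e * (d - s).
  by have := key (d - s); rewrite subrK (ger0_norm (x := d - s)) ?subr_ge0// => /(_ dr1).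
have -> : ivint f c d - f s * (d - c) = (ivint f a d - ivint f a s - f s * (d - s)) +
    (ivint f a s - ivint f a c - f s * (s - c)).
  by rewrite (@ivint_split f a c d hf (ltW rc2) (le_trans cs sd)); ring.
apply: le_trans (ler_normD _ _) _; lra.
Qed.


End IntervalIntegrals.

(** * Densities of absolutely continuous functions *)

Section Density.
Context {R : realType}.
Implicit Types (a b c d e s t : R) (F : R -> R).
Notation mu := (@lebesgue_measure R).

Lemma absc_density a b F : a <= b -> absc a b F ->
  exists f : R -> R, locint f /\
    forall c d, a <= c -> c <= d -> d <= b -> F d - F c = ivint f c d.
Proof.
rewrite le_eqVlt => /predU1P[<-|ab] aF.
  exists (cst 0); split=> [|c d ac cd da]; first exact: locint_cst.
  by rewrite ivint_cst// mul0r (_ : d = c) ?subrr//; lra.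
have [V [aV aVF ndV ndVF]] := absc_mono_decomp aF.
have [f [/locint_integrable fint fE]] := absc_nondecreasing_density ab aV ndV.
have [g [/locint_integrable gint gE]] := absc_nondecreasing_density ab aVF ndVF.
exists (fun x => f x - g x); split; first exact: locintB.
move=> c d ac cd db; rewrite ivintB//.
have := fE c d ac cd db; rewrite ivint_EFin// => -[->].
have := gE c d ac cd db; rewrite ivint_EFin// => -[->] /=.
ring.
Qed.

Lemma straddle_derive f F a b s : locint f -> a < s < b ->
  (forall c d, a <= c -> c <= d -> d <= b -> F d - F c = ivint f c d) ->
  straddle f s -> derive1 F s = f s.
Proof.
move=> hf /andP[as_ sb] hF hs; rewrite /derive1; apply/cvg_lim => //.
apply/cvgrPdist_le => e e0; have [r r0 hr] := hs e e0.
near=> h.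
have h0 : h != 0 by near: h; exact: nbhs_dnbhs_neq.
have hlt : `|h| < Num.min r (Num.min (s - a) (b - s)).
  near: h; apply: dnbhs0_lt; rewrite !lt_min r0 !subr_gt0; exact/and3P.
move: hlt; rewrite !lt_min => /and3P[hr1 hsa hbs].
suff : `|F (h + s) - F s - f s * h| <= e * `|h|.
  rewrite /GRing.scale/= -[e * _]mulr1 => le1.
  have -> : f s - h^-1 * (F (h + s) - F s) = - (F (h + s) - F s - f s * h) / h by field.
  by rewrite normrM normrN normfV ler_pdivrMr ?normr_gt0// -[leRHS]mulr1.
have [hp|hn] := leP 0 h.
  rewrite ger0_norm// in hr1 hsa hbs *.
  have := hr s (h + s); rewrite lexx => /(_ isT).
  by rewrite -(hF s (h + s)) ?addrK//; [apply; lra|lra|lra|lra].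
rewrite ltr0_norm// in hr1 hsa hbs *.
have := hr (h + s) s; rewrite lexx => hh.
have := hh _ isT _ _; rewrite -(hF (h + s) s); [|lra|lra|lra].
have -> : s - (h + s) = - h by ring.
rewrite -normrN => hh2; have := hh2 _ _ _.
have -> : - (F s - F (h + s) - f s * - h) = F (h + s) - F s - f s * h by ring.
by apply; lra.
Unshelve. all: by end_near. Qed.

End Density.

(** * Trajectories and their velocities *)

Section Trajectories.
Context {R : realType} {N : nat}.
Implicit Types (a b c d e s t : R) (x y u : R -> 'rV[R]_N) (w : 'rV[R]_N).
Notation mu := (@lebesgue_measure R).

(* The velocity is carried along as data; continuity on the whole line, rather than on [[a, b]] only,
   saves restricting the curves. *)
Definition traj a b x u := [/\ continuous x,
  (forall i, locint (fun s => u s ord0 i)) &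
  forall c d i, a <= c -> c <= d -> d <= b ->
    x d ord0 i - x c ord0 i = ivint (fun s => u s ord0 i) c d].

Lemma locint_dotv u w : (forall i, locint (fun s => u s ord0 i)) ->
  locint (fun s => dotv w (u s)).
Proof. by move=> hu; apply: locint_sum => i; exact: locintZ. Qed.

Lemma traj_dotv a b x u w : traj a b x u -> forall c d, a <= c -> c <= d -> d <= b ->
  dotv w (x d - x c) = ivint (fun s => dotv w (u s)) c d.
Proof.
move=> [_ hu hx] c d ac cd db; rewrite ivint_sum => [|i]; last exact: locintZ.
by apply: eq_bigr => i _; rewrite ivintZ// -hx// !mxE.
Qed.

Lemma traj_sub a b a' b' x u : traj a b x u -> a <= a' -> b' <= b -> traj a' b' x u.
Proof.
move=> [cx hu hx] aa bb; split => // c d i ac cd db; apply: hx => //.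
  exact: le_trans ac.
exact: le_trans bb.
Qed.

(** The increment is tested against itself: with [w = x d - x c], the square of [enorm w] is the
    integral of [dotv w (u s)], hence at most [enorm w] times the integral of [phi]. *)
Lemma traj_modulus a b x u (phi : R -> R) : traj a b x u -> locint phi ->
  {ae mu, forall s, a <= s <= b -> enorm (u s) <= phi s} ->
  forall c d, a <= c -> c <= d -> d <= b -> enorm (x d - x c) <= ivint phi c d.
Proof.
move=> xu hphi hae c d ac cd db.
have [_ hu _] := xu.
have ae' : {ae mu, forall s, c <= s <= d -> enorm (u s) <= phi s}.
  apply: ae_imp hae => s h /andP[cs sd]; apply: h.
  by rewrite (le_trans ac cs) (le_trans sd db).
have [w0|w0] := eqVneq (enorm (x d - x c)) 0.
  rewrite w0 -(mul0r (d - c)) -(ivint_cst 0 cd); apply: ivint_ae_le => //; first exact: locint_cst.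
  by apply: ae_imp ae' => s h /h; apply: le_trans; exact: enorm_ge0.
have wp : 0 < enorm (x d - x c) by rewrite lt_def w0 enorm_ge0.
rewrite -(ler_pM2l wp) -expr2 enorm_sqr (traj_dotv (x d - x c) xu)// -ivintZ//.
apply: ivint_ae_le; [exact: locint_dotv|exact: locintZ|].
apply: ae_imp ae' => s h /h le1; apply: le_trans (dotv_le_enorm _ _) _.
by rewrite ler_pM2l.
Qed.

(** The sum of the increments is at most the integral of [|phi|] over the union of the intervals,
    which is small with the measure of the union. Half-open intervals make the union disjoint. *)
Lemma abs_cont_on_modulus a b y (phi : R -> R) : locint phi ->
  (forall c d, a <= c -> c <= d -> d <= b -> enorm (y d - y c) <= ivint phi c d) ->
  abs_cont_on a b y.
Proof.
move=> hphi hy e e0; have [d d0 hd] := integral_small a b hphi e0.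
exists d => // n l r hlr hdisj hsum.
pose J (k : 'I_n) : set R := `]l k, r k]%classic.
have mJ k : measurable (J k) by exact: measurable_itv.
have tJ : trivIset setT J.
  apply/trivIsetP => k k' _ _ kk'; rewrite -subset0 => z [].
  rewrite /J /= !in_itv/= => /andP[h1 h2] /andP[h3 h4].
  by have [h|h] := hdisj k k' kk'; lra.
pose A := \big[setU/set0]_(k < n) J k.
have mA : measurable A by apply: bigsetU_measurable.
have Aab : A `<=` `[a, b]%classic.
  rewrite /A -bigcup_seq => z [k _]; rewrite /J /= !in_itv/= => /andP[h1 h2].
  by have [h3 [h4 h5]] := hlr k; rewrite (le_trans h3 (ltW h1)) (le_trans h2 h5).
have muA : (mu A < d%:E)%E.
  rewrite /A measure_semi_additive_ord// (_ : (\sum_(i < n) _)%E = (\sum_(k < n) (r k - l k))%:E) ?lte_fin//.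
  rewrite -sumEFin; apply: eq_bigr => k _; have [_ [lr _]] := hlr k.
  rewrite -[LHS]/(lebesgue_measure (J k)) /J lebesgue_measure_itv/= lte_fin.
  by case: ltgtP lr => // -> _; rewrite subrr.
have iA : mu.-integrable A (EFin \o (fun s => `|phi s|)).
  by apply: integrableS (locint_norm hphi a b) => //; exact: measurable_itv.
have := hd A mA Aab muA; rewrite -lte_fin.
rewrite /Rintegral fineK; last exact: integrable_fin_num.
rewrite /A ge0_integral_bigsetU//; last 3 first.
- by rewrite /index_enum -enumT; exact: enum_uniq.
- exact: sub_trivIset tJ.
- exact: measurable_int iA.
move=> hlt; rewrite -lte_fin; apply: le_lt_trans hlt.
rewrite -sumEFin; apply: lee_sum => k _; have [h1 [h2 h3]] := hlr k.
apply: (@le_trans _ _ (ivint (fun s => `|phi s|) (l k) (r k))%:E).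
  rewrite lee_fin; apply: le_trans (hy _ _ h1 h2 h3) _.
  by apply: ivint_le => //; [exact: locint_norm|move=> s _; exact: ler_norm].
rewrite -ivint_EFin; last exact: locint_norm.
rewrite -integral_itv_obnd_cbnd//.
by apply: measurable_funTS; apply/measurable_EFinP; apply: locint_measurable; exact: locint_norm.
Qed.

Lemma traj_abs_cont a b x u : traj a b x u -> abs_cont_on a b x.
Proof.
move=> xu; have [_ hu _] := xu.
have hs : locint (fun s => \sum_i `|u s ord0 i|).
  by apply: locint_sum => i; exact: locint_norm.
apply: (abs_cont_on_modulus hs); apply: traj_modulus xu hs _.
by apply: aeW => s _; exact: enorm_le_sum.
Qed.

Lemma abs_cont_on_coord a b x i : abs_cont_on a b x -> absc a b (fun s => x s ord0 i).
Proof.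
move=> hx e e0; have [d d0 hd] := hx e e0; exists d => // s s1 s2 s3.
have := hd (size s) (fun k => (nth (0, 0) s k).1) (fun k => (nth (0, 0) s k).2).
have sumE (f : R * R -> R) : \sum_(p <- s) f p = \sum_(k < size s) f (nth (0, 0) s k).
  by rewrite (big_nth (0, 0)) big_mkord.
rewrite sumE; move=> h; apply: le_lt_trans (h _ _ _).
- by apply: ler_sum => k _; have := coord_le_enorm (x (nth (0, 0) s k).2 - x (nth (0, 0) s k).1) i; rewrite !mxE.
- by move=> k; have /and3P[] := allP s1 (nth (0, 0) s k) (mem_nth _ (ltn_ord k)).
- move=> k k' kk'; have := pairwiseP (0, 0) s2 => pw.
  have [lt|gt|eq] := ltngtP k k'.
  + by have /orP := pw k k' (ltn_ord k) (ltn_ord k') lt.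
  + by have /orP[] := pw k' k (ltn_ord k') (ltn_ord k) gt; [right|left].
  + by move: kk'; rewrite (ord_inj eq) eqxx.
- by rewrite -(sumE (fun p => p.2 - p.1)).
Qed.

Lemma continuous_clamp a b x : a <= b -> abs_cont_on a b x ->
  continuous (fun s => x (clamp a b s)).
Proof.
move=> ab hx t; apply/continuous_enormP => e e0.
have [d d0 hd] := hx e e0.
have key s s' : s <= s' -> s' - s < d -> enorm (x (clamp a b s') - x (clamp a b s)) < e.
  move=> ss' sd; have := hd 1 (fun=> clamp a b s) (fun=> clamp a b s').
  rewrite !big_ord1; apply.
  - move=> _; have /andP[] := clamp_in s ab; have /andP[] := clamp_in s' ab.
    by move=> *; split=> //; split=> //; exact: clamp_le.
  - by move=> k k'; rewrite !ord1 eqxx.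
  - by apply: le_lt_trans sd; exact: clamp_dist.
near=> s; have sd : `|s - t| < d.
  by rewrite distrC; near: s; exact: cvgr_dist_lt.
have [st|ts] := leP s t.
  rewrite enormB; apply: key => //.
  by rewrite -normrN opprB ger0_norm ?subr_ge0// in sd.
by apply: key; [exact: ltW|rewrite gtr0_norm ?subr_gt0// in sd].
Unshelve. all: by end_near. Qed.

Lemma abs_cont_traj a b x : a <= b -> abs_cont_on a b x ->
  exists u, traj a b (fun s => x (clamp a b s)) u.
Proof.
move=> ab hx.
have [f hf] := choice (fun i => absc_density ab (abs_cont_on_coord i hx)).
exists (fun s => \row_i f i s); split.
- exact: continuous_clamp.
- move=> i; have [h _] := hf i.
  by under eq_fun do rewrite mxE.
- move=> c d i ac cd db; have [_ h] := hf i.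
  under [RHS]eq_ri do rewrite mxE.
  rewrite -h// !clamp_id//; first by rewrite ac (le_trans cd db).
  by rewrite db (le_trans ac cd).
Qed.

(** The curve [x'] of the cost is arbitrary outside [[a, b]], while the trajectory [x] is its
    continuous extension; the derivative sees only the interior, where they agree. *)
Lemma traj_xdot a b x x' u : traj a b x u -> (forall s, a <= s <= b -> x' s = x s) ->
  {ae mu, forall s, a < s < b -> xdot x' s = u s}.
Proof.
move=> [_ hu hx] xx'.
(* The coordinates are indexed by natural numbers with a proof of [n < N], so that countable
   additivity gives a single null set. *)
have : {ae mu, forall s, forall n (h : (n < N)%N), a < s ->
    straddle (fun s => u s ord0 (Ordinal h)) s}.
  apply/ae_foralln => n; have [h|h] : (n < N)%N \/ ~~ (n < N)%N by case: (n < N)%N; [left|right].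
    apply: ae_imp (ae_straddle a (hu (Ordinal h))) => s hs h'.
    by rewrite (bool_irrelevance h' h).
  by apply: aeW => s h'; case/negP: h.
apply: ae_imp => s hs /andP[as_ sb]; apply/rowP => i; rewrite mxE.
apply: (@straddle_derive _ (fun s => u s ord0 i) _ a b) => //; first exact/andP.
  move=> c d ac cd db; rewrite !xx' ?hx//; first by rewrite ac (le_trans cd db).
  by rewrite db (le_trans ac cd).
by have := hs _ (ltn_ord i) as_; congr straddle; apply/funext => s'; congr (_ _ _); exact: ord_inj.
Qed.

Lemma traj_glue a t b x1 u1 x2 u2 : traj a t x1 u1 -> traj t b x2 u2 ->
  x1 t = x2 t ->
  traj a b (fun s => if s < t then x1 s else x2 s) (fun s => if s < t then u1 s else u2 s).
Proof.
move=> [cx1 hu1 hx1] [cx2 hu2 hx2] xt; split.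
- move=> s; apply/continuous_enormP => e e0.
  have h1 := (continuous_enormP _ _).1 (cx1 s) e e0.
  have h2 := (continuous_enormP _ _).1 (cx2 s) e e0.
  have [st|ts|st] := ltgtP s t.
  + near=> s'; have -> : s' < t by near: s'; exact: lt_nbhsl.
    by near: s'.
  + near=> s'; have -> : (s' < t) = false.
      apply/negbTE; rewrite -leNgt; apply: ltW; near: s'; exact: lt_nbhsr.
    by near: s'.
  + near=> s'; rewrite -st in xt *; case: ifP => _; last by near: s'.
    by rewrite -xt; near: s'.
- move=> i; have := locint_if t (hu1 i) (hu2 i).
  by congr locint; apply/funext => s; case: ifP.
- have hv i : locint (fun s => (if s < t then u1 s else u2 s) ord0 i).
    have := locint_if t (hu1 i) (hu2 i).
    by congr locint; apply/funext => s; case: ifP.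
  move=> c d i ac cd db.
  have [dt|td] := ltP d t.
    rewrite (le_lt_trans cd dt) (hx1 _ _ _ ac cd (ltW dt)); apply: eq_ri => s /andP[_ sd].
    by rewrite (le_lt_trans sd dt).
  have [ct|tc] := ltP c t; last first.
    rewrite hx2//; apply: eq_ri => s /andP[cs _].
    by rewrite ltNge (le_trans tc cs).
  rewrite (ivint_split (hv i) (ltW ct) td).
  rewrite -[RHS](_ : ivint (fun s => u1 s ord0 i) c t + ivint (fun s => u2 s ord0 i) t d = _).
    by rewrite -(hx1 _ _ _ ac (ltW ct) (lexx t)) -(hx2 _ _ _ (lexx t) td db) xt; ring.
  congr (_ + _); last first.
    by apply: eq_ri => s /andP[ts _]; rewrite ltNge ts.
  (* At [t] the glued velocity is [u2 t]; passing to the half-open interval removes this point. *)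
  rewrite /ivint -!Rintegral_itv_bndo_bndc.
  - by apply: eq_Rintegral => s; rewrite inE /= in_itv/= => /andP[_ ->].
  - by apply: integrableS (hv i c t) => //; apply: subset_itvl; rewrite bnd_simp.
  - by apply: integrableS (hu1 i c t) => //; apply: subset_itvl; rewrite bnd_simp.
Unshelve. all: by end_near. Qed.

End Trajectories.

(** * The Lagrangian *)

Section LowerIntegral.
Context {R : realType}.
Implicit Types (f g : R -> \bar R) (D : set R).
Notation mu := (@lebesgue_measure R).
Import HBNNSimple.

(* No measurability is assumed: for nonnegative functions the library's integral
   is a supremum over simple minorants, which may be cut off on a null set. *)
Lemma ge0_ae_le_integral f g : (forall x, 0 <= f x)%E -> (forall x, 0 <= g x)%E ->
  {ae mu, forall x, (f x <= g x)%E} -> (\int[mu]_x f x <= \int[mu]_x g x)%E.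
Proof.
move=> f0 g0 [Z [mZ Z0 hZ]]; rewrite !ge0_integralTE//.
apply: ge_ereal_sup => _ [h /= hf <-].
pose h' := proj_nnsfun h (measurableC mZ).
have -> : sintegral mu h = sintegral mu h'.
  rewrite -!integralT_nnsfun; apply: ae_eq_integral => //.
  - by apply/measurable_EFinP.
  - by apply/measurable_EFinP.
  - exists Z; split => // x /= /not_implyP[_ hx]; apply: contrapT => nZ; apply: hx.
    by rewrite /h' /= mindicE mem_set//= mulr1.
apply: ereal_sup_ubound; exists h' => //= x.
rewrite mindicE; have [xZ|xZ] := boolP (x \in ~` Z); last by rewrite mulr0.
rewrite mulr1; apply: le_trans (hf x) _.
by apply: contrapT => hx; move: xZ; rewrite inE; apply; exact: hZ.
Qed.

(** Applied to the integrand of [cost], whose measurability in terms of [xdot] is not established.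
    Positive and negative parts are compared in both directions. *)
Lemma ae_eq_integral_nonmeasurable f g D : {ae mu, forall x, D x -> f x = g x} ->
  (\int[mu]_(x in D) f x = \int[mu]_(x in D) g x)%E.
Proof.
move=> fg.
have fgD : {ae mu, forall x, (f \_ D) x = (g \_ D) x}.
  by apply: ae_imp fg => x h; rewrite !patchE; case: ifPn => // /set_mem.
have key f1 g1 : {ae mu, forall x, f1 x = g1 x} -> (forall x, 0 <= f1 x)%E ->
    (forall x, 0 <= g1 x)%E -> (\int[mu]_x f1 x = \int[mu]_x g1 x)%E.
  move=> fg1 f0 g0; apply/eqP; rewrite eq_le !ge0_ae_le_integral//.
    by apply: ae_imp fg1 => x ->.
  by apply: ae_imp fg1 => x ->.
rewrite integral_mkcond [RHS]integral_mkcond integralE [RHS]integralE.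
congr (_ - _)%E; apply: key => //.
  by apply: ae_imp fgD => x h; rewrite !funeposE h.
by apply: ae_imp fgD => x h; rewrite !funenegE h.
Qed.

End LowerIntegral.

Section Lagrangian.
Context {R : realType} {N : nat}.
Notation vec := 'rV[R]_N.
Notation mu := (@lebesgue_measure R).
Implicit Types (t s r : R) (x p q v w : vec).

(** A countable set of slopes makes [L] a countable supremum, hence measurable along trajectories,
    and allows the finite suprema of slopes in the proof of lower semicontinuity. *)
Lemma rational_dense : exists pk : nat -> vec,
  forall p (e : R), 0 < e -> exists k, enorm (pk k - p) < e.
Proof.
exists (fun k => if @unpickle 'rV[rat]_N k is Some q then map_mx ratr q else 0).
move=> p e e0; pose h := e / N.+1%:R.
have h0 : 0 < h by rewrite divr_gt0.
have ex i : exists q : rat, `|ratr q - p ord0 i| < h.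
  have [|q] := @rat_in_itvoo R (p ord0 i - h) (p ord0 i + h); first lra.
  by rewrite in_itv/= => /andP[h1 h2]; exists q; rewrite ltr_norml; lra.
have [f hf] := choice ex.
exists (pickle (\row_i f i)); rewrite pickleK; apply: le_lt_trans (enorm_le_sum _) _.
apply: (@le_lt_trans _ _ (\sum_(i < N) h)).
  by apply: ler_sum => i _; rewrite !mxE ltW.
rewrite sumr_const card_ord -mulr_natl /h mulrCA -[ltRHS]mulr1 ltr_pM2l//.
by rewrite ltr_pdivrMr// mul1r ltr_nat.
Qed.

Variable H : R -> vec -> vec -> R.
Hypothesis cH : continuous (fun z : R * vec * vec => H z.1.1 z.1.2 z.2).
Local Notation L := (Hstar H).

Lemma Hstar_ge t x p v : ((dotv v p - H t x p)%:E <= L t x v)%E.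
Proof. by apply: ereal_sup_ubound; exists p. Qed.

Lemma Hstar_gtNy t x v : L t x v != -oo%E.
Proof. by rewrite gt_eqF// (lt_le_trans _ (Hstar_ge t x 0 v))// ltNyr. Qed.

Lemma cvg_H (U : Type) (F : set_system U) {FF : Filter F} (t : U -> R) (x p : U -> vec)
    (t0 : R) (x0 p0 : vec) :
  t @ F --> t0 -> x @ F --> x0 -> p @ F --> p0 ->
  H (t z) (x z) (p z) @[z --> F] --> H t0 x0 p0.
Proof.
move=> ht hx hp.
have h : (fun z => (t z, x z, p z)) @ F --> nbhs ((t0, x0, p0) : R * vec * vec).
  exact: (cvg_pair (cvg_pair ht hx) hp).
exact: (cvg_comp _ _ h (@cH (t0, x0, p0))).
Qed.

Lemma continuous_H_curve (x : R -> vec) p : continuous x -> continuous (fun s => H s (x s) p).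
Proof. by move=> cx s; apply: cvg_H; [exact: cvg_id|exact: cx|exact: cvg_cst]. Qed.

Lemma Hstar_le_dense (pk : nat -> vec) t x v (M : \bar R) :
  (forall p (e : R), 0 < e -> exists k, enorm (pk k - p) < e) ->
  (forall k, ((dotv v (pk k) - H t x (pk k))%:E <= M)%E) -> (L t x v <= M)%E.
Proof.
move=> dense hM; apply: ge_ereal_sup => _ [p _ <-].
apply/lee_addgt0Pr => e e0.
have cF : (fun q => dotv v q - H t x q) @ p --> dotv v p - H t x p.
  have c1 : (fun q : vec => q) @ nbhs p --> p by exact: cvg_id.
  have c2 : (fun _ : vec => v) @ nbhs p --> v by exact: cvg_cst.
  have c3 : (fun _ : vec => t) @ nbhs p --> t by exact: cvg_cst.
  have c4 : (fun _ : vec => x) @ nbhs p --> x by exact: cvg_cst.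
  apply: (@cvgB _ _ _ (nbhs p)); [exact: (@cvg_dotv _ _ _ (nbhs p) _ _ _ _ _ c2 c1)|exact: (@cvg_H _ (nbhs p) _ _ _ _ _ _ _ c3 c4 c1)].
have /nbhs_enormP[d d0 hd] : nbhs p [set q | `|(dotv v p - H t x p) - (dotv v q - H t x q)| < e].
  by move/cvgrPdist_lt : cF => /(_ e e0).
have [k /hd /= hk] := dense p d d0.
apply: le_trans (leeD2r e%:E (hM k)).
rewrite -EFinD lee_fin; move: hk; rewrite ltr_norml; lra.
Qed.

Lemma measurable_Hstar (x u : R -> vec) : continuous x ->
  (forall i, measurable_fun setT (fun s => u s ord0 i)) ->
  measurable_fun setT (fun s => L s (x s) (u s)).
Proof.
move=> cx mu_; have [pk dense] := rational_dense.
pose F k s := (dotv (u s) (pk k) - H s (x s) (pk k))%:E.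
have -> : (fun s => L s (x s) (u s)) = (fun s => esups (F ^~ s) 0%N).
  apply/funext => s; apply/eqP; rewrite eq_le; apply/andP; split.
    apply: (Hstar_le_dense dense) => k; apply: ereal_sup_ubound.
    by exists k.
  by apply: ge_ereal_sup => _ [k _ <-]; exact: Hstar_ge.
apply: measurable_fun_esups => k; apply/measurable_EFinP.
apply: measurable_funB.
  rewrite /dotv; apply: measurable_sum => i.
  by apply: measurable_funM => //; exact: mu_.
by apply: continuous_measurable_fun; exact: continuous_H_curve.
Qed.

(** Along the slopes [r *: v] the affine minorants grow like [r * enorm v * (enorm v - k)], which is
    unbounded in [r] if [enorm v > k]. *)
Lemma Hstar_dom_le t x v (k : R) : 0 <= k ->
  (forall p q, `|H t x p - H t x q| <= k * enorm (p - q)) ->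
  (L t x v < +oo)%E -> enorm v <= k.
Proof.
move=> k0 hk Lfin; rewrite leNgt; apply/negP => kv.
have Lf : L t x v \is a fin_num by rewrite fin_numElt Lfin andbT lt_neqAle leNye andbT eq_sym Hstar_gtNy.
pose M := fine (L t x v).
have hM r : 0 <= r -> r * (enorm v * (enorm v - k)) <= M + H t x 0.
  move=> r0; have := Hstar_ge t x (r *: v) v.
  rewrite -(fineK Lf) lee_fin dotvZr -enorm_sqr => h1.
  have := hk (r *: v) 0; rewrite subr0 enormZ (ger0_norm r0) ler_norml => /andP[_ h2].
  rewrite -/M in h1; move: h1 h2; nra.
have vp : 0 < enorm v * (enorm v - k) by rewrite mulr_gt0 ?subr_gt0// (le_lt_trans k0).
have M0 : 0 <= M + H t x 0 by have := hM 0 (lexx 0); rewrite mul0r.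
(* This [r] turns the left side of [hM] into [M + H t x 0 + 1], one more than its bound. *)
have := hM ((M + H t x 0 + 1) / (enorm v * (enorm v - k))).
rewrite divfK ?gt_eqF// => /(_ (divr_ge0 _ (ltW vp))) h.
by have := h ltac:(lra); lra.
Qed.

End Lagrangian.

(** * Integrals of functions bounded below *)

Section ShiftedIntegral.
Context {R : realType}.
Implicit Types (a b K : R) (f : R -> \bar R).
Notation mu := (@lebesgue_measure R).

(** An integral is the difference of the integrals of the two parts of [f]. The negative part
    contributes at most [K * (b - a)], so when the shifted integral is [+oo] the positive part is
    responsible and both sides are [+oo]. *)
Lemma integral_shift a b K f : a <= b -> 0 <= K -> measurable_fun setT f ->
  (forall s, a <= s <= b -> ((- K)%:E <= f s)%E) ->
  (\int[mu]_(s in `[a, b]) f s =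
   \int[mu]_(s in `[a, b]) (f s + K%:E) - (K * (b - a))%:E)%E.
Proof.
move=> ab K0 mf hf.
have mD : measurable (`[a, b]%classic : set (measurableTypeR R)) by exact: measurable_itv.
have mfD : measurable_fun `[a, b] f by exact: measurable_funTS.
have mfK : measurable_fun `[a, b] (fun s => f s + K%:E)%E.
  by apply: emeasurable_funD => //; exact: measurable_cst.
have fK0 s : `[a, b]%classic s -> (0 <= f s + K%:E)%E.
  by rewrite /= in_itv/= => /hf h; rewrite -leeBlDr// sub0e.
have intK : mu.-integrable `[a, b] (cst K%:E).
  exact: (locint_cst K a b).
have iK : (\int[mu]_(s in `[a, b]) K%:E = (K * (b - a))%:E)%E.
  by rewrite (ivint_EFin a b (locint_cst K)) ivint_cst.
have [fin|nfin] := boolP (\int[mu]_(s in `[a, b]) (f s + K%:E) < +oo)%E.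
  have ifK : mu.-integrable `[a, b] (fun s => f s + K%:E)%E.
    apply/integrableP; split => //; apply: le_lt_trans fin.
    rewrite le_eqVlt; apply/orP; left; apply/eqP.
    by apply: eq_integral => s /[!inE] /fK0 h; rewrite gee0_abs.
  rewrite -iK -integralB//; apply: eq_integral => s _.
  by rewrite addeK.
have hoo : (\int[mu]_(s in `[a, b]) (f s + K%:E) = +oo)%E.
  by apply/eqP; rewrite -leye_eq leNgt.
rewrite hoo addye// integralE.
have neg : (\int[mu]_(s in `[a, b]) f^\- s <= (K * (b - a))%:E)%E.
  rewrite -iK; apply: ge0_le_integral => //.
  - exact: measurable_funeneg.
  - move=> s; rewrite /= in_itv/= => /hf h; rewrite funenegE ge_max leeNl h/= lee_fin//.
have pos : (\int[mu]_(s in `[a, b]) f^\+ s = +oo)%E.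
  have : (+oo <= \int[mu]_(s in `[a, b]) f^\+ s + (K * (b - a))%:E)%E.
    rewrite -hoo -iK -ge0_integralD//; last exact: measurable_funepos.
    apply: ge0_le_integral => //.
    - by apply: emeasurable_funD => //; exact: measurable_funepos.
    - by move=> s _; apply: leeD2r; rewrite funeposE le_max lexx.
  by set I := integral _ _ _; case: I.
by rewrite pos addye//; move: neg; set I := integral _ _ _; case: I.
Qed.

End ShiftedIntegral.

(** * A priori bounds *)

Section Hamiltonian.
Context {R : realType} {N : nat}.
Notation vec := 'rV[R]_N.
Notation mu := (@lebesgue_measure R).
Implicit Types (T a b r s t K M : R) (H : R -> vec -> vec -> R) (c : R -> R).

(* (H1)-(H4) for a Hamiltonian whose time variable has been extended to the whole line. *)
Record regular_hamiltonian T H c : Prop := RegularHamiltonian {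
  rh_cont : continuous (fun z : R * vec * vec => H z.1.1 z.1.2 z.2);
  rh_convex : forall t x p q (l : R), 0 <= l <= 1 ->
    H t x (l *: p + (1 - l) *: q) <= l * H t x p + (1 - l) * H t x q;
  rh_lip : forall r, 0 <= r -> exists2 C : R, 0 <= C &
    forall t x p q, enorm x <= r -> `|H t x p - H t x q| <= C * enorm (p - q);
  rh_lint : locint c;
  rh_ge0 : forall s, 0 <= c s;
  rh_growth : {ae mu, forall t, 0 <= t <= T ->
     forall x p q, `|H t x p - H t x q| <= c t * (1 + enorm x) * enorm (p - q)} }.

Lemma hamiltonian_bounded H T M (q : vec) :
  continuous (fun z : R * vec * vec => H z.1.1 z.1.2 z.2) ->
  exists2 K, 0 <= K & forall s x, 0 <= s <= T -> enorm x <= M -> `|H s x q| <= K.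
Proof.
move=> cH.
have cH2 : continuous (fun z : R * vec => H z.1 z.2 q).
  move=> z; apply: (@cvg_H _ _ H cH _ (nbhs z)); [exact: cvg_fst|exact: cvg_snd|exact: cvg_cst].
have cpt : compact (`[0, T]%classic `*` [set x : vec | enorm (x - 0) <= M]).
  by apply: compact_setX; [exact: segment_compact|exact: compact_enorm_ball].
have /compact_bounded[K [_ hK]] := continuous_compact (continuous_subspaceT cH2) cpt.
exists (`|K| + 1); first by rewrite addr_ge0.
move=> s x sT xM; apply: (hK (`|K| + 1)).
  by rewrite (le_lt_trans (ler_norm _))// ltrDl.
by exists (s, x) => //=; rewrite in_itv/= subr0.
Qed.

(** On an interval of length below [d] the integral of [c] is less than 1/2, so the maximum [M] of
    [1 + enorm (x s)] satisfies [M <= 1 + enorm (x a') + M / 2]. The bound doubles at most once per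
    step of length [d / 2], and the number [n] of steps depends only on [c] and [T], not on the
    trajectory. *)
Lemma gronwall (c : R -> R) T : 0 <= T -> locint c -> (forall s, 0 <= c s) ->
  exists2 A, 1 <= A & forall a b x u, 0 <= a -> b <= T -> @traj R N a b x u ->
    {ae mu, forall s, a <= s <= b -> enorm (u s) <= c s * (1 + enorm (x s))} ->
    forall s, a <= s <= b -> 1 + enorm (x s) <= A * (1 + enorm (x a)).
Proof.
move=> T0 hc c0; have h20 : 0 < 2^-1 :> R by [].
have [d d0 hd] := ivint_small 0 T hc h20.
have [n hn] : exists n, T / (d / 2) <= n%:R.
  exists (Num.bound (T / (d / 2))); apply/ltW/archi_boundP.
  by rewrite divr_ge0// divr_ge0// ltW.
exists (2 ^+ n); first by rewrite exprn_ege1// ler1n.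
move=> a b x u a0 bT xu hae.
have step a' s : a <= a' -> a' <= s -> s <= b -> s - a' < d ->
    1 + enorm (x s) <= 2 * (1 + enorm (x a')).
  move=> aa' a's sb sd.
  have cx : {within `[a', s], continuous (fun z => enorm (x z))}.
    by apply: continuous_subspaceT => z; apply: cvg_enorm; case: xu => cx _ _; exact: cx.
  have [m min hm] := EVT_max a's cx.
  move: min; rewrite in_itv/= => /andP[a'm ms].
  pose M := 1 + enorm (x m).
  have lphi : locint (fun z => M * c z) by exact: locintZ.
  have := traj_modulus (traj_sub xu aa' (le_trans ms sb)) lphi.
  have hae' : {ae mu, forall z, a' <= z <= m -> enorm (u z) <= M * c z}.
    apply: ae_imp hae => z hz /andP[a'z zm]; apply: (le_trans (hz _)).
      by rewrite (le_trans aa' a'z) (le_trans zm (le_trans ms sb)).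
    rewrite mulrC ler_wpM2r// lerD2l; apply: hm.
    by rewrite in_itv/= a'z (le_trans zm ms).
  move=> /(_ hae' _ _ (lexx _) a'm (lexx _)); rewrite ivintZ// => h1.
  have h2 : ivint c a' m < 2^-1.
    rewrite (@eq_ri _ c (fun z => `|c z|)); last by move=> z _; rewrite ger0_norm.
    apply: hd => //; [exact: le_trans a0 aa'|by rewrite (le_trans ms)// (le_trans sb)|].
    by apply: le_lt_trans sd; rewrite lerB.
  have h3 := enorm_dist (x m) (x a') 0; rewrite !subr0 in h3.
  have h4 : enorm (x s) <= enorm (x m) by apply: hm; rewrite in_itv/= lexx a's.
  have M0 : 0 < M by rewrite /M ltr_pwDl// enorm_ge0.
  have h5 : M * ivint c a' m <= M * 2^-1 by rewrite ler_pM2l// ltW.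
  rewrite /M in h1 h5; lra.
have main k s : a <= s -> s <= b -> s - a <= k%:R * (d / 2) ->
    1 + enorm (x s) <= 2 ^+ k * (1 + enorm (x a)).
  elim: k s => [|k IH] s as_ sb sk.
    by rewrite expr0 mul1r (_ : s = a)//; lra.
  have P0 : 0 <= 2 ^+ k * (1 + enorm (x a)).
    by rewrite mulr_ge0// addr_ge0// enorm_ge0.
  have [sk'|sk'] := leP (s - a) (k%:R * (d / 2)).
    by apply: le_trans (IH s as_ sb sk') _; rewrite exprS; lra.
  have kd : 0 <= k%:R * (d / 2) by rewrite mulr_ge0// ltW// divr_gt0.
  have := IH (a + k%:R * (d / 2)) ltac:(lra) ltac:(lra) ltac:(lra).
  have := step (a + k%:R * (d / 2)) s ltac:(lra) ltac:(lra) sb.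
  rewrite exprS; move: sk; rewrite mulrSr => sk h h'.
  by have := h ltac:(lra); lra.
move=> s /andP[as_ sb]; apply: main => //.
rewrite -ler_pdivrMr ?divr_gt0//; apply: le_trans hn.
rewrite ler_pM2r ?invr_gt0 ?divr_gt0//; lra.
Qed.

End Hamiltonian.

Lemma lsc_bounded_below (T : topologicalType) (R : realType) (f : T -> \bar R) (A : set T) :
  lower_semicontinuous f -> (forall x, f x != -oo%E) -> compact A ->
  exists m : R, forall x, A x -> (m%:E <= f x)%E.
Proof.
move=> lf fN /compact_near_coveringP cA.
have [|n _ hn] := cA nat \oo (fun n x => ((- n%:R)%:E < f x)%E) _.
  move=> x _.
  have [k hk] : exists k : nat, ((- k%:R)%:E < f x)%E.
    have := fN x; case: (f x) => [r _| _|//].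
      exists (Num.bound `|r|); rewrite lte_fin ltrNl.
      by apply: le_lt_trans (archi_boundP (normr_ge0 r)); rewrite ler_normr lexx orbT.
    by exists 0%N; rewrite ltry.
  have [W xW hW] := lf x _ hk.
  exists (W, [set n | (k <= n)%N]) => /=; first by split => //; exists k.
  move=> [y n] [/= Wy kn]; apply: le_lt_trans (hW y Wy).
  by rewrite lee_fin lerN2 ler_nat.
by exists (- n%:R) => x Ax; apply/ltW/(hn n (leqnn n)).
Qed.

(** * The value function in terms of trajectories *)

Section ValueFunction.
Context {R : realType} {N : nat}.
Notation vec := 'rV[R]_N.
Notation mu := (@lebesgue_measure R).
Implicit Types (T a b r s t K M : R) (H : R -> vec -> vec -> R) (c : R -> R)
  (g : vec -> \bar R) (x u : R -> vec).

Definition running H a b x u : \bar R :=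
  (\int[mu]_(s in `[a, b]) Hstar H s (x s) (u s))%E.

Lemma ae_interior (P : R -> Prop) a b : {ae mu, forall s, a < s < b -> P s} ->
  {ae mu, forall s, a <= s <= b -> P s}.
Proof.
have ne (z : R) : {ae mu, forall s, s <> z}.
  exists [set z]; split; [exact: measurable_set1|exact: lebesgue_measure_set1|].
  by move=> s /= /contrapT.
move=> h; apply: ae_imp (ae_and h (ae_and (ne a) (ne b))) => s [h1 [sa sb]] /andP[as_ sb'].
apply: h1; rewrite !lt_neqAle as_ sb' !andbT eq_sym.
by apply/andP; split; apply/eqP.
Qed.

Lemma running_xdot H a b x x' u : traj a b x u -> (forall s, a <= s <= b -> x' s = x s) ->
  (\int[mu]_(s in [set s : R | (a <= s <= b)%R]) Hstar H s (x' s) (xdot x' s))%E =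
  running H a b x u.
Proof.
move=> xu xx'; rewrite /running (_ : [set s | _] = `[a, b]%classic); last first.
  by apply/seteqP; split => s; rewrite /= in_itv.
apply: ae_eq_integral_nonmeasurable.
apply: ae_imp (ae_interior (traj_xdot xu xx')) => s h.
by rewrite /= in_itv/= => sab; rewrite h// xx'.
Qed.

Lemma running1 H a x u : running H a a x u = 0%E.
Proof. by rewrite /running set_itv1 integral_set1. Qed.

(** Here and in [value_function_lt] the time [t = T] is included: the running cost over a point is
    0, so [V] is an infimum over trajectories on all of [[0, T]]. *)
Lemma value_function_le H g T t x u : 0 <= t <= T -> traj t T x u ->
  (value_function H g T t (x t) <= g (x T) + running H t T x u)%E.
Proof.
move=> /andP[t0 tT] xu; rewrite /value_function t0 /=.
have [{}tT|Tt] := ltP t T.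
  apply: ereal_inf_lbound; exists x; first by split => //; exact: traj_abs_cont xu.
  by rewrite /cost (running_xdot H xu).
have -> : t = T by apply/eqP; rewrite eq_le tT Tt.
by rewrite eqxx running1 adde0.
Qed.

Lemma traj_cst a b (x0 : vec) : traj a b (fun=> x0) (fun=> 0).
Proof.
split=> [s|i|c d i ac cd db]; first exact: cvg_cst.
  by apply: locint_continuous => s; exact: cvg_cst.
by rewrite subrr mxE -/(cst 0) ivint_cst// mul0r.
Qed.

Lemma value_function_lt H g T t (x0 : vec) (al : \bar R) : 0 <= t <= T ->
  (value_function H g T t x0 < al)%E ->
  exists x u, [/\ traj t T x u, x t = x0 & (g (x T) + running H t T x u < al)%E].
Proof.
move=> /andP[t0 tT]; rewrite /value_function t0 /=.
have [{}tT|Tt] := ltP t T.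
  move=> /ereal_inf_lt[_ [x [ax xt] <-] h].
  have [u xu] := abs_cont_traj (ltW tT) ax.
  exists (fun s => x (clamp t T s)), u; split => //.
    by rewrite clamp_id// lexx ltW.
  rewrite -(@running_xdot H t T _ x)//; first by rewrite clamp_id ?lexx ?andbT ?ltW.
  by move=> s sT; rewrite clamp_id.
have -> : t = T by apply/eqP; rewrite eq_le tT Tt.
rewrite eqxx => h; exists (fun=> x0), (fun=> 0); split => //; first exact: traj_cst.
by rewrite running1 adde0.
Qed.

Lemma measurable_running H a b x u :
  continuous (fun z : R * vec * vec => H z.1.1 z.1.2 z.2) -> traj a b x u ->
  measurable_fun setT (fun s => Hstar H s (x s) (u s)).
Proof.
move=> cH [cx hu _]; apply: measurable_Hstar => // i; exact: locint_measurable.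
Qed.

Lemma running_ae_fin H a b x u :
  continuous (fun z : R * vec * vec => H z.1.1 z.1.2 z.2) -> a <= b -> traj a b x u ->
  (running H a b x u < +oo)%E ->
  {ae mu, forall s, a <= s <= b -> (Hstar H s (x s) (u s) < +oo)%E}.
Proof.
move=> cH ab xu; have [cx _ _] := xu.
have [K K0 hK] : exists2 K, 0 <= K & forall s, a <= s <= b -> H s (x s) 0 <= K.
  have cc : {within `[a, b], continuous (fun s => H s (x s) 0)}.
    by apply: continuous_subspaceT; exact: continuous_H_curve.
  have [m _ hm] := EVT_max ab cc.
  exists `|H m (x m) 0| => // s sab; apply: le_trans (ler_norm _).
  by apply: hm; rewrite in_itv.
have mL := measurable_running cH xu.
have Lge s : a <= s <= b -> ((- K)%:E <= Hstar H s (x s) (u s))%E.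
  move=> sab; apply: le_trans (Hstar_ge H s (x s) 0 (u s)).
  by rewrite dotv0r sub0r lee_fin lerN2 hK.
rewrite /running (integral_shift ab K0 mL Lge) lteBlDr// addye// => fin.
have mD : measurable (`[a, b]%classic : set (measurableTypeR R)) by exact: measurable_itv.
have int : mu.-integrable `[a, b] (fun s => Hstar H s (x s) (u s) + K%:E)%E.
  apply/integrableP; split.
    by apply: measurable_funTS; apply: emeasurable_funD => //; exact: measurable_cst.
  apply: le_lt_trans fin; rewrite le_eqVlt; apply/orP; left; apply/eqP.
  apply: eq_integral => s; rewrite inE /= in_itv/= => /Lge h; rewrite gee0_abs//.
  by rewrite -leeBlDr// sub0e.
apply: ae_imp (integrable_ae mD int) => s h sab.
have /h : `[a, b]%classic s by rewrite /= in_itv.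
by rewrite fin_numD ltey => /andP[/fin_numP[]].
Qed.

Section Bounds.
Variables (T : R) (H : R -> vec -> vec -> R) (c : R -> R).
Hypotheses (T0 : 0 <= T) (rH : regular_hamiltonian T H c).

(** A finite cost puts the velocity in the domain of [L] almost everywhere; (H4) bounds that domain
    by [c s * (1 + enorm (x s))], and Gronwall's inequality turns this into a bound on the curve.
    [M] is uniform in the starting time and over the ball of radius [r]. *)
Lemma trajectory_bound r : exists2 M, 0 <= M & forall t x u, 0 <= t <= T ->
  traj t T x u -> enorm (x t) <= r -> (running H t T x u < +oo)%E ->
  (forall s, t <= s <= T -> enorm (x s) <= M) /\
  {ae mu, forall s, t <= s <= T -> enorm (u s) <= (1 + M) * c s}.
Proof.
have [A A1 hA] := @gronwall R N c T T0 (rh_lint rH) (rh_ge0 rH).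
have M0 : 0 <= A * (1 + `|r|) by rewrite mulr_ge0 ?addr_ge0// (le_trans _ A1).
exists (A * (1 + `|r|)) => // t x u /andP[t0 tT] xu xr fin.
have hae : {ae mu, forall s, t <= s <= T -> enorm (u s) <= c s * (1 + enorm (x s))}.
  apply: ae_imp (ae_and (rh_growth rH) (running_ae_fin (rh_cont rH) tT xu fin)) => s [h1 h2] stT.
  have /andP[ts sT] := stT.
  apply: (@Hstar_dom_le _ _ H s (x s)) (h2 stT).
    by rewrite mulr_ge0 ?(rh_ge0 rH)// addr_ge0// enorm_ge0.
  by move=> p q; apply: h1; rewrite (le_trans t0 ts).
have hM s : t <= s <= T -> enorm (x s) <= A * (1 + `|r|).
  move=> stT; have := hA t T x u t0 (lexx T) xu hae s stT.
  have : A * (1 + enorm (x t)) <= A * (1 + `|r|).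
    rewrite ler_wpM2l ?(le_trans _ A1)// lerD2l.
    by apply: le_trans xr _; exact: ler_norm.
  lra.
split => //; apply: ae_imp hae => s h stT.
apply: le_trans (h stT) _; rewrite mulrC ler_wpM2r ?(rh_ge0 rH)// lerD2l; exact: hM.
Qed.

(** Inside a fixed ball (H3) replaces the integrable bound on the speed by a constant, so that mean
    velocities from every starting time are bounded. *)
Lemma speed_bound M : 0 <= M -> exists2 C, 0 <= C & forall t x u, t <= T ->
  traj t T x u -> (running H t T x u < +oo)%E ->
  (forall s, t <= s <= T -> enorm (x s) <= M) ->
  {ae mu, forall s, t <= s <= T -> enorm (u s) <= C}.
Proof.
move=> M0; have [C C0 hC] := rh_lip rH M0; exists C => // t x u tT xu fin hM.
apply: ae_imp (running_ae_fin (rh_cont rH) tT xu fin) => s h stT.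
apply: (@Hstar_dom_le _ _ H s (x s)) (h stT) => // p q.
by apply: hC; exact: hM.
Qed.

Lemma Hstar_lower_bound M : exists2 K, 0 <= K & forall s (x v : vec), 0 <= s <= T ->
  enorm x <= M -> ((- K)%:E <= Hstar H s x v)%E.
Proof.
have [K K0 hK] := hamiltonian_bounded T M 0 (rh_cont rH).
exists K => // s x v sT xM; apply: le_trans (Hstar_ge H s x 0 v).
rewrite dotv0r sub0r lee_fin lerN2; apply: le_trans (hK s x sT xM); exact: ler_norm.
Qed.

Lemma running_ge t x u K : 0 <= t <= T -> traj t T x u -> 0 <= K ->
  (forall s, t <= s <= T -> ((- K)%:E <= Hstar H s (x s) (u s))%E) ->
  ((- (K * (T - t)))%:E <= running H t T x u)%E.
Proof.
move=> /andP[t0 tT] xu K0 hK.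
rewrite /running (integral_shift tT K0 (measurable_running (rh_cont rH) xu) hK).
rewrite leeBrDr// -EFinD addNr; apply: integral_ge0 => s; rewrite /= in_itv/= => /hK h.
by rewrite -leeBlDr// sub0e.
Qed.

(** All competitors end in the ball of radius [M], where [g] is bounded below by compactness, and
    their running cost is at least [- K * T]. *)
Lemma value_function_bounded_below g r : proper_ext g -> lower_semicontinuous g ->
  exists m : R, forall t (x0 : vec), 0 <= t <= T -> enorm x0 <= r ->
    (m%:E <= value_function H g T t x0)%E.
Proof.
move=> [gN _] lg; have [M M0 hM] := trajectory_bound r.
have [K K0 hK] := Hstar_lower_bound M.
have [m hm] := lsc_bounded_below lg gN (@compact_enorm_ball R N 0 M).
exists (m - K * T) => t x0 tT x0r; rewrite leNgt; apply/negP.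
move=> /(value_function_lt tT)[x [u [xu xt lt]]].
have runfin : (running H t T x u < +oo)%E.
  rewrite ltey; apply/eqP => e; move: lt; rewrite e addey ?gN//.
have := hM t x u tT xu; rewrite xt => /(_ x0r runfin)[hx _].
have h1 : ((- (K * (T - t)))%:E <= running H t T x u)%E.
  apply: running_ge => // s /[dup] stT /andP[ts sT]; apply: hK; last exact: hx.
  by case/andP: tT => t0 _; rewrite (le_trans t0 ts).
have h2 : (m%:E <= g (x T))%E.
  by apply: hm; rewrite /= subr0; apply: hx; case/andP: tT => _ ->; rewrite lexx.
have := leeD h2 h1; rewrite -EFinD => h3; have := le_lt_trans h3 lt.
rewrite lte_fin => h4; have : 0 <= K * t by case/andP: tT => t0 _; rewrite mulr_ge0.
lra.
Qed.

End Bounds.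
End ValueFunction.

(** * Compactness and existence of curves *)

Section Ascoli.
Context {R : realType} {N : nat}.
Notation vec := 'rV[R]_N.
Implicit Types (a b c d e M : R).

Lemma uniform_grid a b d : 0 < d -> exists (m : nat) (t : 'I_m -> R),
  forall s, a <= s <= b -> exists i, [/\ a <= t i, t i <= s & s - t i < d].
Proof.
move=> d0; pose m := Num.bound ((b - a) / d).
exists m.+1, (fun i => a + i%:R * d) => s /andP[as_ sb].
have sd0 : 0 <= (s - a) / d by rewrite divr_ge0 ?subr_ge0// ltW.
pose k := Num.truncn ((s - a) / d).
have /andP[k1 k2] := truncn_itv sd0.
have km : (k < m.+1)%N.
  rewrite ltnS ltnW// -(ltr_nat R) -/k; apply: (le_lt_trans k1).
  apply: (@le_lt_trans _ _ ((b - a) / d)); first by rewrite ler_pM2r ?invr_gt0//; lra.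
  by apply: archi_boundP; apply: le_trans sd0 _; rewrite ler_pM2r ?invr_gt0//; lra.
exists (Ordinal km) => /=; split.
- by rewrite lerDl mulr_ge0// ltW.
- by move: k1; rewrite ler_pdivlMr// -/k; lra.
- by move: k2; rewrite ltr_pdivrMr// -/k -natr1 mulrDl mul1r; lra.
Qed.

(** Tychonoff's theorem gives a cluster point [z] for pointwise convergence. It inherits the modulus
    of continuity, so closeness at the finitely many points of a grid becomes uniform closeness. *)
Lemma ascoli_cluster (y : nat -> R -> vec) a b M :
  (forall n s, enorm (y n s) <= M) ->
  (forall e, 0 < e -> exists2 d, 0 < d & forall n s s', a <= s -> s <= s' -> s' <= b ->
    s' - s < d -> enorm (y n s' - y n s) <= e) ->
  exists z : R -> vec, forall e, 0 < e -> forall n0, exists2 n, (n0 <= n)%N &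
    forall s, a <= s <= b -> enorm (y n s - z s) <= e.
Proof.
move=> yM yeq.
pose A (s : R) := [set v : vec | enorm (v - 0) <= M].
have cA : compact (fun f : prod_topology (fun _ : R => vec) => forall s, A s (f s)).
  by apply: tychonoff => s; exact: compact_enorm_ball.
have FA : (y @ \oo) (fun f : prod_topology (fun _ : R => vec) => forall s, A s (f s)).
  by exists 0%N => // n _ s; rewrite /A /= subr0.
have [z [_ zcl]] := cA _ _ FA.
have close e m (t : 'I_m -> R) n0 : 0 < e -> exists2 n, (n0 <= n)%N &
    forall i, enorm (y n (t i) - z (t i)) < e.
  move=> e0; have [||f [[n /= n0n <-] hn]] := zcl (y @` [set n | (n0 <= n)%N])
      (fun f => forall i : 'I_m, enorm (f (t i) - z (t i)) < e).
  - by exists n0 => // n n0n; exists n.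
  - apply: (@filter_forall _ _ (fun i (f : R -> vec) => enorm (f (t i) - z (t i)) < e)
      _ (@nbhs_filter (prod_topology (fun _ : R => vec)) z)) => i.
    apply: (@proj_continuous R (fun _ => vec) (t i) z [set v | enorm (v - z (t i)) < e]).
    by apply/nbhs_enormP; exists e.
  by exists n.
have zeq e d : 0 < e -> (forall n s s', a <= s -> s <= s' -> s' <= b -> s' - s < d ->
      enorm (y n s' - y n s) <= e) ->
    forall s s', a <= s -> s <= s' -> s' <= b -> s' - s < d -> enorm (z s' - z s) <= e.
  move=> e0 hd s s' as_ ss' s'b sd; apply/ler_addgt0Pr => eta eta0.
  have [|n _ hn] := close (eta / 2) 2 (fun i => if i == ord0 then s else s') 0%N.
    by rewrite divr_gt0.
  have h1 := hn ord0; have h2 := hn ord_max; rewrite /= in h1 h2.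
  have h3 := hd n s s' as_ ss' s'b sd.
  have h4 := enorm_dist (z s') (y n s') (z s).
  have h5 := enorm_dist (y n s') (y n s) (z s).
  rewrite (enormB (z s') (y n s')) in h4; lra.
exists z => e e0 n0; have e30 : 0 < e / 3 by rewrite divr_gt0.
have [d d0 hd] := yeq _ e30.
have [m [t ht]] := uniform_grid a b d0.
have [n n0n hn] := close _ _ t n0 e30; exists n => // s /[dup] sab /ht[i [h1 h2 h3]].
have sb : s <= b by case/andP: sab.
have k1 := hd n _ _ h1 h2 sb h3; have k2 := zeq _ _ e30 hd _ _ h1 h2 sb h3.
have k3 := hn i.
have k4 := enorm_dist (y n s) (y n (t i)) (z s).
have k5 := enorm_dist (y n (t i)) (z (t i)) (z s).
rewrite (enormB (z (t i)) (z s)) in k5; lra.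
Qed.

Lemma ascoli_subsequence (y : nat -> R -> vec) a b M :
  (forall n s, enorm (y n s) <= M) ->
  (forall e, 0 < e -> exists2 d, 0 < d & forall n s s', a <= s -> s <= s' -> s' <= b ->
    s' - s < d -> enorm (y n s' - y n s) <= e) ->
  exists (z : R -> vec) (phi : nat -> nat), forall k, (k <= phi k)%N /\
    forall s, a <= s <= b -> enorm (y (phi k) s - z s) <= k.+1%:R^-1.
Proof.
move=> yM yeq; have [z hz] := ascoli_cluster yM yeq.
have h k : exists n, (k <= n)%N /\
    forall s, a <= s <= b -> enorm (y n s - z s) <= k.+1%:R^-1.
  by have [|n kn hn] := hz k.+1%:R^-1 _ k; [rewrite invr_gt0|exists n].
have [phi hphi] := choice h.
by exists z, phi.
Qed.

(** [G] need not be uniformly continuous on the whole space; compactness of [[a, b]] gives one [d]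
    for a tube around the graph of [y]. *)
Lemma uniform_near_graph (G : R -> vec -> R) (y : R -> vec) a b e :
  continuous (fun z : R * vec => G z.1 z.2) -> continuous y -> 0 < e ->
  exists2 d, 0 < d & forall s v, a <= s <= b -> enorm (v - y s) < d ->
    `|G s v - G s (y s)| < e.
Proof.
move=> cG cy e0.
have /compact_near_coveringP cab := @segment_compact R a b.
have [|r r0 hr] := cab R (0 : R)^'+ (fun d s => forall v, enorm (v - y s) < d ->
    `|G s v - G s (y s)| < e) _.
  move=> s0 _.
  have e20 : 0 < e / 2 by rewrite divr_gt0.
  have := @cG (s0, y s0); move=> /cvgrPdist_lt/(_ _ e20)[[/= U W] [Us Wy] hUW].
  have [r r0 hW] := (nbhs_enormP _ _).1 Wy.
  have r20 : 0 < r / 2 by rewrite divr_gt0.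
  have cys := (continuous_enormP _ _).1 (cy s0) _ r20.
  exists ([set s | U s /\ enorm (y s - y s0) < r / 2], [set d | d < r / 2]).
    split => /=; first exact: filterI.
    by near=> d; near: d; apply: nbhs_right_lt.
  move=> [s d] [/= [sU sy] dr] v vd.
  have k1 := hUW (s, v); have k2 := hUW (s, y s); rewrite /= in k1 k2.
  have j1 : `|G s0 (y s0) - G s v| < e / 2.
    apply: k1; split => //; apply: hW.
    have := enorm_dist v (y s) (y s0); lra.
  have j2 : `|G s0 (y s0) - G s (y s)| < e / 2.
    by apply: k2; split => //; apply: hW; lra.
  move: j1 j2; rewrite !ltr_norml => /andP[? ?] /andP[? ?]; apply/andP; split; lra.
rewrite /= in r0; exists (r / 2); first by rewrite divr_gt0.
move=> s v sab; apply: (hr (r / 2)) => //=.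
- by rewrite sub0r normrN gtr0_norm ?divr_gt0//; lra.
- by rewrite divr_gt0.
Unshelve. all: by end_near. Qed.

End Ascoli.

(** * Backward solutions for a bounded continuous right-hand side *)

Section Peano.
Context {R : realType} {N : nat}.
Notation vec := 'rV[R]_N.
Implicit Types (a b c d e C s t : R) (w y : R -> vec).

Lemma ler_eps (x z : R) : (forall e, 0 < e -> x <= z + e) -> x <= z.
Proof. by move=> h; apply/ler_addgt0Pr. Qed.

Definition vec_ivint w c d : vec := \row_i ivint (fun s => w s ord0 i) c d.

Lemma locint_coord w : continuous w -> forall i, locint (fun s => w s ord0 i).
Proof.
move=> cw i; apply: locint_continuous => s.
exact: (cvg_comp _ _ (cw s) (@coord_continuous R 1 N ord0 i (w s))).
Qed.

Lemma vec_ivint_split w c d e : continuous w -> c <= d -> d <= e ->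
  vec_ivint w c e = vec_ivint w c d + vec_ivint w d e.
Proof.
by move=> cw cd de; apply/rowP => i; rewrite !mxE; apply: ivint_split => //; exact: locint_coord.
Qed.

Lemma enorm_vec_ivint w C c d : continuous w -> (forall s, enorm (w s) <= C) -> c <= d ->
  enorm (vec_ivint w c d) <= C * (d - c).
Proof.
move=> cw wC cd; set v := vec_ivint w c d.
have dv : dotv v v = ivint (fun s => dotv v (w s)) c d.
  rewrite ivint_sum => [|i]; last exact/locintZ/locint_coord.
  by apply: eq_bigr => i _; rewrite ivintZ ?mxE//; exact: locint_coord.
have [v0|v0] := eqVneq (enorm v) 0.
  by rewrite v0 mulr_ge0 ?subr_ge0//; apply: le_trans (wC c); exact: enorm_ge0.
have vp : 0 < enorm v by rewrite lt_def v0 enorm_ge0.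
rewrite -(ler_pM2l vp) -expr2 enorm_sqr dv mulrA -ivint_cst//.
apply: ivint_le; [exact/locint_dotv/locint_coord|exact: locint_cst|].
move=> s _; apply: le_trans (dotv_le_enorm _ _) _.
by rewrite ler_pM2l.
Qed.

(** [F] is not assumed Lipschitz, so the solution is a limit of delayed equations: going backwards
    from [t], the argument of [F] is read at a time ahead by [n.+1%:R^-1], where the curve is
    already known. All approximations are [C]-Lipschitz, and Ascoli's theorem applies. *)
Lemma peano (F : R -> vec -> vec) C t (x0 : vec) :
  continuous (fun z : R * vec => F z.1 z.2) -> (forall s v, enorm (F s v) <= C) ->
  exists y, [/\ traj (t - 1) t y (fun s => F s (y s)), y t = x0 &
    forall c d, t - 1 <= c -> c <= d -> d <= t -> enorm (y d - y c) <= C * (d - c)].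
Proof.
move=> cF FC; have C0 : 0 <= C by apply: le_trans (FC t x0); exact: enorm_ge0.
have cFc (f : R -> vec) (h : R -> R) : continuous f -> continuous h ->
    continuous (fun s => F s (f (h s))).
  move=> cf ch s.
  have h1 : (fun s => (s, f (h s))) @ s --> nbhs ((s, f (h s)) : R * vec).
    have h2 := cvg_comp _ _ (ch s) (cf (h s)).
    have h3 : (fun s : R => s) @ nbhs s --> nbhs s by exact: cvg_id.
    exact: (cvg_pair h3 h2).
  exact: (cvg_comp _ _ h1 (@cF (s, f (h s)))).
pose dl n s : R := Num.min (s + n.+1%:R^-1) t.
have cdl n : continuous (dl n).
  move=> s; apply: (@continuous_min _ _ (fun s => s + n.+1%:R^-1) (fun=> t)).
    by apply: cvgD; [exact: cvg_id|exact: cvg_cst].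
  exact: cvg_cst.
pose Phi n y s := x0 - vec_ivint (fun r => F r (y (dl n r))) (Num.min s t) t.
have PhiL n y : continuous y -> forall s s', s <= s' ->
    enorm (Phi n y s' - Phi n y s) <= C * (s' - s).
  move=> cy s s' ss'.
  have m1 : Num.min s t <= Num.min s' t.
    by rewrite le_min ge_min ss' /= ge_min lexx orbT.
  have m2 : Num.min s' t <= t by rewrite ge_min lexx orbT.
  have cw := cFc y (dl n) cy (cdl n).
  have -> : Phi n y s' - Phi n y s =
      vec_ivint (fun r => F r (y (dl n r))) (Num.min s t) (Num.min s' t).
    rewrite /Phi (vec_ivint_split cw m1 m2); set v1 := vec_ivint _ _ _; set v2 := vec_ivint _ _ _.
    by move: v1 v2 => v1 v2; apply/rowP => i; rewrite !mxE; ring.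
  apply: (le_trans (enorm_vec_ivint cw (fun s => FC s _) m1)).
  rewrite ler_wpM2l// /Num.min; case: ifP; case: ifP; lra.
have PhiC n y : continuous y -> continuous (Phi n y).
  move=> cy s; apply/continuous_enormP => e e0.
  have hC : 0 < C + 1 by lra.
  near=> s'; have sd : `|s' - s| < e / (C + 1).
    by rewrite distrC; near: s'; apply: cvgr_dist_lt; rewrite ?divr_gt0.
  have sd2 : C * `|s' - s| < e.
    move: sd; rewrite ltr_pdivlMr// mulrDr mulr1 mulrC; have := normr_ge0 (s' - s); lra.
  have [h|h] := leP s s'.
    by apply: le_lt_trans (PhiL n y cy s s' h) _; rewrite ger0_norm ?subr_ge0// in sd2.
  rewrite enormB; apply: le_lt_trans (PhiL n y cy s' s (ltW h)) _.
  by rewrite ltr0_norm ?subr_lt0// opprB in sd2.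
pose Y n k := iter k (Phi n) (cst x0).
have YC n k : continuous (Y n k).
  elim: k => [|k IH]; first by move=> s; exact: cvg_cst.
  exact: PhiC.
have Yt n k : Y n k t = x0.
  case: k => [//|k]; rewrite /Y iterS /Phi minxx.
  rewrite (_ : vec_ivint _ t t = 0) ?subr0//.
  by apply/rowP => i; rewrite !mxE ivint_xx.
have Yst n k s : t - k%:R / n.+1%:R <= s -> Y n k.+1 s = Y n k s.
  elim: k s => [|k IH] s hs.
    rewrite mul0r subr0 in hs.
    by rewrite /Y /= /Phi min_r// (_ : vec_ivint _ t t = 0) ?subr0//; apply/rowP => i; rewrite !mxE ivint_xx.
  rewrite /Y (iterS k.+1) (iterS k); rewrite /Phi; congr (_ - _).
  apply/rowP => i; rewrite !mxE; apply: eq_ri => r /andP[h1 h2].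
  rewrite -/(Y n k.+1) -/(Y n k); congr (F _ _ _ _); apply: IH.
  rewrite /dl le_min; apply/andP; split; last first.
    by rewrite gerBl divr_ge0.
  have : t - k.+1%:R / n.+1%:R <= r.
    apply: le_trans h1; rewrite le_min hs /= gerBl divr_ge0//.
  by rewrite (mulrSr 1 k) mulrDl mul1r; set v1 := _%:R / _; set v2 := _^-1; lra.
pose y n := Y n n.+1.
have yL n s s' : s <= s' -> enorm (y n s' - y n s) <= C * (s' - s).
  by move=> ss'; exact: (PhiL n (Y n n) (YC n n)).
have yE n c d i : t - 1 <= c -> c <= d -> d <= t ->
    y n d ord0 i - y n c ord0 i = ivint (fun s => F s (y n (dl n s)) ord0 i) c d.
  move=> tc cd dt.
  have fix_ s : t - 1 <= s -> y n s = Phi n (y n) s.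
    by move=> hs; rewrite -[RHS]/(Y n n.+2 s) Yst// divff.
  have cw := cFc (y n) (dl n) (YC n n.+1) (cdl n).
  rewrite (fix_ d) ?(fix_ c)//; last exact: le_trans cd.
  rewrite /Phi !min_l//; last exact: le_trans dt.
  by rewrite (vec_ivint_split cw cd dt) !mxE; ring.
have yt n : y n t = x0 by exact: Yt.
have cy n : continuous (y n) by exact: YC.
clearbody y; clear Phi PhiL PhiC Y YC Yt Yst.
have [M hM] : exists M, forall n s, enorm (y n (clamp (t - 1) t s)) <= M.
  exists (enorm x0 + C) => n s.
  have /andP[h1 h2] : t - 1 <= clamp (t - 1) t s <= t by apply: clamp_in; lra.
  have := yL n _ _ h2; rewrite yt => h3.
  have h4 := enorm_dist (y n (clamp (t - 1) t s)) x0 0; rewrite !subr0 enormB in h4.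
  have : C * (t - clamp (t - 1) t s) <= C by rewrite -[leRHS]mulr1 ler_wpM2l//; lra.
  lra.
have ycl n s : t - 1 <= s -> s <= t -> y n (clamp (t - 1) t s) = y n s.
  by move=> h1 h2; rewrite clamp_id// h1 h2.
have [e e0|z [phi hphi]] := @ascoli_subsequence R N (fun n s => y n (clamp (t - 1) t s)) (t - 1) t M hM.
  exists (e / (C + 1)); first by rewrite divr_gt0//; lra.
  move=> n s s' ts ss' s't; rewrite !ycl//; [|lra|lra].
  rewrite ltr_pdivlMr; last lra.
  have := yL n _ _ ss'; have -> : (s' - s) * (C + 1) = C * (s' - s) + (s' - s) by ring.
  lra.
have zc k s : t - 1 <= s -> s <= t -> enorm (y (phi k) s - z s) <= k.+1%:R^-1.
  by move=> h1 h2; have [_] := hphi k; move=> /(_ s); rewrite ycl// h1 h2; apply.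
have small (e : R) : 0 < e -> exists k0 : nat, forall k, (k0 <= k)%N -> (k.+1%:R : R)^-1 < e.
  move=> e0; exists (Num.bound e^-1) => k hk.
  rewrite invf_plt ?posrE//.
  apply: lt_le_trans (archi_boundP _) _; first by rewrite invr_ge0 ltW.
  by rewrite ler_nat ltnW// ltnS.
have zL c d : t - 1 <= c -> c <= d -> d <= t -> enorm (z d - z c) <= C * (d - c).
  move=> tc cd dt; apply: ler_eps => e e0.
  have [k0 hk] := small (e / 2) ltac:(lra).
  have h1 := hk k0 (leqnn _).
  have h2 : enorm (y (phi k0) c - z c) <= e / 2.
    exact: le_trans (zc k0 c tc (le_trans cd dt)) (ltW h1).
  have h3 : enorm (y (phi k0) d - z d) <= e / 2.
    exact: le_trans (zc k0 d (le_trans tc cd) dt) (ltW h1).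
  clear h1 hk; have h4 := yL (phi k0) c d cd.
  have h5 := enorm_dist (z d) (y (phi k0) d) (z c).
  have h6 := enorm_dist (y (phi k0) d) (y (phi k0) c) (z c).
  rewrite (enormB (z d) (y (phi k0) d)) in h5.
  lra.
have zt : z t = x0.
  apply/eqP; rewrite -subr_eq0; apply/eqP.
  have : enorm (z t - x0) <= 0.
    apply: ler_eps => e e0; rewrite add0r.
    have [k0 hk] := small e e0; have h1 := hk k0 (leqnn _).
    have := zc k0 t ltac:(lra) (lexx t); rewrite yt enormB => h2.
    exact: le_trans h2 (ltW h1).
  move=> h0; apply/rowP => i; rewrite [RHS]mxE; apply/eqP; rewrite -normr_le0.
  by apply: le_trans h0; exact: coord_le_enorm.
pose zz s := z (clamp (t - 1) t s).
have zzE s : t - 1 <= s -> s <= t -> zz s = z s.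
  by move=> h1 h2; rewrite /zz clamp_id// h1 h2.
have czz : continuous zz.
  apply: continuous_clamp; first lra.
  apply: (abs_cont_on_modulus (locint_cst C)) => c d tc cd dt.
  by rewrite ivint_cst//; exact: zL.
have cFz := cFc zz id czz (fun s => cvg_id).
exists zz; split; last 2 first.
- by rewrite zzE// ; lra.
- move=> c d tc cd dt; rewrite !zzE//; [exact: zL|lra|lra].
split => //; first exact: locint_coord.
move=> c d i tc cd dt; rewrite !zzE; [|lra|lra|lra|lra].
apply/eqP; rewrite -subr_eq0 -normr_le0; apply: ler_eps => e e0; rewrite add0r.
have cG : continuous (fun w : R * vec => F w.1 w.2 ord0 i).
  move=> w; exact: (cvg_comp _ _ (@cF w) (@coord_continuous R 1 N ord0 i (F w.1 w.2))).
have e30 : 0 < e / 3 by lra.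
have [r r0 hr] := @uniform_near_graph R N (fun s v => F s v ord0 i) zz (t - 1) t (e / 3) cG czz e30.
(* The delay displaces the argument by at most [C * (r / (C + 2))] and the limit by another
   [r / (C + 2)]; together this is less than [r]. *)
have [k0 hk0] := small (r / (C + 2)) ltac:(by rewrite divr_gt0//; lra).
have [k1 hk1] := small (e / 3) e30.
pose k := maxn k0 k1.
have a0 := hk0 k (leq_maxl _ _); have a1 := hk1 k (leq_maxr _ _).
have [kphi _] := hphi k.
have a2 : (phi k).+1%:R^-1 <= k.+1%:R^-1 :> R by rewrite lef_pV2 ?posrE// ler_nat.
have cw := cFc (y (phi k)) (dl (phi k)) (cy _) (cdl _).
have b1 := yE (phi k) c d i tc cd dt.
have b2 : `|ivint (fun s => F s (y (phi k) (dl (phi k) s)) ord0 i) c d -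
    ivint (fun s => F s (zz s) ord0 i) c d| <= e / 3 * (d - c).
  rewrite -ivintB; [|exact: (locint_coord cw)|exact: (locint_coord cFz)].
  apply: ivint_norm_cst => //; first by apply: locintB; [exact: (locint_coord cw)|exact: (locint_coord cFz)].
  move=> s /andP[cs sd]; apply/ltW/hr; first by apply/andP; split; lra.
  rewrite zzE; [|lra|lra].
  have /andP[d1 d2] : s <= dl (phi k) s <= s + (phi k).+1%:R^-1.
    by rewrite /dl le_min ge_min lexx (le_trans sd dt) lerDl invr_ge0 ler0n.
  have d3 : dl (phi k) s <= t by rewrite /dl ge_min lexx orbT.
  have h1 := yL (phi k) _ _ d1.
  have h2 := zc k s ltac:(lra) ltac:(lra).
  have h3 := enorm_dist (y (phi k) (dl (phi k) s)) (y (phi k) s) (z s).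
  have h4 : dl (phi k) s - s <= r / (C + 2).
    by rewrite lerBlDl; apply: le_trans d2 _; rewrite lerD2l; exact: le_trans a2 (ltW a0).
  have {}h2 : enorm (y (phi k) s - z s) <= r / (C + 2) by exact: le_trans h2 (ltW a0).
  have h5 : C * (dl (phi k) s - s) <= C * (r / (C + 2)) by rewrite ler_wpM2l.
  have h6 : (C + 2) * (r / (C + 2)) = r by rewrite mulrC divfK// gt_eqF//; lra.
  have h7 : 0 < r / (C + 2) by rewrite divr_gt0//; lra.
  clear a0 a1 a2 d1 d2 d3 h4; move: h1 h2 h3 h5 h6 h7; set q := r / _; lra.
have b3 : e / 3 * (d - c) <= e / 3.
  by rewrite -[leRHS]mulr1 ler_wpM2l; lra.
have c1 : `|z d ord0 i - y (phi k) d ord0 i| <= e / 3.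
  have := coord_le_enorm (z d - y (phi k) d) i; rewrite !mxE enormB => /le_trans; apply.
  exact: le_trans (zc k d ltac:(lra) dt) (ltW a1).
have c2 : `|z c ord0 i - y (phi k) c ord0 i| <= e / 3.
  have := coord_le_enorm (z c - y (phi k) c) i; rewrite !mxE enormB => /le_trans; apply.
  exact: le_trans (zc k c tc ltac:(lra)) (ltW a1).
move: b2 c1 c2; rewrite -b1 !ler_norml => /andP[? ?] /andP[? ?] /andP[? ?].
by apply/andP; split; lra.
Unshelve. all: by end_near. Qed.

End Peano.

(** * Continuous selection of almost optimal velocities *)

Section ProximalSelection.
Context {R : realType} {N : nat}.
Notation vec := 'rV[R]_N.
Variables (T : R) (H : R -> vec -> vec -> R) (c : R -> R).
Hypothesis rH : regular_hamiltonian T H c.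
Variables (q : vec) (ka : R).
Hypothesis ka0 : 0 < ka.
Implicit Types (z : R * vec) (p : vec) (C e r : R).

(** The objective of the Moreau envelope of [H z.1 z.2] at [q]; its minimizer is the proximal
    point. *)
Let phi z p : R := H z.1 z.2 p + ka * enorm (p - q) ^+ 2.

(** At a distance above [C / ka] from [q] the quadratic term outweighs any gain of the [C]-Lipschitz
    function [H], so a minimizer over the compact ball is global. *)
Lemma prox_exists z : exists P, forall p, phi z P <= phi z p.
Proof.
have [C C0 hC] := rh_lip rH (enorm_ge0 z.2).
pose B := [set p : vec | enorm (p - q) <= C / ka].
have Bq : B q by rewrite /B /= subrr enorm0 divr_ge0// ltW.
have cphi : continuous (phi z).
  move=> p; apply: (@cvgD _ _ _ (nbhs p)).
    have c1 : (fun p : vec => p) @ nbhs p --> p by exact: cvg_id.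
    have c3 : (fun _ : vec => z.1) @ nbhs p --> z.1 by exact: cvg_cst.
    have c4 : (fun _ : vec => z.2) @ nbhs p --> z.2 by exact: cvg_cst.
    exact: (@cvg_H _ _ H (rh_cont rH) _ (nbhs p) _ _ _ _ _ _ _ c3 c4 c1).
  apply: (@cvgM _ _ (nbhs p)); first exact: cvg_cst.
  apply: (@cvgM _ _ (nbhs p)); apply: (@cvg_enorm _ _ _ (nbhs p));
    by apply: (@cvgB _ _ _ (nbhs p)); [exact: cvg_id|exact: cvg_cst].
have [P _ hP] := @EVT_min_rV R N (phi z) B (ex_intro _ q Bq) (@compact_enorm_ball R N q _)
  (continuous_subspaceT cphi).
exists P => p; have [pB|pB] := leP (enorm (p - q)) (C / ka).
  by apply: hP; rewrite inE.
apply: (@le_trans _ _ (phi z q)); first by apply: hP; rewrite inE.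
rewrite /phi subrr enorm0 expr0n mulr0 addr0.
have := hC z.1 z.2 q p (lexx _); rewrite enormB => /(le_trans (ler_norm _)) h1.
have h2 : C * enorm (p - q) <= ka * enorm (p - q) ^+ 2.
  rewrite expr2 mulrA ler_wpM2r ?enorm_ge0//.
  by move: pB; rewrite ltr_pdivrMr// mulrC => /ltW.
lra.
Qed.

Lemma prox_uniform_bound r C : 0 <= C ->
  (forall t x p p', enorm x <= r -> `|H t x p - H t x p'| <= C * enorm (p - p')) ->
  forall z P, enorm z.2 <= r -> (forall p, phi z P <= phi z p) ->
  enorm (P - q) <= C / ka /\ H z.1 z.2 q - C * (C / ka) <= H z.1 z.2 P.
Proof.
move=> C0 hC z P zr hP.
have h0 := hP q; rewrite /phi subrr enorm0 expr0n mulr0 addr0 in h0.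
have := hC z.1 z.2 q P zr; rewrite enormB => /(le_trans (ler_norm _)) h1.
have h2 : enorm (P - q) <= C / ka.
  rewrite ler_pdivlMr//; have [e0|e0] := eqVneq (enorm (P - q)) 0; first by rewrite e0 mul0r.
  have ep : 0 < enorm (P - q) by rewrite lt_def e0 enorm_ge0.
  rewrite -(ler_pM2r ep); lra.
split => //; have h3 : C * enorm (P - q) <= C * (C / ka) by rewrite ler_wpM2l.
lra.
Qed.

(** Compare [P] with the midpoint of [p] and [P]: convexity of [H] and the parallelogram identity
    gain [ka / 4] times the squared distance. *)
Lemma prox_strong z P : (forall p, phi z P <= phi z p) -> forall p,
  ka / 2 * enorm (p - P) ^+ 2 <= phi z p - phi z P.
Proof.
move=> hP p; have := hP (2^-1 *: p + (1 - 2^-1) *: P).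
have l01 : 0 <= (2^-1 : R) <= 1 by apply/andP; split; lra.
have := rh_convex rH z.1 z.2 p P l01; rewrite /phi => h1 h2.
have mid : enorm (2^-1 *: p + (1 - 2^-1) *: P - q) ^+ 2 =
    (enorm (p - q) ^+ 2 + enorm (P - q) ^+ 2) / 2 - enorm (p - P) ^+ 2 / 4.
  rewrite !enorm_sqr !(dotvBl, dotvBr, dotvDl, dotvDr, dotvZl, dotvZr).
  rewrite (dotvC P p) (dotvC q p) (dotvC q P); lra.
rewrite mid in h2; move: h1 h2.
set u1 := H _ _ (_ + _); set u2 := H _ _ P; set u3 := H _ _ p.
set v1 := enorm (P - q); set v2 := enorm (p - q); set v3 := enorm (p - P).
by clearbody u1 u2 u3 v1 v2 v3; lra.
Qed.

(** The first-order condition says that [(2 * ka) *: (q - P)] is a subgradient of [H] at [P], which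
    is equality in Fenchel's inequality. It is obtained by comparing [P] with
    [l *: p + (1 - l) *: P] for small [l], where the quadratic error is of order [l ^+ 2]. *)
Lemma prox_subgradient z P : (forall p, phi z P <= phi z p) ->
  Hstar H z.1 z.2 ((2 * ka) *: (q - P)) =
  (dotv ((2 * ka) *: (q - P)) P - H z.1 z.2 P)%:E.
Proof.
move=> hP; apply/eqP; rewrite eq_le Hstar_ge andbT.
apply: ge_ereal_sup => _ [p _ <-]; rewrite lee_fin.
have key (l : R) : 0 < l -> l <= 1 ->
    dotv ((2 * ka) *: (q - P)) (p - P) <= H z.1 z.2 p - H z.1 z.2 P + l * (ka * enorm (p - P) ^+ 2).
  move=> l0 l1; have l01 : 0 <= l <= 1 by rewrite ltW.
  have := rh_convex rH z.1 z.2 p P l01; have := hP (l *: p + (1 - l) *: P).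
  rewrite /phi.
  have -> : enorm (l *: p + (1 - l) *: P - q) ^+ 2 =
      enorm (P - q) ^+ 2 - 2 * l * dotv (q - P) (p - P) + l ^+ 2 * enorm (p - P) ^+ 2.
    rewrite !enorm_sqr !(dotvBl, dotvBr, dotvDl, dotvDr, dotvZl, dotvZr).
    rewrite (dotvC P p) (dotvC q p) (dotvC q P); ring.
  rewrite dotvZl => h1 h2; rewrite -(ler_pM2l l0).
  move: h1 h2; set u1 := H _ _ (_ + _); set u2 := H _ _ P; set u3 := H _ _ p.
  set u4 := dotv (q - P) _; set v1 := enorm (P - q); set v3 := enorm (p - P).
  by clearbody u1 u2 u3 u4 v1 v3; lra.
suff : dotv ((2 * ka) *: (q - P)) (p - P) <= H z.1 z.2 p - H z.1 z.2 P.
  by rewrite dotvBr; lra.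
apply: ler_eps => e e0; set m := ka * enorm (p - P) ^+ 2.
have m0 : 0 <= m by rewrite mulr_ge0 ?sqr_ge0 ?ltW.
pose l := Num.min 1 (e / (m + 1)).
have l0 : 0 < l by rewrite lt_min ltr01 divr_gt0//; lra.
have l1 : l <= 1 by rewrite ge_min lexx.
have lm : l * m <= e.
  have : l <= e / (m + 1) by rewrite ge_min lexx orbT.
  by rewrite ler_pdivlMr; lra.
have := key l l0 l1; rewrite -/m; lra.
Qed.

(** Adding the quadratic growth of [phi z] at [P z] and of [phi z0] at [P z0] cancels the penalty
    terms. What remains bounds the squared distance by the variation of [H] between [z] and [z0] at
    two points of one compact ball. *)
Lemma prox_continuous (P : R * vec -> vec) : (forall z p, phi z (P z) <= phi z p) ->
  continuous P.
Proof.
move=> hP z0; apply/continuous_enormP => e e0.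
have r0 : 0 <= enorm z0.2 + 1 by rewrite addr_ge0 ?enorm_ge0.
have [C C0 hC0] := rh_lip rH r0; have hC := prox_uniform_bound C0 hC0.
have cB := @compact_enorm_ball R N q (C / ka).
(* The sum of the two growth estimates is less than [2 * eta], that is, half of [ka * e ^+ 2]. *)
pose eta := ka / 4 * e ^+ 2.
have eta0 : 0 < eta by rewrite mulr_gt0 ?exprn_gt0// divr_gt0.
have unif : \forall z \near z0, forall p, enorm (p - q) <= C / ka ->
    `|H z.1 z.2 p - H z0.1 z0.2 p| < eta.
  have /compact_near_coveringP cBn := cB.
  apply: (cBn _ (nbhs z0) (fun z p => `|H z.1 z.2 p - H z0.1 z0.2 p| < eta)) => p _.
  have e20 : 0 < eta / 2 by rewrite divr_gt0.
  have := @rh_cont _ _ _ _ _ rH (z0.1, z0.2, p).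
  move=> /cvgrPdist_lt/(_ _ e20)[[/= U W] [Uz Wp] hUW].
  have -> : z0 = (z0.1, z0.2) by case: (z0).
  exists (W, U) => //= -[p' z] /= [Wp' Uz'].
  have k1 : `|H z0.1 z0.2 p - H z.1 z.2 p'| < eta / 2.
    by apply: (hUW (z.1, z.2, p')); split => //=; case: (z) Uz'.
  have k2 : `|H z0.1 z0.2 p - H z0.1 z0.2 p'| < eta / 2.
    apply: (hUW (z0.1, z0.2, p')); split => //=.
    exact: nbhs_singleton Uz.
  move: k1 k2; rewrite !ltr_norml => /andP[? ?] /andP[? ?]; apply/andP; split; lra.
have bnd : \forall z \near z0, enorm z.2 <= enorm z0.2 + 1.
  have c2 : (fun z : R * vec => z.2) @ z0 --> z0.2 by exact: cvg_snd.
  apply: (@filterS _ (nbhs z0) _ _ _ _ ((cvg_enormP _ _).1 c2 1 ltr01)) => z h; have := enorm_dist z.2 z0.2 0; rewrite !subr0; lra.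
near=> z.
have zb : enorm z.2 <= enorm z0.2 + 1 by near: z.
have zu : forall p, enorm (p - q) <= C / ka -> `|H z.1 z.2 p - H z0.1 z0.2 p| < eta by near: z.
have [b1 _] := hC z (P z) zb (hP z).
have [b2 _] := hC z0 (P z0) ltac:(by rewrite lerDl) (hP z0).
have s1 := prox_strong (hP z) (P z0); have s2 := prox_strong (hP z0) (P z).
have u1 := zu _ b1; have u2 := zu _ b2.
rewrite enormB in s1; rewrite /phi in s1 s2.
have lt2 : enorm (P z - P z0) ^+ 2 < e ^+ 2.
  rewrite -(ltr_pM2l ka0).
  move: u1 u2 s1 s2; rewrite !ltr_norml => /andP[? ?] /andP[? ?].
  have etaE : eta = ka / 4 * e ^+ 2 by []; clearbody eta; lra.
by move: lt2; rewrite ltr_pXn2r// nnegrE ?enorm_ge0// ltW.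
Unshelve. all: by end_near. Qed.

End ProximalSelection.

Section Selection.
Context {R : realType} {N : nat}.
Notation vec := 'rV[R]_N.

(* [f] is the gradient of the Moreau envelope of [H s x] at [q]: unlike a subgradient
   of [H s x] at [q] itself it depends continuously on [(s, x)]. *)
Lemma approximate_velocity_selection (T : R) (H : R -> vec -> vec -> R) (c : R -> R) :
  regular_hamiltonian T H c -> forall (t0 : R) (x0 q : vec) (e : R), 0 < e ->
  exists (f : R -> vec -> vec) (l : R -> vec -> R) (C : R),
    [/\ continuous (fun z : R * vec => f z.1 z.2),
        continuous (fun z : R * vec => l z.1 z.2),
        (forall s x, Hstar H s x (f s x) = (l s x)%:E),
        (forall s x, enorm (x - x0) <= 1 -> enorm (f s x) <= C) &
        H t0 x0 q - e <= dotv (f t0 x0) q - l t0 x0].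
Proof.
move=> rH t0 x0 q e e0.
have r0 : 0 <= enorm x0 + 1 by rewrite addr_ge0 ?enorm_ge0.
have [C0 C00 hC0] := rh_lip rH r0.
(* Moving from [q] to the proximal point lowers [H] by at most [C0 * (C0 / ka)], which this choice
   makes at most [e]; the added 1 keeps [ka] positive. *)
pose ka := (C0 * C0 + 1) / e.
have ka0 : 0 < ka.
  by rewrite divr_gt0// ltr_wpDl// mulr_ge0.
have [P hP] := choice (prox_exists rH q ka0).
have cP := prox_continuous rH ka0 hP.
have hC' := @prox_uniform_bound _ _ _ q _ ka0 _ _ C00 hC0.
have cP2 : continuous (fun z : R * vec => P (z.1, z.2)).
  by have -> : (fun z : R * vec => P (z.1, z.2)) = P by apply/funext => -[].
have c1 : continuous (fun z : R * vec => (2 * ka) *: (q - P (z.1, z.2))).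
  by move=> z; apply: cvgZr; apply: cvgB; [exact: cvg_cst|exact: cP2].
exists (fun s x => (2 * ka) *: (q - P (s, x))),
  (fun s x => dotv ((2 * ka) *: (q - P (s, x))) (P (s, x)) - H s x (P (s, x))),
  (2 * C0); split.
- exact: c1.
- move=> z; apply: (@cvgB _ _ _ (nbhs z)).
    by apply: (@cvg_dotv _ _ _ (nbhs z)); [exact: c1|exact: cP2].
  by apply: (@cvg_H _ _ H (rh_cont rH) _ (nbhs z)); [exact: cvg_fst|exact: cvg_snd|exact: cP2].
- by move=> s x; exact: (prox_subgradient rH ka0 (hP (s, x))).
- move=> s x xx0; have xr : enorm x <= enorm x0 + 1.
    by have := enorm_dist x x0 0; rewrite !subr0; lra.
  have [b1 _] := hC' (s, x) _ xr (hP (s, x)).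
  have ka20 : 0 < 2 * ka by rewrite mulr_gt0.
  rewrite enormZ enormB (gtr0_norm ka20).
  by rewrite -mulrA ler_wpM2l// mulrC -ler_pdivlMr.
- have x0r : enorm (t0, x0).2 <= enorm x0 + 1 by rewrite /= lerDl.
  have [b1 b2] := hC' (t0, x0) _ x0r (hP (t0, x0)).
  have small : C0 * (C0 / ka) <= e.
    have ek : e * ka = C0 * C0 + 1 by rewrite /ka mulrC divfK// gt_eqF.
    by rewrite mulrA ler_pdivrMr// ek lerDl.
  (* Since [f] is a positive multiple of [q - P], replacing [P] by [q] in the Fenchel equality can
     only increase the pairing. *)
  have sq : 0 <= dotv ((2 * ka) *: (q - P (t0, x0))) (q - P (t0, x0)).
    by rewrite dotvZl mulr_ge0 ?dotv_ge0// mulr_ge0// ltW.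
  rewrite dotvBr in sq; rewrite /= in b2; lra.
Qed.

End Selection.

(** * Additivity of running costs and the integrated Fenchel inequality *)

Section Running.
Context {R : realType} {N : nat}.
Notation vec := 'rV[R]_N.
Notation mu := (@lebesgue_measure R).
Implicit Types (a b r s t K : R) (x u : R -> vec).
Variable H : R -> vec -> vec -> R.
Hypothesis cH : continuous (fun z : R * vec * vec => H z.1.1 z.1.2 z.2).

Lemma ge0_integral_itv_split (f : R -> \bar R) a t b : a <= t -> t <= b ->
  measurable_fun setT f -> (forall s, a <= s <= b -> (0 <= f s)%E) ->
  (\int[mu]_(s in `[a, b]) f s =
   \int[mu]_(s in `[a, t]) f s + \int[mu]_(s in `[t, b]) f s)%E.
Proof.
move=> at_ tb mf f0.
have -> : `[a, b]%classic = `[a, t]%classic `|` `]t, b]%classic.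
  by rewrite -itv_bndbnd_setU// bnd_simp.
rewrite ge0_integral_setU//; last 3 first.
- exact: measurable_funTS.
- move=> s [|]; rewrite /= in_itv/= => /andP[h1 h2]; apply: f0; apply/andP; split; lra.
- apply/disj_setPS => s [/=]; rewrite !in_itv/= => /andP[_ st] /andP[ts _]; lra.
congr (_ + _)%E; rewrite integral_itv_obnd_cbnd//; exact: measurable_funTS.
Qed.

Lemma Hstar_curve_bound a b x u : continuous x ->
  exists2 K, 0 <= K & forall s, a <= s <= b -> ((- K)%:E <= Hstar H s (x s) (u s))%E.
Proof.
move=> cx; have [ab|ba] := leP a b; last first.
  by exists 0 => // s /andP[h1 h2]; exfalso; lra.
have cc : {within `[a, b], continuous (fun s => H s (x s) 0)}.
  by apply: continuous_subspaceT; exact: continuous_H_curve.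
have [m _ hm] := EVT_max ab cc.
exists `|H m (x m) 0| => // s sab; apply: le_trans (Hstar_ge H s (x s) 0 (u s)).
rewrite dotv0r sub0r lee_fin lerN2; apply: le_trans (ler_norm _).
by apply: hm; rewrite in_itv.
Qed.

Lemma running_split a t b x u : a <= t -> t <= b -> traj a b x u ->
  running H a b x u = (running H a t x u + running H t b x u)%E.
Proof.
move=> at_ tb xu; have [cx _ _] := xu.
have [K K0 hK] := Hstar_curve_bound a b u cx.
have mL := measurable_running cH xu.
have hK1 s : a <= s <= t -> ((- K)%:E <= Hstar H s (x s) (u s))%E.
  by move=> /andP[h1 h2]; apply: hK; rewrite h1 (le_trans h2 tb).
have hK2 s : t <= s <= b -> ((- K)%:E <= Hstar H s (x s) (u s))%E.
  by move=> /andP[h1 h2]; apply: hK; rewrite h2 (le_trans at_ h1).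
rewrite /running (integral_shift (le_trans at_ tb) K0 mL hK).
rewrite (integral_shift at_ K0 mL hK1) (integral_shift tb K0 mL hK2).
rewrite (ge0_integral_itv_split at_ tb); last 2 first.
- by apply: emeasurable_funD => //; exact: measurable_cst.
- by move=> s /hK h; rewrite -leeBlDr// sub0e.
have -> : K * (b - a) = K * (t - a) + K * (b - t) by ring.
by rewrite EFinD oppeD// addeACA.
Qed.

Lemma running_gtNy a b x u : a <= b -> traj a b x u -> running H a b x u != -oo%E.
Proof.
move=> ab xu; have [cx _ _] := xu; have [K K0 hK] := Hstar_curve_bound a b u cx.
rewrite /running (integral_shift ab K0 (measurable_running cH xu) hK).
have : (0 <= \int[mu]_(s in `[a, b]) (Hstar H s (x s) (u s) + K%:E))%E.
  by apply: integral_ge0 => s; rewrite /= in_itv/= => /hK h; rewrite -leeBlDr// sub0e.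
by set I := integral _ _ _; case: I.
Qed.

Lemma running_shift_fenchel a b x u K p : a <= b -> traj a b x u ->
  (forall s, a <= s <= b -> ((- K)%:E <= Hstar H s (x s) (u s))%E) ->
  ((dotv p (x b - x a) - ivint (fun s => H s (x s) p) a b + K * (b - a))%:E <=
   \int[mu]_(s in `[a, b]) (Hstar H s (x s) (u s) + K%:E))%E.
Proof.
move=> ab xu hK; have [cx hu _] := xu.
have lH : locint (fun s => H s (x s) p) by apply: locint_continuous; exact: continuous_H_curve.
have lu : locint (fun s => dotv p (u s)) by exact: locint_dotv.
pose w s := dotv p (u s) - H s (x s) p + K.
have lw : locint w by apply: locintD; [exact: locintB|exact: locint_cst].
(* The positive part of [w]: the shifted Lagrangian is nonnegative and hence dominates it, and
   nonnegative integrands can be compared without integrability of the Lagrangian. *)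
pose m s := 2^-1 * (w s + `|w s|).
have lm : locint m by apply: locintZ; apply: locintD => //; exact: locint_norm.
have wm s : w s <= m s /\ 0 <= m s.
  by rewrite /m; have := ler_norm (w s); have := ler_norm (- w s); rewrite normrN; split; lra.
rewrite (traj_dotv p xu)// -ivintB// -ivint_cst// -ivintD//; [|exact: locintB|exact: locint_cst].
apply: (@le_trans _ _ (ivint m a b)%:E).
  by rewrite lee_fin; apply: ivint_le => // s _; have [] := wm s.
rewrite -ivint_EFin//; apply: ge0_le_integral => //.
- by move=> s _; rewrite lee_fin; have [] := wm s.
- by apply: measurable_int (lm a b).
- apply: measurable_funTS; apply: emeasurable_funD; last exact: measurable_cst.
  exact: measurable_running cH xu.
move=> s; rewrite /= in_itv/= => /hK h.
have L0 : (0 <= Hstar H s (x s) (u s) + K%:E)%E by rewrite -leeBlDr// sub0e.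
have Lw : ((w s)%:E <= Hstar H s (x s) (u s) + K%:E)%E.
  by rewrite /w EFinD leeD2r// dotvC Hstar_ge.
rewrite /m; have [h0|h0] := leP 0 (w s).
  by rewrite (ger0_norm h0) (_ : 2^-1 * _ = w s)//; lra.
by rewrite (ltr0_norm h0) subrr mulr0.
Qed.

Lemma running_fenchel a b x u p : a <= b -> traj a b x u ->
  ((dotv p (x b - x a) - ivint (fun s => H s (x s) p) a b)%:E <= running H a b x u)%E.
Proof.
move=> ab xu; have [cx _ _] := xu; have [K K0 hK] := Hstar_curve_bound a b u cx.
rewrite /running (integral_shift ab K0 (measurable_running cH xu) hK) leeBrDr// -EFinD.
exact: running_shift_fenchel.
Qed.

Lemma running_eq a b x u x' u' : {ae mu, forall s, a <= s <= b -> x s = x' s /\ u s = u' s} ->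
  running H a b x u = running H a b x' u'.
Proof.
move=> h; apply: ae_eq_integral_nonmeasurable; apply: ae_imp h => s h.
by rewrite /= in_itv/= => /h[-> ->].
Qed.

Lemma running_glue a t b x1 u1 x2 u2 : a <= t -> t <= b ->
  traj a t x1 u1 -> traj t b x2 u2 -> x1 t = x2 t ->
  running H a b (fun s => if s < t then x1 s else x2 s) (fun s => if s < t then u1 s else u2 s)
  = (running H a t x1 u1 + running H t b x2 u2)%E.
Proof.
move=> at_ tb h1 h2 xt; rewrite (running_split at_ tb (traj_glue h1 h2 xt)).
congr (_ + _)%E; apply: running_eq.
  apply: ae_interior; apply: aeW => s /andP[_ ->] //.
by apply: aeW => s /andP[ts _]; rewrite ltNge ts.
Qed.

End Running.

(** * Viscosity inequalities *)

Section Subderivative.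
Context {R : realType} {N : nat}.
Notation vec := 'rV[R]_N.

Lemma subderiv_le (phi : R -> vec -> \bar R) (t : R) (x : vec) (vt : R) (vx : vec) (B : \bar R) :
  (forall d : R, 0 < d -> exists (h e : R) (y : vec),
    [/\ 0 < h < d, `|e - vt| < d, enorm (y - vx) < d &
     ((phi (t + h * e)%R (x + h *: y)%R - phi t x) * (h^-1)%:E <= B)%E]) ->
  (subderiv phi t x vt vx <= B)%E.
Proof.
move=> hB; apply: ge_ereal_sup => _ [d /= d0 <-].
have [h [e [y [h1 h2 h3 h4]]]] := hB d d0.
apply: le_trans h4; apply: ereal_inf_lbound.
by exists (h, e, y).
Qed.

Lemma bounded_cluster (y : nat -> vec) (C : R) : (forall n, enorm (y n) <= C) ->
  exists v, forall e : R, 0 < e -> forall n0, exists2 n, (n0 <= n)%N & enorm (y n - v) < e.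
Proof.
move=> yC; have cB := @compact_enorm_ball R N 0 C.
have [|v [_ hv]] := cB (y @ \oo) _.
  by exists 0%N => // n _ /=; rewrite subr0.
exists v => e e0 n0.
have [||_ [[n /= n0n <-] hn]] := hv (y @` [set n | (n0 <= n)%N]) [set w | enorm (w - v) < e].
- by exists n0 => // n n0n; exists n.
- by apply/nbhs_enormP; exists e.
by exists n.
Qed.

End Subderivative.

Section ViscosityInequalities.
Context {R : realType} {N : nat}.
Notation vec := 'rV[R]_N.
Notation mu := (@lebesgue_measure R).
Variables (T : R) (H : R -> vec -> vec -> R) (c : R -> R) (g : vec -> \bar R).
Hypotheses (T0 : 0 <= T) (rH : regular_hamiltonian T H c).
Hypotheses (pg : proper_ext g) (lg : lower_semicontinuous g).
Local Notation V := (value_function H g T).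

Lemma value_function_gtNy t x : 0 <= t <= T -> V t x != -oo%E.
Proof.
move=> tT; have [m hm] := value_function_bounded_below T0 rH (enorm x) pg lg.
by have := hm t x tT (lexx _); case: (V t x).
Qed.

Lemma supersolution t x pt (px : vec) : 0 <= t -> t < T -> V t x \is a fin_num ->
  subdiff (ext T V) t x pt px -> 0 <= - pt + H t x (- px).
Proof.
move=> t0 tT Vfin hsub; rewrite addrC subr_ge0; set q := - px.
have tT' : 0 <= t <= T by rewrite t0 ltW.
have [v vE] : exists v, V t x = v%:E by exists (fine (V t x)); rewrite fineK.
have [M M0 hM] := trajectory_bound T0 rH (enorm x).
have [C C0 hC] := speed_bound rH M0.
apply: ler_eps => e' e'0; pose e := e' / 3; have e0 : 0 < e by rewrite divr_gt0.
have [r r0 hr] : exists2 r, 0 < r & forall s z, `|s - t| < r -> enorm (z - x) < r ->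
    `|H s z q - H t x q| < e.
  have := @rh_cont _ _ _ _ _ rH (t, x, q).
  move=> /cvgrPdist_lt/(_ _ e0)[[/= U W] [[[U1 U2] /= [Ut Ux] hU] Wq] hUW].
  move: Ut => /nbhs_ballP[r1 /= r10 hr1]; move: Ux => /nbhs_enormP[r2 r20 hr2].
  exists (Num.min r1 r2); first by rewrite lt_min r10.
  move=> s z; rewrite !lt_min => /andP[s1 _] /andP[_ z2].
  rewrite distrC; apply: (hUW (s, z, q)); split => /=; last exact: nbhs_singleton Wq.
  apply: (hU (s, z)); split => /=; last exact: hr2.
  by apply: hr1; rewrite /ball/= distrC.
(* [T - t] keeps [t + h] in the interval, [e] makes [h ^+ 2 <= e * h], and [r / (C + 1)] keeps the
   trajectory where [H] varies by less than [e]. *)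
pose hbar := Num.min (Num.min (T - t) e) (r / (C + 1)).
have hbar0 : 0 < hbar by rewrite !lt_min subr_gt0 tT e0 divr_gt0//; lra.
have step h : 0 < h -> h < hbar -> exists eta : vec, enorm eta <= C /\
   ((ext T V (t + h * 1)%R (x + h *: eta)%R - ext T V t x) * (h^-1)%:E <=
     (dotv px eta + H t x q + 2 * e)%:E)%E.
  move=> h0; rewrite !lt_min => /andP[/andP[hT he] hr'].
  have hC1 : h * (C + 1) < r by move: hr'; rewrite ltr_pdivlMr//; lra.
  (* Optimality up to [h ^+ 2] leaves only the error [h] after division by [h]. *)
  have : (V t x < (v + h ^+ 2)%:E)%E by rewrite vE lte_fin ltrDl exprn_gt0.
  move=> /(value_function_lt tT')[y [u [yu yt lt1]]].
  have runfin : (running H t T y u < +oo)%E.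
    rewrite ltey; apply/eqP => e1; move: lt1; rewrite e1 addey//.
    by case: pg => gN _; exact: gN.
  have yr : enorm (y t) <= enorm x by rewrite yt.
  have [yM _] := hM t y u tT' yu yr runfin.
  have uC := hC t y u (ltW tT) yu runfin yM.
  have yL s : t <= s -> s <= T -> enorm (y s - x) <= C * (s - t).
    by move=> ts sT; rewrite -yt -ivint_cst//; apply: (traj_modulus yu) => //; exact: locint_cst.
  have th : t <= t + h by lra.
  have thT : t + h <= T by lra.
  have thT' : 0 <= t + h <= T by apply/andP; split; lra.
  pose eta := h^-1 *: (y (t + h) - x).
  have etaE : x + h *: eta = y (t + h).
    by rewrite scalerA divff ?gt_eqF// scale1r addrC subrK.
  exists eta; split.
    rewrite enormZ gtr0_norm ?invr_gt0// mulrC ler_pdivrMr//.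
    by have := yL _ th thT; rewrite addrAC subrr add0r.
  rewrite etaE mulr1 /ext t0 (ltW tT) /= (_ : (0 <= t + h) && _ = true)//.
  set I := ivint (fun s => H s (y s) q) t (t + h).
  have Ile : I <= (H t x q + e) * h.
    have lI : locint (fun s => H s (y s) q).
      by apply: locint_continuous; apply: (continuous_H_curve (rh_cont rH)); case: yu.
    apply: (@le_trans _ _ (ivint (cst (H t x q + e)) t (t + h))).
      apply: ivint_le => //; first exact: locint_cst.
      move=> s /andP[ts sh].
      have sT : s <= T by apply: le_trans thT.
      have h1 := yL s ts sT.
      have h2 : C * (s - t) <= C * h by rewrite ler_wpM2l//; lra.
      have : `|H s (y s) q - H t x q| < e.
        by apply: hr; [rewrite ger0_norm ?subr_ge0//; nra|lra].
      by rewrite ltr_norml /=; lra.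
    by rewrite ivint_cst// (_ : t + h - t = h)//; ring.
  have lt2 : (V (t + h)%R (y (t + h)%R) + (dotv q (y (t + h) - y t) - I)%:E < (v + h ^+ 2)%:E)%E.
    apply: le_lt_trans lt1.
    rewrite (running_split (rh_cont rH) th thT yu) addeCA [leLHS]addeC.
    apply: leeD.
      apply: (running_fenchel (rh_cont rH)) => //.
      exact: traj_sub yu (lexx _) thT.
    by apply: value_function_le => //; exact: traj_sub yu th (lexx _).
  have := value_function_gtNy (y (t + h)) thT'.
  move: lt2; rewrite vE; case: (V (t + h)%R (y (t + h)%R)) => [w||//]; last first.
    by rewrite addye// ltNge leey.
  rewrite -EFinD lte_fin => lt2 _; rewrite -EFinB -EFinM lee_fin ler_pdivrMr//.
  have dq : dotv q (y (t + h) - y t) = - (h * dotv px eta).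
    by rewrite yt -etaE addrAC subrr add0r dotvZr /q dotvNl mulrN.
  rewrite dq in lt2.
  move: Ile lt2 he; set A := H t x q; set B := dotv px eta; clearbody A B I => *.
  have : h ^+ 2 <= e * h by rewrite expr2 ler_wpM2r// ltW.
  nra.
pose hn n := hbar / n.+2%:R.
have hn0 n : 0 < hn n by rewrite divr_gt0.
have hnlt n : hn n < hbar by rewrite ltr_pdivrMr// ltr_pMr// ltr1n.
have [eta heta] := choice (fun n => step (hn n) (hn0 n) (hnlt n)).
have [vv hvv] := bounded_cluster (fun n => (heta n).1).
(* One [e] pays for the variation of [H], one for the near-optimality, and one for replacing the
   mean velocities by their cluster point. *)
suff : (subderiv (ext T V) t x 1 vv <= (dotv px vv + H t x q + 3 * e)%:E)%E.
  move=> h1; have := le_trans (hsub 1 vv) h1; rewrite lee_fin mul1r (dotvC vv px) /e.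
  by set A := H t x q; clearbody A; lra.
apply: subderiv_le => d d0.
pose d' := Num.min d (e / (enorm px + 1)).
have px1 : 0 < enorm px + 1 by have := enorm_ge0 px; lra.
have d'0 : 0 < d' by rewrite lt_min d0 divr_gt0.
have [n hn' hlt] := hvv d' d'0 (Num.bound (hbar / d)).
exists (hn n), 1, (eta n); split.
- rewrite hn0 /= /hn ltr_pdivrMr// mulrC -ltr_pdivrMr//.
  apply: lt_le_trans (archi_boundP _) _; first by rewrite divr_ge0// ltW.
  by rewrite ler_nat (leq_trans hn')// ltnW// ltnW.
- by rewrite subrr normr0.
- by apply: lt_le_trans hlt _; rewrite ge_min lexx.
apply: le_trans (heta n).2 _; rewrite lee_fin.
have h1 : dotv px (eta n) - dotv px vv <= e.
  rewrite -dotvBr; apply: le_trans (dotv_le_enorm _ _) _.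
  have h2 : enorm (eta n - vv) <= e / (enorm px + 1).
    by apply/ltW; apply: lt_le_trans hlt _; rewrite ge_min lexx orbT.
  apply: (@le_trans _ _ ((enorm px + 1) * (e / (enorm px + 1)))).
    by apply: ler_pM => //; rewrite ?enorm_ge0// lerDl.
  by rewrite mulrC divfK// gt_eqF.
by move: h1; set A := H t x q; clearbody A; lra.
Qed.

End ViscosityInequalities.

(** * The subsolution inequality *)

Section Subsolution.
Context {R : realType} {N : nat}.
Notation vec := 'rV[R]_N.
Notation mu := (@lebesgue_measure R).

(** The radial retraction onto the closed unit ball around [x]. The selected velocity is bounded on
    that ball, and precomposing with the retraction gives the global bound that [peano] requires. *)
Definition ball_retract (x z : vec) : vec := x + (Num.max 1 (enorm (z - x)))^-1 *: (z - x).

Lemma ball_retract_id x z : enorm (z - x) <= 1 -> ball_retract x z = z.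
Proof. by move=> h; rewrite /ball_retract max_l// invr1 scale1r addrC subrK. Qed.

Lemma ball_retract_in x z : enorm (ball_retract x z - x) <= 1.
Proof.
rewrite /ball_retract addrAC subrr add0r enormZ.
have m1 : 1 <= Num.max 1 (enorm (z - x)) by rewrite le_max lexx.
have m0 : 0 < Num.max 1 (enorm (z - x)) by apply: lt_le_trans m1.
rewrite gtr0_norm ?invr_gt0// mulrC ler_pdivrMr// mul1r.
by rewrite le_max lexx orbT.
Qed.

Lemma continuous_ball_retract x : continuous (ball_retract x).
Proof.
move=> z; apply: (@cvgD _ _ _ (nbhs z)); first exact: cvg_cst.
have c1 : (fun z : vec => z - x) @ nbhs z --> z - x.
  by apply: (@cvgB _ _ _ (nbhs z)); [exact: cvg_id|exact: cvg_cst].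
apply: (@cvgZ _ _ _ (nbhs z)) => //.
apply: (@cvgV _ _ (nbhs z)).
  by rewrite gt_eqF// (lt_le_trans ltr01)// le_max lexx.
have c2 : (fun z : vec => enorm (z - x)) @ nbhs z --> enorm (z - x) by exact: cvg_enorm.
apply: (@continuous_max R vec (fun=> 1) (fun w => enorm (w - x)) z); last exact: c2.
exact: cst_continuous.
Qed.

Variables (T : R) (H : R -> vec -> vec -> R) (c : R -> R) (g : vec -> \bar R).
Hypotheses (T0 : 0 <= T) (rH : regular_hamiltonian T H c).
Hypotheses (pg : proper_ext g) (lg : lower_semicontinuous g).
Local Notation V := (value_function H g T).

(** Any curve arriving at [x] at time [t] may be continued by a trajectory that is optimal up to
    [e]. *)
Lemma dynamic_programming_le (t h : R) (x : vec) y u : 0 <= h -> h <= t -> t <= T ->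
  V t x \is a fin_num -> traj (t - h) t y u -> y t = x ->
  (V (t - h)%R (y (t - h)%R) <= running H (t - h) t y u + V t x)%E.
Proof.
move=> h0 ht tT Vfin yu yt.
have tT' : 0 <= t <= T by rewrite (le_trans h0 ht).
have th : t - h <= t by lra.
have run_gtNy : running H (t - h) t y u != -oo%E by exact: (running_gtNy (rh_cont rH)).
apply/lee_addgt0Pr => e e0.
have : (V t x < V t x + e%:E)%E by rewrite lteDl.
move=> /(value_function_lt tT')[y2 [u2 [yu2 yt2 lt2]]].
have ee : y t = y2 t by rewrite yt yt2.
have zu := traj_glue yu yu2 ee.
have thT : 0 <= t - h <= T by apply/andP; split; lra.
have := value_function_le H g thT zu; rewrite running_glue//; last exact: rh_cont rH.
rewrite (ltNge T t) tT /=.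
have -> : (if t - h < t then y (t - h) else y2 (t - h)) = y (t - h).
  case: ltP => // h1; rewrite -(_ : t = t - h) ?ee//; lra.
move=> h1; apply: le_trans h1 _; rewrite addeCA -[leRHS]addeA.
apply: leeD2l; exact: ltW.
Qed.

Lemma subsolution t x pt (px : vec) : 0 < t -> t <= T -> V t x \is a fin_num ->
  subdiff (ext T V) t x pt px -> - pt + H t x (- px) <= 0.
Proof.
move=> t0 tT Vfin hsub; rewrite addrC subr_le0; set q := - px.
have [v vE] : exists v, V t x = v%:E by exists (fine (V t x)); rewrite fineK.
apply: ler_eps => e' e'0; pose e := e' / 3; have e0 : 0 < e by rewrite divr_gt0.
have [f [l [C [cf cl fl fC hfl]]]] := approximate_velocity_selection rH t x q e0.
pose F s z := f s (ball_retract x z).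
have cF : continuous (fun z : R * vec => F z.1 z.2).
  move=> z.
  have h1 : (fun z : R * vec => ball_retract x z.2) @ nbhs z --> nbhs (ball_retract x z.2).
    by apply: (cvg_comp _ _ (@cvg_snd _ _ _ _ _)); exact: continuous_ball_retract.
  have h2 : (fun z : R * vec => z.1) @ nbhs z --> nbhs z.1 by exact: cvg_fst.
  exact: (cvg_comp _ _ (cvg_pair h2 h1) (@cf (z.1, ball_retract x z.2))).
have FC s z : enorm (F s z) <= C by apply: fC; exact: ball_retract_in.
have C0 : 0 <= C by apply: le_trans (FC t x); exact: enorm_ge0.
have [y [yu yt yL]] := peano t x cF FC.
have cy : continuous y by case: yu.
set f0 := f t x.
have cFy : continuous (fun s => F s (y s)).
  move=> s; have h1 : (fun s => (s, y s)) @ nbhs s --> nbhs ((s, y s) : R * vec).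
    exact: (cvg_pair (@cvg_id _ _) (cy s)).
  exact: (cvg_comp _ _ h1 (@cF (s, y s))).
have cly : continuous (fun s => l s (y s)).
  move=> s; have h1 : (fun s => (s, y s)) @ nbhs s --> nbhs ((s, y s) : R * vec).
    exact: (cvg_pair (@cvg_id _ _) (cy s)).
  exact: (cvg_comp _ _ h1 (@cl (s, y s))).
have Ft : F t (y t) = f0 by rewrite /F yt ball_retract_id// subrr enorm0.
suff : (subderiv (ext T V) t x (-1) (- f0) <= (l t x + e)%:E)%E.
  move=> h1; have := le_trans (hsub (-1) (- f0)) h1; rewrite lee_fin mulN1r.
  move: hfl; rewrite -/f0 /q dotvNr dotvNl /e.
  by set A := H t x _; set B := l t x; set D := dotv _ _; clearbody A B D; lra.
apply: subderiv_le => d d0.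
have d20 : 0 < d / 2 by lra.
have n1 : \forall s \near t, enorm (F s (y s) - f0) < d / 2.
  by have := (continuous_enormP _ _).1 (cFy t) _ d20; rewrite Ft.
have e20 : 0 < e / 2 by lra.
have n2 : \forall s \near t, `|l t x - l s (y s)| < e / 2.
  have h1 : (fun s => l s (y s)) @ nbhs t --> l t (y t) by exact: cly.
  move/cvgrPdist_lt: h1 => /(_ _ e20).
  by apply: filterS => s; rewrite yt.
have [r /= r0 hr] := (nbhs_ballP _ _).1 (filterI n1 n2).
(* [t] keeps [t - h] positive, 1 keeps it in the interval of [peano], [r] gives the continuity
   estimates at [t], and [(C + 1)^-1] keeps the curve in the unit ball around [x], where [F]
   coincides with [f]. *)
pose hbar := Num.min (Num.min (Num.min d t) (Num.min 1 (e / 2))) (Num.min r (C + 1)^-1).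
have hbar0 : 0 < hbar by rewrite !lt_min d0 t0 ltr01 e20 r0 invr_gt0/=; lra.
pose h := hbar / 2.
have h0 : 0 < h by rewrite divr_gt0.
have : h < hbar by rewrite /h; lra.
rewrite !lt_min => /andP[/andP[/andP[hd ht] /andP[h1 he]] /andP[hr' hC]].
clearbody h; clear hbar hbar0.
have hC1 : h * (C + 1) < 1 by rewrite -ltr_pdivlMr ?div1r//; lra.
have near_t s : t - h <= s <= t -> enorm (F s (y s) - f0) < d / 2 /\ `|l t x - l s (y s)| < e / 2.
  by move=> /andP[s1 s2]; apply: hr; rewrite /ball/= ger0_norm ?subr_ge0//; lra.
have Ff s : t - h <= s <= t -> F s (y s) = f s (y s).
  move=> /andP[s1 s2]; rewrite /F ball_retract_id// -yt enormB.
  have := yL s t ltac:(lra) s2 (lexx t); have : C * (t - s) <= C * h by rewrite ler_wpM2l//; lra.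
  lra.
have th : t - h <= t by lra.
have yu' : traj (t - h) t y (fun s => F s (y s)) by apply: traj_sub yu _ (lexx _); lra.
have runE : running H (t - h) t y (fun s => F s (y s)) = (ivint (fun s => l s (y s)) (t - h) t)%:E.
  rewrite -ivint_EFin; last exact: locint_continuous.
  by apply: eq_integral => s; rewrite inE /= in_itv/= => hs; rewrite Ff// fl.
have lle : ivint (fun s => l s (y s)) (t - h) t <= (l t x + e / 2) * h.
  apply: (@le_trans _ _ (ivint (cst (l t x + e / 2)) (t - h) t)).
    apply: ivint_le => //; [exact: locint_continuous|exact: locint_cst|].
    by move=> s /near_t[_]; rewrite ltr_norml /=; lra.
  by rewrite ivint_cst// (_ : t - (t - h) = h)//; ring.
have dpp := dynamic_programming_le (ltW h0) (ltW ht) tT Vfin yu' yt.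
rewrite runE vE in dpp.
pose eta := h^-1 *: (y (t - h) - x).
have etaE : x + h *: eta = y (t - h).
  by rewrite scalerA divff ?gt_eqF// scale1r addrC subrK.
exists h, (-1), eta; split.
- by rewrite h0.
- by rewrite subrr normr0.
(* The deviation [D] of the mean velocity from its limit is tested against itself: [h * dotv D D] is
   an integral of [D] against velocities within [d / 2] of [f0]. *)
- rewrite opprK; set D := eta + f0.
  have [D0|D0] := eqVneq (enorm D) 0; first by rewrite D0.
  have Dp : 0 < enorm D by rewrite lt_def D0 enorm_ge0.
  apply: (@le_lt_trans _ _ (d / 2)); last lra.
  have hD : h * dotv D D = ivint (fun s => dotv D f0 - dotv D (F s (y s))) (t - h) t.
    rewrite ivintB; [|exact: locint_cst|by case: yu => _ hu _; exact: locint_dotv].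
    rewrite -(traj_dotv D yu')//.
    rewrite -/(cst (dotv D f0)) ivint_cst// yt.
    have -> : dotv D D = h^-1 * (dotv D (y (t - h)) - dotv D x) + dotv D f0.
      by rewrite -dotvBr -dotvZr -dotvDr.
    rewrite dotvBr.
    have hh : h * h^-1 = 1 by rewrite divff// gt_eqF.
    set u1 := dotv _ (y _); set u2 := dotv _ x; set u3 := dotv _ f0.
    rewrite mulrDr mulrA hh; ring.
  have : h * dotv D D <= enorm D * (d / 2) * h.
    rewrite hD; apply: (@le_trans _ _ (ivint (cst (enorm D * (d / 2))) (t - h) t)).
      apply: ivint_le => //; [|exact: locint_cst|].
        by apply: locintB; [exact: locint_cst|case: yu => _ hu _; exact: locint_dotv].
      move=> s /near_t[h2 _]; rewrite -dotvBr; apply: le_trans (dotv_le_enorm _ _) _.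
      by rewrite ler_wpM2l ?enorm_ge0// enormB ltW.
    by rewrite ivint_cst// (_ : t - (t - h) = h)//; ring.
  by rewrite mulrC ler_pM2r// -enorm_sqr expr2 ler_pM2l.
rewrite etaE mulrN1 /ext (ltW t0) tT /= (_ : (0 <= t - h) && _ = true); last first.
  by apply/andP; split; lra.
have thT : 0 <= t - h <= T by apply/andP; split; lra.
have := value_function_gtNy T0 rH pg lg (y (t - h)) thT.
rewrite vE; move: dpp; case: (V (t - h)%R (y (t - h)%R)) => [w||//].
  rewrite -EFinD lee_fin => dpp _; rewrite -EFinB -EFinM lee_fin ler_pdivrMr//.
  move: dpp lle; set A := l t x; set I := ivint _ _ _; clearbody A I => dpp lle.
  have : e / 2 * h <= e * h by rewrite ler_pM2r//; lra.
  lra.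
by rewrite -EFinD.
Qed.

End Subsolution.

(** * Lower semicontinuity *)

Section CellSuprema.
Context {R : realType}.
Notation mu := (@lebesgue_measure R).

Lemma limn_einf_ge (v : nat -> \bar R) (A : \bar R) (n0 : nat) :
  (forall n, (n0 <= n)%N -> (A <= v n)%E) -> (A <= limn_einf v)%E.
Proof.
move=> h; rewrite limn_einf_lim; apply: lime_ge; first exact: is_cvg_einfs.
by exists n0 => // n /= n0n; apply: le_ereal_inf_tmp => _ [k /= nk <-]; apply: h; exact: leq_trans nk.
Qed.

Lemma limn_einf_le (v : nat -> \bar R) (A : \bar R) :
  (forall n, (v n <= A)%E) -> (limn_einf v <= A)%E.
Proof.
move=> h; rewrite limn_einf_lim; apply: lime_le; first exact: is_cvg_einfs.
apply: nearW => n; apply: le_trans (h n); apply: ereal_inf_lbound; exists n => //=; exact: leqnn.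
Qed.

Definition gridpt a b m i : R := a + i%:R * ((b - a) / m.+1%:R).

Lemma gridptS a b m i : gridpt a b m i.+1 - gridpt a b m i = (b - a) / m.+1%:R.
Proof. by rewrite /gridpt -natr1; ring. Qed.

Lemma gridpt_le a b m i : a <= b -> gridpt a b m i <= gridpt a b m i.+1.
Proof. by move=> ab; rewrite -subr_ge0 gridptS divr_ge0 ?subr_ge0. Qed.

Lemma gridpt_last a b m : gridpt a b m m.+1 = b.
Proof. by rewrite /gridpt mulrCA divff ?mulr1 ?pnatr_eq0// addrC subrK. Qed.

(* The first cell is left out of the sums: in the application the approximating trajectories may start only
   inside it. *)
Lemma integral_le_cell_sup (w : nat -> R -> R) (F : R -> \bar R) a b B : a < b ->
  (forall k, locint (w k)) -> (forall s, a <= s <= b -> (0 <= F s)%E) ->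
  {ae mu, forall s, a <= s <= b -> forall M, (forall k, ((w k s)%:E <= M)%E) -> (F s <= M)%E} ->
  (forall m, \sum_(i < m) \big[Num.max/0]_(k < m)
     ivint (w k) (gridpt a b m i.+1) (gridpt a b m i.+2) <= B) ->
  (\int[mu]_(s in `[a, b]) F s <= B%:E)%E.
Proof.
move=> ab hw F0 hF hB.
pose h m : R := (b - a) / m.+1%:R.
have h0 m : 0 < h m by rewrite divr_gt0// subr_gt0.
pose q m i := \big[Num.max/0]_(k < m) ivint (w k) (gridpt a b m i.+1) (gridpt a b m i.+2).
have q0 m i : 0 <= q m i by exact: bigmax_ge_id.
pose cell m i := (`[gridpt a b m i.+1, gridpt a b m i.+2]%classic : set (measurableTypeR R)).
have mcell m i : measurable (cell m i) by exact: measurable_itv.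
have mucell m i : mu (cell m i) = (h m)%:E.
  rewrite /h -(gridptS a b m i.+1); apply: mu_itvcc; exact: gridpt_le (ltW ab).
(* On each cell, the largest of 0 and the averages of the first [m] functions [w k]. Its integral is
   at most the sum in [hB], and its lower limit dominates [F] almost everywhere. *)
pose psi m s : R := \sum_(i < m) q m i / h m * \1_(cell m i) s.
have mpsi1 m i : measurable_fun setT (fun s : measurableTypeR R => q m i / h m * (\1_(cell m i) s : R)).
  by apply: measurable_funM; [exact: measurable_cst|exact: measurable_indic].
have qh0 m i : 0 <= q m i / h m by exact: divr_ge0 (q0 m i) (ltW (h0 m)).
have psi1 m i s : 0 <= q m i / h m * (\1_(cell m i) s : R).
  by apply: mulr_ge0; [exact: qh0|rewrite indicE ler0n].
have psi0 m s : 0 <= psi m s by rewrite /psi; apply: sumr_ge0 => i _; exact: psi1.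
have mpsi m : measurable_fun `[a, b] (EFin \o psi m).
  by apply/measurable_EFinP; apply: measurable_funTS; apply: measurable_sum => i; exact: mpsi1.
have Ipsi m : (\int[mu]_(s in `[a, b]) (EFin \o psi m) s <= B%:E)%E.
  apply: le_trans (_ : (\sum_(i < m) (q m i)%:E <= B%:E)%E); last first.
    by rewrite sumEFin lee_fin; exact: hB.
  have -> : (\int[mu]_(s in `[a, b]) (EFin \o psi m) s =
     \int[mu]_(s in `[a, b]) (\sum_(i < m) (q m i / h m * \1_(cell m i) s)%:E))%E.
    by apply: eq_integral => s _; rewrite sumEFin.
  rewrite ge0_integral_sum//; last first.
  - by move=> i s _; rewrite lee_fin.
  - by move=> i; apply/measurable_EFinP; exact: measurable_funTS.
  apply: lee_sum => i _.
  have -> : (\int[mu]_(s in `[a, b]) (q m i / h m * \1_(cell m i) s)%:E =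
     (q m i / h m)%:E * \int[mu]_(s in `[a, b]) (\1_(cell m i) s)%:E)%E.
    under eq_integral do rewrite EFinM.
    apply: ge0_integralZl_EFin => //.
    by apply/measurable_EFinP; apply: measurable_funTS; exact: measurable_indic.
  rewrite integral_indic//.
  apply: (@le_trans _ _ ((q m i / h m)%:E * mu (cell m i))%E).
    apply: lee_wpmul2l; first by rewrite lee_fin; exact: qh0.
    by apply: (@le_measure _ _ _ mu); rewrite ?inE//; exact: measurableI.
  by rewrite mucell -EFinM divfK// gt_eqF.
have key : (\int[mu]_(s in `[a, b]) limn_einf (fun m => (EFin \o psi m) s) <= B%:E)%E.
  apply: le_trans (@fatou _ _ _ mu _ _ _ mpsi _) _ => //; last exact: limn_einf_le.
  by move=> n s _; rewrite lee_fin.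
apply: le_trans key; rewrite integral_mkcond [leRHS]integral_mkcond.
apply: ge0_ae_le_integral.
- by move=> s; rewrite patchE; case: ifPn => // /set_mem; rewrite /= in_itv; exact: F0.
- move=> s; rewrite patchE; case: ifPn => // _; apply: (@limn_einf_ge _ _ 0) => n _.
  by rewrite lee_fin.
have hst : {ae mu, forall s, forall k, a < s -> straddle (w k) s}.
  by apply: ae_foralln => k; exact: ae_straddle.
have ne (z : R) : {ae mu, forall s, s <> z}.
  exists [set z]; split; [exact: measurable_set1|exact: lebesgue_measure_set1|].
  by move=> s /= /contrapT.
apply: ae_imp (ae_and hst (ae_and hF (ne a))) => s [hs [hFs sa]].
rewrite !patchE; case: ifPn => // /set_mem; rewrite /= in_itv/= => sab.
have {}sa : a < s by case/andP: sab => as_ _; rewrite lt_neqAle as_ andbT eq_sym; exact/eqP.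
apply: hFs => // k; apply/lee_addgt0Pr => e e0; rewrite -leeBlDr//.
have [r r0 hr] := hs k sa e e0.
pose d := Num.min r (s - a); have d0 : 0 < d by rewrite lt_min r0 subr_gt0.
(* From [n0] on, [w k] takes part in the maximum, and the cells are shorter than [r] and than
   [s - a], so the cell containing [s] is not the omitted first one. *)
pose n0 := maxn k.+1 (Num.bound ((b - a) / d)).
apply: (@limn_einf_ge _ _ n0) => m; rewrite geq_max => /andP[km bm].
have hmd : h m < d.
  rewrite /h ltr_pdivrMr// mulrC -ltr_pdivrMr//.
  have := archi_boundP (divr_ge0 (ltW (eqbRL (subr_gt0 _ _) ab)) (ltW d0)).
  move=> /lt_le_trans; apply; rewrite ler_nat; exact: leqW.
have [hr1 hr2] : h m < r /\ h m < s - a by move: hmd; rewrite lt_min => /andP.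
have [i [im ci di]] : exists i : nat, [/\ (i < m)%N, gridpt a b m i.+1 <= s & s <= gridpt a b m i.+2].
  have ex : exists j, s <= gridpt a b m j by exists m.+1; rewrite gridpt_last; case/andP: sab.
  case: (ex_minnP ex) => j sj jmin; case: j sj jmin => [|[|i]] sj jmin.
  - by exfalso; move: sj; rewrite /gridpt mul0r addr0; lra.
  - by exfalso; move: sj; rewrite /gridpt mul1r -/(h m); lra.
  exists i; split => //.
    by apply: (jmin m.+1); rewrite gridpt_last; case/andP: sab.
  by rewrite leNgt; apply/negP => /ltW/jmin; rewrite ltnn.
rewrite -EFinB lee_fin.
have ch : gridpt a b m i.+2 - gridpt a b m i.+1 = h m by exact: gridptS.
apply: (@le_trans _ _ (q m i / h m)).
  rewrite ler_pdivlMr//.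
  apply: (@le_trans _ _ (ivint (w k) (gridpt a b m i.+1) (gridpt a b m i.+2))); last first.
    exact: (@le_bigmax _ _ _ _ _ (Ordinal km)).
  have := hr _ _ ci di ltac:(lra) ltac:(lra); rewrite ch ler_norml => /andP[+ _].
  rewrite mulrBl; lra.
rewrite /psi /= (bigD1 (Ordinal im))//= (_ : \1_(cell m i) s = 1); last first.
  rewrite indicE; have -> // : s \in cell m i by apply/mem_set; rewrite /cell /= in_itv/= ci di.
by rewrite mulr1 lerDl; apply: sumr_ge0 => l _.
Qed.
End CellSuprema.

(** * Passage to the limit in the cost *)

Section RunningLimit.
Context {R : realType} {N : nat}.
Notation vec := 'rV[R]_N.
Notation mu := (@lebesgue_measure R).

Lemma sum_cell_integral_le (f : R -> \bar R) a b t m j : a <= b -> t <= gridpt a b m 1 ->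
  (j <= m)%N -> measurable_fun setT f -> (forall s, t <= s <= b -> (0 <= f s)%E) ->
  (\sum_(i < j) \int[mu]_(s in `[gridpt a b m i.+1, gridpt a b m i.+2]) f s <=
   \int[mu]_(s in `[t, gridpt a b m j.+1]) f s)%E.
Proof.
move=> ab t1 + mf f0.
have tg i : t <= gridpt a b m i.+1.
  by elim: i => // i IH; apply: le_trans IH (gridpt_le _ _ ab).
have gb i : (i <= m.+1)%N -> gridpt a b m i <= b.
  move=> im; rewrite -[leRHS](gridpt_last a b m) lerD2l ler_wpM2r ?ler_nat//.
  by rewrite divr_ge0 ?subr_ge0.
elim: j => [_|j IH jm].
  rewrite big_ord0; apply: integral_ge0 => s; rewrite /= in_itv/= => /andP[ts sg].
  by apply: f0; rewrite ts (le_trans sg)// gb.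
rewrite big_ord_recr/= (@ge0_integral_itv_split _ f t (gridpt a b m j.+1))//.
- by apply: leeD; [apply: IH; exact: ltnW|].
- exact: gridpt_le.
- by move=> s /andP[ts sg]; apply: f0; rewrite ts (le_trans sg)// gb.
Qed.

Lemma near_natSinv_lt (e : R) : 0 < e -> \forall n \near \oo, (n.+1%:R : R)^-1 < e.
Proof. by move=> e0; exact: (near_infty_natSinv_lt (PosNum e0)). Qed.

Variables (H : R -> vec -> vec -> R) (g : vec -> \bar R) (K a t0 T : R).
Variables (t : nat -> R) (x u : nat -> R -> vec) (y v : R -> vec).
Hypotheses (cH : continuous (fun z : R * vec * vec => H z.1.1 z.1.2 z.2)).
Hypotheses (gN : forall z, g z != -oo%E) (lg : lower_semicontinuous g).
Hypotheses (K0 : 0 <= K) (t0leT : t0 <= T) (tT : forall n, t n <= T) (tt0 : t @ \oo --> t0).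
Hypotheses (xu : forall n, traj (t n) T (x n) (u n)) (yv : traj t0 T y v).
Hypothesis hKx : forall n s, t n <= s <= T -> ((- K)%:E <= Hstar H s (x n s) (u n s))%E.
Hypothesis hKy : forall s, t0 <= s <= T -> ((- K)%:E <= Hstar H s (y s) (v s))%E.
Hypothesis xy : forall n s, t n <= s -> t0 <= s -> s <= T -> enorm (x n s - y s) <= n.+1%:R^-1.
Hypothesis cost_lt : forall n,
  (g (x n T) + running H (t n) T (x n) (u n) < (a + n.+1%:R^-1)%:E)%E.

(** Lower semicontinuity of [g] gives [g (x n T) > b] for large [n], which leaves less than [a - b],
    up to a vanishing error, for the running cost. A real [b] is used because [g (y T)] may be
    [+oo]. *)
Lemma near_shifted_running b e : (b%:E < g (y T))%E -> 0 < e -> \forall n \near \oo,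
  (\int[mu]_(s in `[t n, T]) (Hstar H s (x n s) (u n s) + K%:E) <=
   (a - b + K * (T - t0) + e)%:E)%E.
Proof.
move=> bg e0; have e20 : 0 < e / 2 by rewrite divr_gt0.
have eK0 : 0 < e / (2 * (K + 1)) by rewrite divr_gt0// mulr_gt0// ltr_wpDl.
have [U /nbhs_enormP[d d0 hd] hU] := @lg (y T) b bg.
have n1 := near_natSinv_lt d0; have n2 := near_natSinv_lt e20.
have n3 : \forall n \near \oo, `|t0 - t n| < e / (2 * (K + 1)).
  by move/cvgrPdist_lt : tt0 => /(_ _ eK0).
near=> n.
have xyT : enorm (x n T - y T) <= n.+1%:R^-1 by exact: xy.
have bgn : (b%:E < g (x n T))%E by apply/hU/hd; apply: le_lt_trans xyT _; near: n.
have := cost_lt n; rewrite /running (integral_shift (tT n) K0 (measurable_running cH (xu n)) (@hKx n)).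
have : (n.+1%:R : R)^-1 < e / 2 by near: n.
have : `|t0 - t n| < e / (2 * (K + 1)) by near: n.
set r := (n.+1%:R : R)^-1; clearbody r; rewrite ltr_norml => /andP[_ h1] h2.
have hz : e / (2 * (K + 1)) * (2 * (K + 1)) = e by rewrite divfK// gt_eqF// mulr_gt0// ltr_wpDl.
have {}h1 : K * (t0 - t n) <= K * (e / (2 * (K + 1))) by rewrite ler_wpM2l// ltW.
have {h1 hz} h1 : K * (t0 - t n) <= e / 2.
  move: eK0 hz h1; set z := e / (2 * _); set w := K * (_ - _); clearbody z w => z0.
  rewrite mulrDr mulr1 mulrDr mulrCA [z * K]mulrC => hz; lra.
have : (0 <= \int[mu]_(s in `[t n, T]) (Hstar H s (x n s) (u n s) + K%:E))%E.
  by apply: integral_ge0 => s; rewrite /= in_itv/= => /hKx h; rewrite -leeBlDr// sub0e.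
move: bgn; set G := g _; set J := integral _ _ _; clearbody J; case: G => [G||//]; last first.
  by case: J.
case: J => [J||//]; last by [].
rewrite lte_fin => bG _; rewrite -EFinB -EFinD lte_fin lee_fin => h3.
move: h1 h3; rewrite !mulrBr; set A := K * T; set B := K * t0; set C := K * t n.
clearbody A B C; lra.
Unshelve. all: by end_near. Qed.

Lemma running_limit_le b : (b%:E < g (y T))%E -> (running H t0 T y v <= (a - b)%:E)%E.
Proof.
move=> bg; have [cy hv _] := yv.
have J0 n : (0 <= \int[mu]_(s in `[t n, T]) (Hstar H s (x n s) (u n s) + K%:E))%E.
  by apply: integral_ge0 => s; rewrite /= in_itv/= => /hKx h; rewrite -leeBlDr// sub0e.
(* Over a single point there are no cells; the claim becomes [b <= a], which holds because the
   shifted running costs are nonnegative. *)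
have [t0T'|t0T] : t0 = T \/ t0 < T by move: t0leT; rewrite le_eqVlt => /orP[/eqP|]; [left|right].
  rewrite -{1}t0T' running1 lee_fin; apply: ler_eps => e e0.
  have [n hn] := @filter_ex _ \oo _ _ (near_shifted_running bg e0).
  by have := le_trans (J0 n) hn; rewrite lee_fin t0T' subrr mulr0 addr0.
rewrite /running (integral_shift (ltW t0T) K0 (measurable_running cH yv) hKy) leeBlDr// -EFinD.
have [pk dense] := @rational_dense R N.
have lH k : locint (fun s => H s (y s) (pk k)) by apply: locint_continuous; exact: continuous_H_curve.
have lp k : locint (fun s => dotv (pk k) (v s)) by exact: locint_dotv.
have l1 k : locint (fun s => dotv (pk k) (v s) - H s (y s) (pk k)) by exact: locintB.
apply: (@integral_le_cell_sup R
  (fun k s => dotv (pk k) (v s) - H s (y s) (pk k) + cst K s)) => //.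
- by move=> k; apply: locintD => //; exact: locint_cst.
- by move=> s /hKy h; rewrite -leeBlDr// sub0e.
- apply: nearW => s _ M hM; rewrite -leeBrDr//.
  by apply: (Hstar_le_dense cH dense) => k; rewrite leeBrDr// -EFinD dotvC; exact: hM.
move=> m; apply: ler_eps => e e0.
pose h := (T - t0) / m.+1%:R; have h0 : 0 < h by rewrite divr_gt0 ?subr_gt0.
(* Each of the [m] cells may lose [e1]: half of it from [H] along [x n] instead of [y], and a
   quarter from each endpoint. The other [e / 2] is left for [near_shifted_running]. *)
pose e1 := e / 2 / m.+1%:R; have e10 : 0 < e1 by rewrite !divr_gt0.
pose e2 := e1 / (2 * (h + 1)); have e20 : 0 < e2 by rewrite divr_gt0// mulr_gt0// addr_gt0.
have e0' : 0 < e / 2 by rewrite divr_gt0.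
have n1 : \forall n \near \oo, forall k : 'I_m, forall s, t n <= s -> t0 <= s -> s <= T ->
    `|H s (x n s) (pk k) - H s (y s) (pk k)| < e2.
  apply: filter_forall => k.
  have cG : continuous (fun z : R * vec => H z.1 z.2 (pk k)).
    by move=> z; apply: (@cvg_H _ _ H cH _ (nbhs z)); [exact: cvg_fst|exact: cvg_snd|exact: cvg_cst].
  have [d d0 hd] := @uniform_near_graph _ _ (fun s z => H s z (pk k)) y t0 T e2 cG cy e20.
  have := near_natSinv_lt d0; apply: filterS => n nd s ts t0s sT.
  by apply: hd; rewrite ?t0s//; apply: le_lt_trans nd; exact: xy.
have n2 : \forall n \near \oo, forall k : 'I_m, enorm (pk k) * n.+1%:R^-1 <= e1 / 4.
  apply: filter_forall => k.
  have d0 : 0 < e1 / 4 / (enorm (pk k) + 1) by rewrite !divr_gt0// ltr_wpDl ?enorm_ge0.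
  have := near_natSinv_lt d0; apply: filterS => n; rewrite ltr_pdivlMr ?ltr_wpDl ?enorm_ge0//.
  have : 0 <= (n.+1%:R : R)^-1 by [].
  by set r := (n.+1%:R : R)^-1; clearbody r; rewrite mulrDr mulr1 mulrC; lra.
have n3 : \forall n \near \oo, t n <= gridpt t0 T m 1.
  move/cvgrPdist_lt : tt0 => /(_ _ h0); apply: filterS => n.
  by rewrite /gridpt mul1r -/h ltr_norml; lra.
have [n [[{}n1 {}n2] [{}n3 n4]]] := @filter_ex _ \oo _ _
  (filterI (filterI n1 n2) (filterI n3 (near_shifted_running bg e0'))).
have [cx hu _] := xu n.
have gS i := gridpt_le m i (ltW t0T).
have tg i : t n <= gridpt t0 T m i.+1.
  by elim: i => // i IH; apply: le_trans IH (gS _).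
have t0g i : t0 <= gridpt t0 T m i by elim: i => [|i /le_trans]; [rewrite /gridpt mul0r addr0|exact].
have gT i : (i <= m.+1)%N -> gridpt t0 T m i <= T.
  move=> im; rewrite -[leRHS](gridpt_last t0 T m) lerD2l ler_wpM2r ?ler_nat//; exact: ltW.
rewrite -lee_fin -sumEFin.
pose J i := (\int[mu]_(s in `[gridpt t0 T m i.+1, gridpt t0 T m i.+2])
  (Hstar H s (x n s) (u n s) + K%:E))%E.
apply: (@le_trans _ _ (\sum_(i < m) (J i + e1%:E))%E).
  apply: lee_sum => i _; set c := gridpt _ _ _ _; set d := gridpt _ _ _ _.
  have im1 : (i.+2 <= m.+1)%N by rewrite ltnS; exact: ltn_ord.
  have hKi s : c <= s <= d -> ((- K)%:E <= Hstar H s (x n s) (u n s))%E.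
    by move=> /andP[cs sd]; apply: hKx; rewrite (le_trans (tg _) cs) (le_trans sd (gT _ im1)).
  (* The entry 0 of the maximum is covered by nonnegativity of the shifted integrand, the others by
     Fenchel's inequality along [x n] with the slope [pk k]. *)
  apply: (big_ind (fun z => (z%:E <= J i + e1%:E)%E)).
  - rewrite adde_ge0 ?lee_fin ?(ltW e10)//; apply: integral_ge0 => s.
    by rewrite /= in_itv/= => /hKi hs; rewrite -leeBlDr// sub0e.
  - by move=> z1 z2; case: (leP z1 z2).
  move=> k _.
  have xui : traj c d (x n) (u n) by apply: traj_sub (xu n) _ _; [exact: tg|exact: gT].
  have := running_shift_fenchel cH (pk k) (gS i.+1) xui hKi; rewrite -/(J i) -/c -/d => h1.
  rewrite -leeBlDr// -EFinB; apply: le_trans h1; rewrite lee_fin.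
  rewrite ivintD//; last exact: locint_cst.
  rewrite ivintB// ivint_cst; last exact: gS.
  have yvi : traj c d y v by apply: traj_sub yv _ _; [exact: t0g|exact: gT].
  rewrite -(traj_dotv (pk k) yvi) //; last exact: gS.
  have hx : locint (fun s => H s (x n s) (pk k)) by apply: locint_continuous; exact: continuous_H_curve.
  have hH : ivint (fun s => H s (x n s) (pk k)) c d <= ivint (fun s => H s (y s) (pk k)) c d + e1 / 2.
    apply: (@le_trans _ _ (ivint (fun s => H s (y s) (pk k) + cst e2 s) c d)).
      apply: ivint_le => //; first by apply: locintD => //; exact: locint_cst.
      move=> s /andP[cs sd] /=.
      have := n1 k s (le_trans (tg _) cs) (le_trans (t0g _) cs) (le_trans sd (gT _ im1)).
      by rewrite ltr_norml => /andP[_ /ltW]; rewrite lerBlDl.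
    rewrite ivintD//; last exact: locint_cst.
    rewrite ivint_cst; last exact: gS.
    rewrite lerD2l (_ : d - c = h); last exact: gridptS.
    have : e2 * (2 * (h + 1)) = e1 by rewrite divfK// gt_eqF// mulr_gt0// addr_gt0.
    by clearbody e2 h e1; rewrite mulrDr mulr1 mulrDr mulrCA; lra.
  have hp z : t n <= z -> t0 <= z -> z <= T ->
      `|dotv (pk k) (x n z) - dotv (pk k) (y z)| <= e1 / 4.
    move=> tz t0z zT; rewrite -dotvBr; apply: le_trans (normr_dotv_le _ _) _.
    by apply: le_trans (n2 k); rewrite ler_wpM2l ?enorm_ge0// xy.
  have := hp c (tg _) (t0g _) (le_trans (gS _) (gT _ im1)).
  have := hp d (tg _) (t0g _) (gT _ im1).
  rewrite !dotvBr !ler_norml.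
  move: hH; set A1 := ivint _ _ _; set A2 := ivint _ _ _; clearbody A1 A2; lra.
rewrite big_split/= sumEFin sumr_const card_ord.
have JT : (\sum_(i < m) J i <= (a - b + K * (T - t0) + e / 2)%:E)%E.
  apply: le_trans n4; rewrite -[in X in `[_, X]](gridpt_last t0 T m).
  apply: (@sum_cell_integral_le _ t0 T (t n) m m) => //.
    by apply: emeasurable_funD; [exact: (measurable_running cH (xu n))|exact: measurable_cst].
  by move=> s /hKx hs; rewrite -leeBlDr// sub0e.
apply: le_trans (leeD2r _ JT) _; rewrite -EFinD lee_fin.
have : e1 *+ m <= e / 2.
  have : e1 *+ m.+1 = e / 2 by rewrite -mulr_natr divfK// pnatr_eq0.
  rewrite mulrSr; lra.
lra.
Qed.

(** If [g (y T)] were [+oo], every real [b] would be allowed in [running_limit_le] and the running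
    cost would be [-oo], which its lower bound excludes. For finite [g (y T)], let [b] increase to
    it. *)
Lemma limit_cost_le : (g (y T) + running H t0 T y v <= a%:E)%E.
Proof.
have rN : running H t0 T y v != -oo%E by exact: running_gtNy.
move: (gN (y T)) running_limit_le; case: (g (y T)) => [r||//] _ hr.
- apply/lee_addgt0Pr => e e0; have /hr : ((r - e)%:E < r%:E)%E by rewrite lte_fin gtrBl.
  case: (running H t0 T y v) rN => [w _||//]; last by [].
  by rewrite -!EFinD !lee_fin; lra.
- case: (running H t0 T y v) rN hr => [w _|_|//] hr.
    by have := hr (a - w + 1) (ltry (a - w + 1)); rewrite lee_fin => h; exfalso; lra.
  by have := hr 0 (ltry (0 : R)).
Qed.

End RunningLimit.

(** * Limits of trajectories with varying starting times *)

Section Compactness.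
Context {R : realType} {N : nat}.
Notation vec := 'rV[R]_N.

Lemma enorm_le_eps_eq (v w : vec) : (forall e, 0 < e -> enorm (v - w) <= e) -> v = w.
Proof.
move=> h; apply/eqP; rewrite -subr_eq0; apply/eqP/rowP => i; rewrite [RHS]mxE.
apply/eqP; rewrite -normr_le0; apply: ler_eps => e /h; rewrite add0r.
by apply: le_trans; exact: coord_le_enorm.
Qed.

Lemma clamp_max (a b s : R) : s <= b -> clamp a b s = Num.max a s.
Proof. by move=> sb; rewrite /clamp min_l. Qed.

(** The curves start at different times, so each is frozen at its initial value before [t n]; this
    keeps the common modulus given by [phi] and puts all of them on [[0, T]] for Ascoli's theorem.
    At [t0] the limit is [x0] because the modulus controls the gap between [t n] and [t0]. *)
Lemma trajectory_compactness (phi : R -> R) T M t0 (x0 : vec) (t : nat -> R) x u :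
  locint phi -> (forall s, 0 <= phi s) -> 0 <= t0 -> t0 <= T ->
  (forall n, 0 <= t n <= T) -> (forall n, `|t n - t0| <= n.+1%:R^-1) ->
  (forall n, traj (t n) T (x n) (u n)) -> (forall n, enorm (x n (t n) - x0) <= n.+1%:R^-1) ->
  (forall n s, t n <= s <= T -> enorm (x n s) <= M) ->
  (forall n c d, t n <= c -> c <= d -> d <= T -> enorm (x n d - x n c) <= ivint phi c d) ->
  exists y v (f : nat -> nat), [/\ traj t0 T y v, y t0 = x0 &
    forall k, (k <= f k)%N /\ forall s, t (f k) <= s -> t0 <= s -> s <= T ->
      enorm (x (f k) s - y s) <= k.+1%:R^-1].
Proof.
move=> lphi phi0 t00 t0T tT tt0 xu xt0 xM xphi.
have tT' n : t n <= T by case/andP: (tT n).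
have t0' n : 0 <= t n by case/andP: (tT n).
pose z n s := x n (clamp (t n) T s).
have zphi n c d : c <= d -> d <= T -> enorm (z n d - z n c) <= ivint phi c d.
  move=> cd dT; have cT := le_trans cd dT.
  have := clamp_le (t n) T cd; rewrite /z !clamp_max// => cd'.
  have [tc|ct] := leP (t n) c.
    by rewrite !max_r ?(le_trans tc)//; exact: xphi.
  have [td|dt] := leP (t n) d.
    apply: le_trans (xphi n _ _ (lexx _) td dT) _.
    by rewrite [leRHS](ivint_split lphi (ltW ct) td) lerDr; exact: ivint_ge0.
  by rewrite subrr enorm0; exact: ivint_ge0.
have equi e : 0 < e -> exists2 d, 0 < d & forall n s s', 0 <= s -> s <= s' -> s' <= T ->
    s' - s < d -> enorm (z n s' - z n s) <= e.
  move=> /(ivint_small 0 T lphi)[d d0 hd]; exists d => // n s s' s0 ss' s'T sd.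
  apply: le_trans (zphi n _ _ ss' s'T) _; apply: le_trans (ltW (hd _ _ s0 ss' s'T sd)).
  by apply: ivint_le => //; [exact: locint_norm|move=> r _; exact: ler_norm].
have zM n s : enorm (z n s) <= M by apply: xM; exact: clamp_in.
have [w [f hf]] := ascoli_subsequence zM equi.
have inv_small (e : R) : 0 < e -> exists k : nat, (k.+1%:R : R)^-1 < e.
  by move=> e0; have [k hk] := @filter_ex _ \oo _ _ (near_natSinv_lt e0); exists k.
have hw c d : t0 <= c -> c <= d -> d <= T -> enorm (w d - w c) <= ivint phi c d.
  move=> tc cd dT; apply: ler_eps => e e0.
  have e20 : 0 < e / 2 by rewrite divr_gt0.
  have [k hk] := inv_small _ e20; have [_ hfk] := hf k.
  have h1 : enorm (z (f k) c - w c) <= e / 2.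
    by apply: le_trans (ltW hk); apply: hfk; rewrite (le_trans t00 tc) (le_trans cd).
  have h2 : enorm (z (f k) d - w d) <= e / 2.
    by apply: le_trans (ltW hk); apply: hfk; rewrite (le_trans t00 (le_trans tc cd)).
  have := zphi (f k) c d cd dT; have := enorm_dist (w d) (z (f k) d) (w c).
  have := enorm_dist (z (f k) d) (z (f k) c) (w c).
  rewrite (enormB (w d) (z _ _)); lra.
have [v yv] := abs_cont_traj t0T (abs_cont_on_modulus lphi hw).
exists (fun s => w (clamp t0 T s)), v, f; split => //.
  rewrite clamp_id ?lexx//; apply: enorm_le_eps_eq => e e0.
  have e30 : 0 < e / 3 by rewrite divr_gt0.
  have [d d0 hd] := ivint_small 0 T lphi e30.
  have md : 0 < Num.min d (e / 3) by rewrite lt_min d0.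
  have [k] := inv_small _ md; rewrite lt_min => /andP[kd ke]; have [kf hfk] := hf k.
  have fk : ((f k).+1%:R : R)^-1 <= (k.+1%:R : R)^-1.
    by rewrite lef_pV2 ?posrE// ler_nat ltnS.
  have h1 : enorm (z (f k) t0 - w t0) <= e / 3.
    by apply: le_trans (ltW ke); apply: hfk; rewrite t00.
  have h2 : enorm (x (f k) (t (f k)) - x0) <= e / 3.
    by apply: le_trans (xt0 _) _; apply: le_trans fk (ltW ke).
  have h3 : enorm (z (f k) t0 - x (f k) (t (f k))) <= e / 3.
    rewrite /z clamp_max//; have [tt|tt] := leP (t (f k)) t0; last first.
      by rewrite subrr enorm0 ltW.
    apply: le_trans (xphi _ _ _ (lexx _) tt t0T) _; apply: le_trans (ltW (hd _ _ (t0' _) tt t0T _)).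
      by apply: ivint_le => //; [exact: locint_norm|move=> r _; exact: ler_norm].
    apply: le_lt_trans kd; apply: le_trans fk; apply: le_trans (tt0 _).
    by rewrite distrC ler_norm.
  have := enorm_dist (w t0) (z (f k) t0) x0.
  have := enorm_dist (z (f k) t0) (x (f k) (t (f k))) x0.
  rewrite (enormB (w t0) (z _ _)); lra.
move=> k; have [kf hfk] := hf k; split => // s ts t0s sT.
have := hfk s; rewrite /z !clamp_id ?ts ?t0s//; apply.
by rewrite (le_trans t00 t0s).
Qed.

End Compactness.

Section LowerSemicontinuity.
Context {R : realType} {N : nat}.
Notation vec := 'rV[R]_N.
Notation mu := (@lebesgue_measure R).
Variables (T : R) (H : R -> vec -> vec -> R) (c : R -> R) (g : vec -> \bar R).
Hypotheses (T0 : 0 <= T) (rH : regular_hamiltonian T H c).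
Hypotheses (pg : proper_ext g) (lg : lower_semicontinuous g).
Local Notation V := (value_function H g T).

(** Lower semicontinuity in sequential form. The near-optimal trajectories stay in one ball and
    share the modulus of [(1 + M) * c], so one constant [K] serves them and their limit. *)
Lemma value_function_closed t0 (x0 : vec) a (t : nat -> R) (z : nat -> vec) : 
  (forall n, 0 <= t n <= T) -> (forall n, `|t n - t0| <= n.+1%:R^-1) ->
  (forall n, enorm (z n - x0) <= n.+1%:R^-1) -> (forall n, (V (t n) (z n) <= a%:E)%E) ->
  0 <= t0 <= T /\ (V t0 x0 <= a%:E)%E.
Proof.
move=> tT tt0 zx0 Va; have [gN _] := pg.
have inv_small (e : R) : 0 < e -> exists k : nat, (k.+1%:R : R)^-1 < e.
  by move=> e0; have [k hk] := @filter_ex _ \oo _ _ (near_natSinv_lt e0); exists k.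
have t0T : 0 <= t0 <= T.
  apply/andP; split; apply: ler_eps => e /inv_small[k hk];
    have := tt0 k; have := tT k; rewrite ler_norml => /andP[h1 h2] /andP[h3 h4];
    move: hk h3 h4; set r := (k.+1%:R : R)^-1; clearbody r; lra.
split=> //.
have ex n : exists xu : (R -> vec) * (R -> vec), [/\ traj (t n) T xu.1 xu.2, xu.1 (t n) = z n &
    (g (xu.1 T) + running H (t n) T xu.1 xu.2 < (a + n.+1%:R^-1)%:E)%E].
  have : (V (t n) (z n) < (a + n.+1%:R^-1)%:E)%E.
    by apply: le_lt_trans (Va n) _; rewrite lte_fin ltrDl invr_gt0.
  by move=> /(value_function_lt (tT n))[x [u h]]; exists (x, u).
have {ex} [xu /all_and3[xu_traj xu0 xucost]] := choice ex.
pose x n := (xu n).1; pose u n := (xu n).2.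
have [M M0 hM] := trajectory_bound T0 rH (enorm x0 + 1).
have [K K0 hK] := Hstar_lower_bound rH M.
have bnd n : (forall s, t n <= s <= T -> enorm (x n s) <= M) /\
    {ae mu, forall s, t n <= s <= T -> enorm (u n s) <= (1 + M) * c s}.
  apply: (hM _ _ _ (tT n) (xu_traj n)).
    rewrite /x xu0; have := zx0 n; have := enorm_dist (z n) x0 0; rewrite !subr0.
    have : (n.+1%:R : R)^-1 <= 1 by rewrite invf_le1// ler1n.
    set r := (n.+1%:R : R)^-1; clearbody r; lra.
  have := xucost n; have := gN ((xu n).1 T); rewrite /x /u.
  case: (g _) => [r||//]; case: (running _ _ _ _ _) => [w||] //.
  by rewrite ltry.
pose phi s := (1 + M) * c s.
have lphi : locint phi by apply: locintZ; exact: rh_lint rH.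
have phi0 s : 0 <= phi s by rewrite mulr_ge0 ?addr_ge0// (rh_ge0 rH).
have [t00 t0T'] := andP t0T.
have xx0 n : enorm (x n (t n) - x0) <= n.+1%:R^-1 by rewrite /x xu0.
have [y [v [f [yv yt0 hf]]]] := trajectory_compactness lphi phi0 t00 t0T' tT tt0 xu_traj
  xx0 (fun n => (bnd n).1)
  (fun n => traj_modulus (xu_traj n) lphi (bnd n).2).
have fk k : ((f k).+1%:R : R)^-1 <= (k.+1%:R : R)^-1.
  by rewrite lef_pV2 ?posrE// ler_nat ltnS; have [] := hf k.
rewrite -yt0; apply: le_trans (value_function_le H g t0T yv) _.
have tfT k : t (f k) <= T by case/andP: (tT (f k)).
have hKx k s : t (f k) <= s <= T -> ((- K)%:E <= Hstar H s (x (f k) s) (u (f k) s))%E.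
  move=> sT; apply: hK; last exact: (bnd _).1.
  by case/andP: sT => ts ->; rewrite (le_trans _ ts)//; case/andP: (tT (f k)).
have x0M : enorm x0 <= M.
  apply: ler_eps => e /inv_small[k hk].
  have h1 : enorm (x k (t k)) <= M by apply: (bnd k).1; rewrite lexx; case/andP: (tT k).
  have := xx0 k; have := enorm_dist x0 (x k (t k)) 0; rewrite !subr0 (enormB x0 (x k _)).
  by move: hk; set r := (k.+1%:R : R)^-1; clearbody r; lra.
(* The approximating curves are close to [y] at [s] only once they have started, which is eventually
   the case for [s > t0]; at [t0] itself the bound is [x0M]. *)
have yM s : t0 < s -> s <= T -> enorm (y s) <= M.
  move=> ts sT; apply: ler_eps => e e0.
  have m0 : 0 < Num.min e (s - t0) by rewrite lt_min e0 subr_gt0.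
  have [k] := inv_small _ m0; rewrite lt_min => /andP[ke ks]; have [kf hk] := hf k.
  have tfs : t (f k) <= s.
    have := tt0 (f k); rewrite ler_norml => /andP[_]; move: (fk k) ks.
    by set r := (k.+1%:R : R)^-1; set r' := (_.+1%:R : R)^-1; clearbody r r'; lra.
  have := hk s tfs (ltW ts) sT; have h1 : enorm (x (f k) s) <= M by apply: (bnd _).1; rewrite tfs.
  have := enorm_dist (y s) (x (f k) s) 0; rewrite !subr0 (enormB (y s) (x _ _)).
  by move: ke; set r := (k.+1%:R : R)^-1; clearbody r; lra.
apply: (@limit_cost_le R N H g K a t0 T (fun k => t (f k)) (fun k => x (f k)) (fun k => u (f k)) y v) => //.
- exact: rh_cont rH.
- apply/cvgrPdist_lt => e e0; have := near_natSinv_lt e0; apply: filterS => k ke.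
  by rewrite distrC; apply: le_lt_trans (tt0 _) _; apply: le_lt_trans (fk k) ke.
- move=> s; rewrite le_eqVlt => /andP[/orP[/eqP <-|ts] sT]; apply: hK => //.
  + by rewrite yt0.
  + by rewrite (le_trans t00 (ltW ts)).
  + exact: yM.
- by move=> k s; have [_] := hf k; apply.
- move=> k; apply: lt_le_trans (xucost (f k)) _; rewrite lee_fin lerD2l; exact: fk.
Qed.

Lemma value_function_lsc : lower_semicontinuous (fun z : R * vec => ext T V z.1 z.2).
Proof.
move=> [t0 x0] a /= ha.
pose U (n : nat) : set (R * vec) := [set z | `|z.1 - t0| < n.+1%:R^-1 /\ enorm (z.2 - x0) < n.+1%:R^-1].
have nU n : nbhs ((t0, x0) : R * vec) (U n).
  have r0 : 0 < (n.+1%:R : R)^-1 by [].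
  exists ([set s | `|s - t0| < n.+1%:R^-1], [set x | enorm (x - x0) < n.+1%:R^-1]) => /=; last first.
    by move=> [s x] [].
  split; last by apply/nbhs_enormP; exists n.+1%:R^-1.
  by apply/nbhs_ballP; exists n.+1%:R^-1 => //= s; rewrite /ball/= distrC.
have [[n hn]|hno] := pselect (exists n, forall z, U n z -> (a%:E < ext T V z.1 z.2)%E).
  by exists (U n).
exfalso.
have {}hno n : exists z : R * vec, U n z /\ (ext T V z.1 z.2 <= a%:E)%E.
  apply: contrapT => hz; apply: hno; exists n => z Uz; rewrite ltNge; apply/negP => h.
  by apply: hz; exists z.
have {hno} [z hz] := choice hno.
have zT n : 0 <= (z n).1 <= T.
  by have [_] := hz n; rewrite /ext; case: ifP => // _; rewrite leye_eq.
have [t0T Va] : 0 <= t0 <= T /\ (V t0 x0 <= a%:E)%E.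
  apply: (@value_function_closed t0 x0 a (fun n => (z n).1) (fun n => (z n).2)) => //.
  - by move=> n; have [[/ltW]] := hz n.
  - by move=> n; have [[_ /ltW]] := hz n.
  - by move=> n; have [_] := hz n; rewrite /ext zT.
by move: ha; rewrite /ext t0T ltNge Va.
Qed.

End LowerSemicontinuity.

(** * Extension of the Hamiltonian in time *)

Section Extension.
Context {R : realType} {N : nat}.
Notation vec := 'rV[R]_N.
Notation mu := (@lebesgue_measure R).
Variables (T : R) (H : R -> vec -> vec -> R).
Hypothesis T0 : 0 <= T.

(** Time is frozen outside [[0, T]]: composing with a retraction onto the set where (H1) holds turns
    continuity within that set into continuity everywhere, and the values on [[0, T]], hence [V],
    are unchanged. *)
Definition time_extension (s : R) := H (clamp 0 T s).

Lemma regular_time_extension : H1 T H -> H2 T H -> H3 T H -> H4 T H ->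
  exists c, regular_hamiltonian T time_extension c.
Proof.
move=> h1 h2 h3 [c [c0 ic hc]].
(* Cutting [c] off outside [[0, T]] makes it integrable on the line and nonnegative everywhere. *)
pose c' s := if (0 <= s) && (s <= T) then c s else 0.
have cl s := clamp_in s T0.
have D_itv : [set t : R | 0 <= t <= T] = `[0, T]%classic.
  by apply/seteqP; split => s; rewrite /= in_itv.
exists c'; split.
- move=> z.
  have cclamp : continuous (clamp 0 T).
    move=> s; apply: (@continuous_max _ _ (fun=> 0) (fun s => Num.min s T)); first exact: cst_continuous.
    by apply: (@continuous_min _ _ (fun s => s) (fun=> T)); [exact: cvg_id|exact: cst_continuous].
  pose A := [set z : R * vec * vec | 0 <= z.1.1 <= T].
  pose P (z : R * vec * vec) : R * vec * vec := (clamp 0 T z.1.1, z.1.2, z.2).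
  have PA w : A (P w) by exact: cl.
  have cP : P @ nbhs z --> nbhs (P z).
    have c1 : (fun w : R * vec * vec => w.1.1) @ nbhs z --> nbhs z.1.1.
      exact: (cvg_comp fst fst (@cvg_fst _ _ _ _ _) (@cvg_fst _ _ _ _ _)).
    have c2 : (fun w : R * vec * vec => w.1.2) @ nbhs z --> nbhs z.1.2.
      exact: (cvg_comp fst snd (@cvg_fst _ _ _ _ _) (@cvg_snd _ _ _ _ _)).
    have c3 : (fun w : R * vec * vec => w.2) @ nbhs z --> nbhs z.2 by exact: cvg_snd.
    exact: (cvg_pair (cvg_pair (cvg_comp _ _ c1 (cclamp z.1.1)) c2) c3).
  have h1' : (fun z : R * vec * vec => H z.1.1 z.1.2 z.2) @ within A (nbhs (P z)) -->
      H (clamp 0 T z.1.1) z.1.2 z.2.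
    by have := h1 (P z); rewrite /continuous_at nbhs_subspace_in; [exact|exact: PA].
  move=> U /h1' hU.
  have h : nbhs z (fun w => A (P w) -> U (H (P w).1.1 (P w).1.2 (P w).2)) := cP _ hU.
  by apply: (@filterS _ (nbhs z) _ _ _ _ h) => w; apply; exact: PA.
- by move=> t x p q l; exact: h2.
- by move=> r /h3[C C0 hC]; exists C => // t x p q; exact: hC.
- apply: locint_integrable.
  have -> : EFin \o c' = (EFin \o c) \_ `[0, T]%classic.
    by apply/funext => s; rewrite patchE /c' /= mem_setE in_itv /=; case: ifP.
  by apply/integrable_restrict => //; rewrite setTI -D_itv.
- by move=> s; rewrite /c'; case: ifP => // /c0.
- apply: ae_imp hc => s hs sT x p q; rewrite /time_extension clamp_id// /c' sT.
  exact: hs.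
Qed.

Lemma Hstar_time_extension s x v : 0 <= s <= T -> Hstar time_extension s x v = Hstar H s x v.
Proof. by move=> sT; rewrite /Hstar /time_extension clamp_id. Qed.

Lemma value_function_time_extension g t x :
  value_function time_extension g T t x = value_function H g T t x.
Proof.
rewrite /value_function; case: ifP => [/andP[t0 tT]|//].
congr (ereal_inf _); apply: eq_imagel => y _; rewrite /cost; congr (_ + _)%E.
apply: eq_integral => s; rewrite inE /= => /andP[ts sT].
by rewrite Hstar_time_extension// (le_trans t0 ts).
Qed.

End Extension.

Theorem theorem5p6 (R : realType) (N : nat) (T : R) (hT : 0 < T)
    (H : R -> 'rV[R]_N -> 'rV[R]_N -> R) (g : 'rV[R]_N -> \bar R) :
  H1 T H -> H2 T H -> H3 T H -> H4 T H ->
  proper_ext g -> lower_semicontinuous g ->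
  lsc_solution H g T (value_function H g T).
Proof.
move=> h1 h2 h3 h4 pg lg; have T0 := ltW hT.
have [c rH] := regular_time_extension T0 h1 h2 h3 h4.
have -> : value_function H g T = value_function (time_extension T H) g T.
  by apply/funext => t; apply/funext => x; rewrite value_function_time_extension.
split.
- exact: value_function_lsc rH pg lg.
- by move=> t x; exact: (value_function_gtNy T0 rH pg lg x).
- by move=> x; rewrite /value_function ltxx andbF eqxx.
move=> t x pt px tT Vfin hsub; have [t0 tT'] := andP tT; split => ht.
  have := supersolution T0 rH pg lg t0 ht Vfin hsub.
  by rewrite /time_extension clamp_id.
have := subsolution T0 rH pg lg ht tT' Vfin hsub.
by rewrite /time_extension clamp_id.
Qed.
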